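(* For $J,K\in\mathcal I_\lambda$ we have $$\sum_{I\in\mathcal I_\lambda}\frac{\widetilde W^{\mathrm{ell}}_{\mathrm{id},J}(z_I,z,h,\mu)\,\widetilde W^{\mathrm{ell}}_{\sigma_0,K}(z_I,z,h,h^\lambda\mu^{-1})}{R^{\mathrm{ell}}(z_I)\,Q^{\mathrm{ell}}(z_I,h)}=\delta_{J,K}.$$
   Context: Fix positive integers $n,N$ and $\lambda=(\lambda_1,\dots,\lambda_N)\in\mathbb Z_{\ge0}^N$ with $\sum_k\lambda_k=n$. Put $\lambda^{(k)}=\lambda_1+\dots+\lambda_k$, $\lambda^{\{1\}}=\lambda^{(1)}+\dots+\lambda^{(N-1)}$. $\mathcal I_\lambda$ is the set of ordered partitions $I=(I_1,\dots,I_N)$ of $\{1,\dots,n\}$ with $|I_k|=\lambda_k$; write $\bigcup_{j\le k}I_j=\{i^{(k)}_1<\dots<i^{(k)}_{\lambda^{(k)}}\}$; $\sigma(I)=(\sigma(I_1),\dots,\sigma(I_N))$. Let $p_{I,j}(m)=|I_j\cap\{1,\dots,m-1\}|$ and let $j(I,k,a)$ be the index $j$ with $i^{(k)}_a\in I_j$. $\sigma_0$ is the longest permutation in $S_n$. Theta function: $\operatorname{Im}\tau>0$, $q=e^{2\pi i\tau}$; for $x=e^{2\pi iu}$, $x^{1/2}=e^{\pi iu}$, $\vartheta(x)=(x^{1/2}-x^{-1/2})\phi(qx)\phi(q/x)$ with $\phi(x)=\prod_{s\ge0}(1-q^sx)$ (functions are considered on the universal cover of the torus of variables). Elliptic weight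 functions: variables $t=(t^{(k)}_a)$, $1\le k\le N-1$, $1\le a\le\lambda^{(k)}$; $z=(z_1,\dots,z_n)$ with $t^{(N)}_a=z_a$; $h$; $\mu=(\mu_1,\dots,\mu_N)$. $$W^{\mathrm{ell}}_I(t,z,h,\mu)=\vartheta(h)^{\lambda^{\{1\}}}\operatorname{Sym}_{t^{(1)}}\cdots\operatorname{Sym}_{t^{(N-1)}}\prod_{k=1}^{N-1}\prod_{a=1}^{\lambda^{(k)}}\Big(\prod_{c=1}^{\lambda^{(k+1)}}\psi^{\mathrm{ell}}_{I,k,a,c}(t^{(k+1)}_c/t^{(k)}_a)\prod_{b=a+1}^{\lambda^{(k)}}\frac{\vartheta(ht^{(k)}_b/t^{(k)}_a)}{\vartheta(t^{(k)}_b/t^{(k)}_a)}\Big),$$ where $\operatorname{Sym}_{t^{(k)}}$ is the sum over all permutations of $t^{(k)}_1,\dots,t^{(k)}_{\lambda^{(k)}}$, and $\psi^{\mathrm{ell}}_{I,k,a,c}(x)$ equals $\vartheta(hx)$ if $i^{(k+1)}_c<i^{(k)}_a$; $\vartheta(x)$ if $i^{(k+1)}_c>i^{(k)}_a$; and $\vartheta(x\,h^{1+p_{I,j}(i^{(k)}_a)-p_{I,k+1}(i^{(k)}_a)}\mu_{k+1}/\mu_j)\big/\vartheta(h^{1+p_{I,j}(i^{(k)}_a)-p_{I,k+1}(i^{(k)}_a)}\mu_{k+1}/\mu_j)$ with $j=j(I,k,a)$ if $i^{(k+1)}_c=i^{(k)}_a$. For $\sigma\in S_n$, $W^{\mathrm{ell}}_{\sigma,I}(t,z,h,\mu)=W^{\mathrm{ell}}_{\sigma^{-1}(I)}(t,z_{\sigma(1)},\dots,z_{\sigma(n)},h,\mu)$,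 and $$\widetilde W^{\mathrm{ell}}_{\sigma,I}=W^{\mathrm{ell}}_{\sigma,I}/E^{\mathrm{ell}}_\lambda,\qquad E^{\mathrm{ell}}_\lambda(t,h)=\prod_{k=1}^{N-1}\prod_{a,b=1}^{\lambda^{(k)}}\vartheta(ht^{(k)}_b/t^{(k)}_a).$$ $f(z_I,z,\dots)$ denotes the substitution $t^{(k)}_a=z_{i^{(k)}_a}$ for all $k,a$. Finally $h^\lambda\mu^{-1}=(h^{\lambda_1}\mu_1^{-1},\dots,h^{\lambda_N}\mu_N^{-1})$ and $$R^{\mathrm{ell}}(z_I)=\prod_{k<l}\prod_{a\in I_k}\prod_{b\in I_l}\vartheta(z_b/z_a),\qquad Q^{\mathrm{ell}}(z_I,h)=\prod_{k<l}\prod_{a\in I_k}\prod_{b\in I_l}\vartheta(hz_b/z_a).$$ *)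

(* Defs.v *)
From HB Require Import structures.
From mathcomp Require Import all_boot all_order all_algebra all_fingroup.
From mathcomp Require Import complex.
From mathcomp Require Import filter reals topology normedtype sequences exp trigo.

Set Implicit Arguments.
Unset Strict Implicit.
Unset Printing Implicit Defensive.

Import Order.TTheory GRing.Theory Num.Theory.
Import numFieldNormedType.Exports.

Local Open Scope ring_scope.

(* Multiplicative variables are given by their logarithms: a complex number u  *)
(* stands for x = e^(2 pi i u), i.e. for a point of the universal cover of     *)
(* C^*. Products, quotients and powers of multiplicative variables are thus    *)
(* written as sums, differences and multiples of the additive ones.            *)

Section Theta.
Variable R : realType.
Implicit Types q x tau u w : R[i].

Definition cexp w : R[i] :=
  (expR (complex.Re w))%:C%C *
    (cos (complex.Im w) +i* sin (complex.Im w))%C.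

Definition e2pi u : R[i] := cexp ((2 * pi)%:C%C * 'i%C * u).

(* The limit is taken for the norm topology of the complex numbers, which      *)
(* MathComp-Analysis attaches to R[i]^o.                                       *)
Definition qphi q x : R[i] :=
  limn (fun m : nat => \prod_(s < m) (1 - q ^+ s * x) : R[i]^o).

(* e2pi (u / 2) is the branch x^(1/2) = e^(pi i u) determined by u. *)
Definition theta tau u : R[i] :=
  let q := e2pi tau in
  let x := e2pi u in
  (e2pi (u / 2) - (e2pi (u / 2))^-1) * qphi q (q * x) * qphi q (q / x).

End Theta.

(* Blocks, elements and positions are numbered from 0: block j is I_(j+1), and *)
(* t k a is t^(k)_(a+1). Levels are not shifted: level k is the union of the   *)
(* first k blocks, so block k is I_(k+1).                                      *)
Section OrderedPartitions.
Variables n N : nat.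
Implicit Types (lam : N.-tuple nat) (I : N.-tuple {set 'I_n}) (k j m a : nat).

Definition ordpart lam : {set N.-tuple {set 'I_n}} :=
  [set I : N.-tuple {set 'I_n} |
    [&& [forall k, #|tnth I k| == tnth lam k],
        [forall k, forall l, (k != l) ==> [disjoint tnth I k & tnth I l]]
      & \bigcup_(k < N) tnth I k == [set: 'I_n]]].

(* lambda^(k) and lambda^{1} *)
Definition lamsum lam k : nat := (\sum_(j < N | j < k) tnth lam j)%N.
Definition lamtot lam : nat := (\sum_(1 <= k < N) lamsum lam k)%N.

Definition level I k : {set 'I_n} := \bigcup_(j < N | (j < k)%N) tnth I j.

(* enum lists a subset of 'I_n in increasing order *)
Definition elt I k a : nat :=
  nth 0%N [seq val i | i <- enum (level I k)] a.

Definition pcount I j m : nat := #|[set i in nth set0 I j | (i < m)%N]|.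

Definition block I k a : nat :=
  find (fun A : {set 'I_n} => [exists i in A, val i == elt I k a]) I.

Definition permpart (s : 'S_n) I : N.-tuple {set 'I_n} :=
  map_tuple (fun A : {set 'I_n} => s @: A) I.

Definition longest : 'S_n := perm (@rev_ord_inj n).

End OrderedPartitions.

Section WeightFunctions.
Variable R : realType.
Variables n N : nat.
Variable tau : R[i].
Variable lam : N.-tuple nat.
Implicit Types (t : nat -> nat -> R[i]) (z : n.-tuple R[i]) (h u : R[i]).
Implicit Types (mu : N.-tuple R[i]) (I : N.-tuple {set 'I_n}).

Local Notation theta := (theta tau).
Local Notation L := (lamsum lam).

(* A family t of variables is read only at 1 <= k <= N-1 and a < lambda^(k).   *)

Definition permvar k (s : 'S_(L k)) t : nat -> nat -> R[i] := fun k' a =>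
  if k' == k then t k (oapp (fun i => val (s i)) a (insub a)) else t k' a.

Definition symvar k (f : (nat -> nat -> R[i]) -> R[i]) t : R[i] :=
  \sum_(s : 'S_(L k)) f (permvar s t).

Definition withz t z : nat -> nat -> R[i] := fun k a =>
  if k == N then z`_a else t k a.

(* logarithm of h^(1 + p_{I,j}(i) - p_{I,k+1}(i)) mu_{k+1} / mu_j for          *)
(* i = i^(k)_a and j = j(I,k,a)                                                *)
Definition dynarg I k a h mu : R[i] :=
  let i := elt I k a in
  let j := block I k a in
  (1 + (pcount I j i)%:R - (pcount I k i)%:R) * h + mu`_k - mu`_j.

Definition psi I k a c h mu u : R[i] :=
  let i := elt I k a in
  let i' := elt I k.+1 c in
  if (i' < i)%N then theta (h + u)
  else if (i < i')%N then theta u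
  else theta (u + dynarg I k a h mu) / theta (dynarg I k a h mu).

Definition Wsummand I z h mu t : R[i] :=
  let T := withz t z in
  \prod_(1 <= k < N) \prod_(0 <= a < L k)
    ((\prod_(0 <= c < L k.+1) psi I k a c h mu (T k.+1 c - T k a)) *
     \prod_(a.+1 <= b < L k)
       (theta (h + T k b - T k a) / theta (T k b - T k a))).

Definition Well I t z h mu : R[i] :=
  theta h ^+ lamtot lam *
    foldr symvar (Wsummand I z h mu) (index_iota 1 N) t.

Definition Wellperm (s : 'S_n) I t z h mu : R[i] :=
  Well (permpart s^-1%g I) t [tuple z`_(s a) | a < n] h mu.

Definition Eell t h : R[i] :=
  \prod_(1 <= k < N) \prod_(0 <= a < L k) \prod_(0 <= b < L k)
    theta (h + t k b - t k a).

Definition Welltilde s I t z h mu : R[i] := Wellperm s I t z h mu / Eell t h.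

(* t = z_I *)
Definition substz I z : nat -> nat -> R[i] := fun k a => z`_(elt I k a).

Definition Rell I z : R[i] :=
  \prod_(k < N) \prod_(l < N | (k < l)%N)
    \prod_(a in tnth I k) \prod_(b in tnth I l) theta (z`_b - z`_a).

Definition Qell I z h : R[i] :=
  \prod_(k < N) \prod_(l < N | (k < l)%N)
    \prod_(a in tnth I k) \prod_(b in tnth I l) theta (h + z`_b - z`_a).

(* h^lambda mu^-1 *)
Definition dualmu h mu : N.-tuple R[i] :=
  [tuple (tnth lam k)%:R * h - tnth mu k | k < N].

(* The denominators of psi, the only ones depending on mu, do not vanish. *)
Definition dyn_regular I h mu : Prop :=
  forall k a : nat, (1 <= k < N)%N -> (a < L k)%N ->
    theta (dynarg I k a h mu) != 0.

End WeightFunctions.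

(* Main.v *)
(* Apart from oddness, the only property of theta that matters is Weierstrass'
three-term relation. By the q-binomial theorem the truncated product for theta is
a weighted Gaussian sum over half-integers, so that theta is, up to a constant,
the limit of the alternating sums of e^(pi i tau a^2 + 2 pi i a u). With the new
indices p = a + b and q = a - b, the product theta(u + v) theta(u - v) becomes a
limit of determinants E(u) O(v) - O(u) E(v), and the three-term relation is the
Pluecker relation between such determinants.

An ordered partition is encoded by the word of the block indices of 1, ..., n.
This makes the weight functions recursive in the number of levels, and the
three-term relation gives, by induction on the levels, an exchange relation:
interchanging two adjacent variables of z amounts to applying a dynamical
R-matrix to the two words that differ by exchanging the corresponding letters.
The second factor of the theorem involves the inverse transposed R-matrix, so
sum_J W_(id,J)(t, z, h, mu) W_(sigma_0,J)(t', z, h, h^lambda mu^-1) is symmetric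
in z. For t = z_I and t' = z_(I') reorder z so that the blocks of I decrease: by
triangularity at most one term survives, and the sum is
delta_(I,I') E^2 R(z_I) Q(z_I). A left inverse of a square matrix is a right
inverse, which turns this into the sum over I. The dynamical denominators that
vanish for exceptional mu without occurring in the two given weight functions are
avoided by a small perturbation of mu. *)

Require Import Defs.
From HB Require Import structures.
From mathcomp Require Import boolp classical_sets ring lra zify.
From mathcomp Require Import all_boot all_order all_algebra all_fingroup.
From mathcomp Require Import complex.
From mathcomp Require Import filter reals topology normedtype sequences exp trigo.

Set Implicit Arguments.
Unset Strict Implicit.
Unset Printing Implicit Defensive.

Import Order.TTheory GRing.Theory Num.Theory.
Import numFieldNormedType.Exports.

Local Open Scope ring_scope.

(** * Exchanging two adjacent variables *)

(** In the weight of a word the lower variables enter only as multisets, through sums over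
    [permutations]. Reordering [z] therefore leaves the evaluation points z_I and z_I' alone; this
    is what makes symmetry in [z] usable. For the reordered [z] the two factors play different
    parts: the first vanishes at z_I for every word but the sorted one, which collapses the sum over
    words, and the second, now taken at that single word, vanishes unless I' has the same levels as
    I.

    Regularity of the denominators of the two given words is too weak for this argument, because the
    exchange relations and the matrix inversion pass through all words of the same content; hence
    the stronger condition [dyn_generic]. The perturbation of mu that provides it runs in the
    imaginary direction: what the product formula readily gives about a zero of theta is that its
    imaginary part is an integer multiple of Im tau, so a small vertical move from any point avoids
    all zeros. *)

Definition three_term (F : numFieldType) (th : F -> F) : Prop :=
  forall p q r s e, e + e = p + q + r + s ->
  th p * th q * th r * th s =
  th e * th (e - r - s) * th (e - q - s) * th (e - q - r) +
  th (e - p) * th (e - q) * th (e - r) * th (e - s).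

Section ThetaIdentities.
Variables (F : numFieldType) (th : F -> F).
Hypothesis th_odd : forall u, th (- u) = - th u.
Hypothesis th_fay : three_term th.
Variable h : F.

(** The theta factors of two neighbouring letters, without the denominators and without the factor
    joining their own variables [x1] and [x2]; [A] and [C] are the dynamical arguments of the first
    and of the second letter. *)
Definition pair_numerator A C x1 x2 y1 y2 :=
  th (y1 - x1 + A) * th (y2 - x1) * th (h + y1 - x2) * th (y2 - x2 + C).

(** Divided by the first term on the right, this is unitarity of the dynamical R-matrix: an exchange
    with spectral parameter [w] followed by one with [- w] is trivial. It is used in [exch_diag] and
    again in [exch_dual]. *)
Lemma unitarity P w :
  th h ^+ 2 * (th (P - w) * th (P + w)) =
  th P ^+ 2 * (th (h + w) * th (h - w)) + th w ^+ 2 * (th (P - h) * th (P + h)).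
Proof.
have H := @th_fay (P + w) (P - w) h h (P + h) ltac:(ring).
rewrite (_ : P + h - h - h = P - h) in H; last by ring.
rewrite (_ : P + h - (P - w) - h = w) in H; last by ring.
rewrite (_ : P + h - (P + w) = h - w) in H; last by ring.
rewrite (_ : P + h - (P - w) = h + w) in H; last by ring.
rewrite (_ : P + h - h = P) in H; last by ring.
transitivity (th (P + w) * th (P - w) * th h * th h); first by ring.
rewrite H; ring.
Qed.

Section Local.
Variables (A C x1 x2 y1 y2 : F).
Let P := A - C.
Let v := x1 - x2.
Let w := y1 - y2.

(** A [pair_numerator] is a pair of factors with dynamical arguments times a pair without. This
    instance of the three-term relation treats the first kind, [fay_stat] the second. *)
Lemma fay_dyn :
  th (P - w) * th v * th (y1 - x2 + A) * th (y2 - x1 + C) +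
  th w * th (P + v) * th (y1 - x2 + C) * th (y2 - x1 + A) =
  th P * th (v + w) * th (y1 - x1 + C) * th (y2 - x2 + A).
Proof.
have H := @th_fay P (v + w) (y1 - x1 + C) (y2 - x2 + A)
  (y1 - x2 + A) ltac:(rewrite /P /v /w; ring).
rewrite H (_ : y1 - x2 + A - (y1 - x1 + C) - (y2 - x2 + A) = - (y2 - x1 + C));
  last by ring.
rewrite (_ : _ - _ - (y2 - x2 + A) = - v); last by rewrite /v /w; ring.
rewrite (_ : _ - _ - (y1 - x1 + C) = P - w); last by rewrite /P /v /w; ring.
rewrite (_ : _ - P = y1 - x2 + C); last by rewrite /P; ring.
rewrite (_ : _ - (v + w) = y2 - x1 + A); last by rewrite /v /w; ring.
rewrite (_ : _ - (y1 - x1 + C) = P + v); last by rewrite /P /v; ring.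
rewrite (_ : _ - (y2 - x2 + A) = w); last by rewrite /w; ring.
rewrite !th_odd; ring.
Qed.

Lemma fay_stat :
  th (h + w) * th v * th (y1 - x2) * th (h + y2 - x1) =
  th h * th (v + w) * th (y2 - x2) * th (h + y1 - x1) -
  th w * th (h - v) * th (y2 - x1) * th (h + y1 - x2).
Proof.
have H := @th_fay (h + w) v (y1 - x2) (h + y2 - x1)
  (h + y1 - x2) ltac:(rewrite /v /w; ring).
have e1 : h + y1 - x2 - (y1 - x2) - (h + y2 - x1) = - (y2 - x1) by ring.
have e2 : h + y1 - x2 - v - (h + y2 - x1) = w by rewrite /v /w; ring.
have e3 : h + y1 - x2 - v - (y1 - x2) = h - v by rewrite /v /w; ring.
have e4 : h + y1 - x2 - (h + w) = y2 - x2 by rewrite /w; ring.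
have e5 : h + y1 - x2 - v = h + y1 - x1 by rewrite /v; ring.
have e6 : h + y1 - x2 - (y1 - x2) = h by ring.
have e7 : h + y1 - x2 - (h + y2 - x1) = v + w by rewrite /v /w; ring.
rewrite H e1 e2 e3 e4 e5 e6 e7 th_odd; ring.
Qed.

(* exch_offdiag and exch_diag are the coefficients of g2 and of g1 in exch_both. *)
Lemma exch_offdiag :
  th P * th (h + w) * th v * pair_numerator A C x2 x1 y2 y1 =
  th h * th (P - w) * th v * pair_numerator A C x2 x1 y1 y2 +
  th w * (th h * th (P + v) * pair_numerator C A x2 x1 y1 y2 -
          th P * th (h - v) * pair_numerator C A x1 x2 y1 y2).
Proof.
have H1 := fay_dyn; have H2 := fay_stat; rewrite /pair_numerator.
transitivity (th P * th (y1 - x1 + C) * th (y2 - x2 + A) *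
  (th (h + w) * th v * th (y1 - x2) * th (h + y2 - x1))); first by ring.
rewrite H2.
transitivity (th h * th (y2 - x2) * th (h + y1 - x1) *
  (th P * th (v + w) * th (y1 - x1 + C) * th (y2 - x2 + A)) -
  th P * th (y1 - x1 + C) * th (y2 - x2 + A) *
  (th w * th (h - v) * th (y2 - x1) * th (h + y1 - x2))); first by ring.
rewrite -H1; ring.
Qed.

(** This is [fay_stat] with [x1] and [x2] exchanged, the signs being absorbed by oddness;
    [fay_dyn_sw] arises from [fay_dyn] in the same way. *)
Lemma fay_stat_sw :
  th (h + w) * th v * th (y1 - x1) * th (h + y2 - x2) =
  th h * th (v - w) * th (y2 - x1) * th (h + y1 - x2) +
  th w * th (h + v) * th (y2 - x2) * th (h + y1 - x1).
Proof.
have H := @th_fay (h + w) v (y1 - x1) (h + y2 - x2)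
  (h + y1 - x2) ltac:(rewrite /v /w; ring).
have e1 : h + y1 - x2 - (y1 - x1) - (h + y2 - x2) = - (y2 - x1) by ring.
have e2 : h + y1 - x2 - v - (h + y2 - x2) = - (v - w) by rewrite /v /w; ring.
have e3 : h + y1 - x2 - v - (y1 - x1) = h by rewrite /v /w; ring.
have e4 : h + y1 - x2 - (h + w) = y2 - x2 by rewrite /w; ring.
have e5 : h + y1 - x2 - v = h + y1 - x1 by rewrite /v; ring.
have e6 : h + y1 - x2 - (y1 - x1) = h + v by rewrite /v; ring.
have e7 : h + y1 - x2 - (h + y2 - x2) = w by rewrite /w; ring.
rewrite H e1 e2 e3 e4 e5 e6 e7 !th_odd; ring.
Qed.

Lemma fay_dyn_sw :
  th P * th (v - w) * th (y1 - x2 + C) * th (y2 - x1 + A) +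
  th (P - v) * th w * th (y1 - x1 + C) * th (y2 - x2 + A) =
  th (P - w) * th v * th (y1 - x1 + A) * th (y2 - x2 + C).
Proof.
have H := @th_fay (P - w) v (y1 - x1 + A) (y2 - x2 + C)
  (y2 - x2 + A) ltac:(rewrite /P /v /w; ring).
have e1 : y2 - x2 + A - (y1 - x1 + A) - (y2 - x2 + C) = - (y1 - x1 + C) by ring.
have e2 : y2 - x2 + A - v - (y2 - x2 + C) = P - v by rewrite /P; ring.
have e3 : y2 - x2 + A - v - (y1 - x1 + A) = - w by rewrite /v /w; ring.
have e4 : y2 - x2 + A - (P - w) = y1 - x2 + C by rewrite /P /w; ring.
have e5 : y2 - x2 + A - v = y2 - x1 + A by rewrite /v; ring.
have e6 : y2 - x2 + A - (y1 - x1 + A) = v - w by rewrite /v /w; ring.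
have e7 : y2 - x2 + A - (y2 - x2 + C) = P by rewrite /P; ring.
rewrite H e1 e2 e3 e4 e5 e6 e7 !th_odd; ring.
Qed.

Lemma exch_diag : th v != 0 ->
  th P * th h * th (P - v) * th (h + w) * pair_numerator A C x2 x1 y2 y1 -
  th P ^+ 2 * th (h - v) * th (h + w) * pair_numerator A C x1 x2 y2 y1 =
  th h ^+ 2 * th (P - w) * th (P - v) * pair_numerator A C x2 x1 y1 y2 -
  th P * th h * th (P - w) * th (h - v) * pair_numerator A C x1 x2 y1 y2 +
  th w * th v * th (P - h) * th (P + h) * pair_numerator C A x2 x1 y1 y2.
Proof.
(* Multiplied by th v, the identity is a linear combination of the four
   relations above and of unitarity. *)
move=> v0; apply: (mulfI v0); apply/eqP; rewrite -subr_eq0; apply/eqP.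
have sub0 (a b : F) : a = b -> a - b = 0 by move=> ->; exact: subrr.
have := (sub0 _ _ fay_stat_sw, sub0 _ _ fay_stat, sub0 _ _ fay_dyn,
  sub0 _ _ fay_dyn_sw, sub0 _ _ (unitarity P v)).
move=> [[[[HS HT] HD] HE] HU].
set Y := th (y1 - x2 + C) * th (y2 - x1 + A).
set Z := th (y1 - x1 + C) * th (y2 - x2 + A).
set U := th (y2 - x2) * th (h + y1 - x1).
set V := th (y2 - x1) * th (h + y1 - x2).
have := congr2 +%R (congr2 +%R (congr2 +%R (congr2 +%R
  (congr1 ( *%R (- th P ^+ 2 * th (h - v) * Y)) HS)
  (congr1 ( *%R (th P * th h * th (P - v) * Z)) HT))
  (congr1 ( *%R (- th h ^+ 2 * th (P - v) * U)) HD))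
  (congr1 ( *%R (- th P * th h * th (h - v) * V)) HE))
  (congr1 ( *%R (th w * Y * U)) HU).
rewrite !mulr0 !addr0 => {}HU; rewrite -[RHS]HU /pair_numerator /Y /Z /U /V; ring.
Qed.
End Local.
End ThetaIdentities.

Section LocalExchange.
Variables (F : numFieldType) (th : F -> F).
Hypothesis th_odd : forall u, th (- u) = - th u.
Hypothesis th_fay : three_term th.
Variable h : F.

(** Diagonal entry of Felder's dynamical R-matrix, with dynamical variable [P] and spectral
    parameter [w]; [bcoef] is the off-diagonal entry in a suitable gauge. *)
Definition acoef P w := th h * th (P - w) / (th P * th (h + w)).
(* b tells whether the first letter is the smaller one. The asymmetric factor is
   forced by the levels that contain only one of the two letters (exch_one1 and
   exch_one2); exch_both depends only on the product of the two values. *)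
Definition bcoef (b : bool) P w :=
  th w / th (h + w) * (if b then 1 else th (P - h) * th (P + h) / th P ^+ 2).

Definition pair_weight A C x1 x2 y1 y2 :=
  th (y1 - x1 + A) / th A *
  (th (h + y1 - x2) * th (y2 - x1) * (th (h + x2 - x1) / th (x2 - x1))) *
  (th (y2 - x2 + C) / th C).

Lemma pair_weightE A C x1 x2 y1 y2 : pair_weight A C x1 x2 y1 y2 =
  - pair_numerator th h A C x1 x2 y1 y2 * th (h - (x1 - x2)) /
  (th A * th C * th (x1 - x2)).
Proof.
rewrite /pair_weight /pair_numerator (_ : h + x2 - x1 = h - (x1 - x2)); last by ring.
by rewrite -(opprB x1 x2) th_odd !invfM invrN; ring.
Qed.

Lemma pair_weight_swapE A C x1 x2 y1 y2 : pair_weight A C x2 x1 y1 y2 =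
  pair_numerator th h A C x2 x1 y1 y2 * th (h + (x1 - x2)) /
  (th A * th C * th (x1 - x2)).
Proof. by rewrite /pair_weight /pair_numerator !invfM addrA; ring. Qed.

Lemma odd_at0 : th 0 = 0.
Proof.
have /eqP := th_odd 0; rewrite oppr0 -subr_eq0 opprK -mulr2n mulrn_eq0 /=.
by move/eqP.
Qed.

(** Here [g1] and [g2] stand for the lower weights of the two words, and [g1s], [g2s] for the same
    weights after the lower variables [x1], [x2] are exchanged, as an induction hypothesis supplies
    them. The identity carries the exchange relation from spectral parameter [v] on one level to [w]
    on the next. *)
Lemma exch_both b A C x1 x2 y1 y2 g1 g2 :
  let P := A - C in let v := x1 - x2 in let w := y1 - y2 in
  th A != 0 -> th C != 0 -> th P != 0 -> th v != 0 ->
  th (h + v) != 0 -> th (h + w) != 0 ->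
  let g1s := acoef P v * g1 + bcoef b P v * g2 in
  let g2s := acoef (- P) v * g2 + bcoef (~~ b) (- P) v * g1 in
  g1 * pair_weight A C x1 x2 y2 y1 + g1s * pair_weight A C x2 x1 y2 y1 =
  acoef P w * (g1 * pair_weight A C x1 x2 y1 y2 + g1s * pair_weight A C x2 x1 y1 y2) +
  bcoef b P w * (g2 * pair_weight C A x1 x2 y1 y2 + g2s * pair_weight C A x2 x1 y1 y2).
Proof.
move=> P v w A0 C0 P0 v0 hv0 hw0 g1s g2s.
have E1 := @exch_offdiag _ _ th_odd th_fay h A C x1 x2 y1 y2.
have E2 := @exch_diag _ _ th_odd th_fay h A C x1 x2 y1 y2 v0.
rewrite -/P -/v -/w in E1 E2.
rewrite !(pair_weightE _ _ x1 x2) !(pair_weight_swapE _ _ x1 x2) -/v {}/g1s {}/g2s /acoef /bcoef.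
have e1 : th (- P - v) = - th (P + v) by rewrite -th_odd; congr th; ring.
have e2 : th (- P - h) = - th (P + h) by rewrite -th_odd; congr th; ring.
have e3 : th (- P + h) = - th (P - h) by rewrite -th_odd; congr th; ring.
rewrite e1 e2 e3 !th_odd.
move: E1 E2.
set r1 := pair_numerator _ _ _ _ _ _ _ _; set r2 := pair_numerator _ _ _ _ _ _ _ _.
set r3 := pair_numerator _ _ _ _ _ _ _ _; set r4 := pair_numerator _ _ _ _ _ _ _ _.
set r5 := pair_numerator _ _ _ _ _ _ y2 y1; set r6 := pair_numerator _ _ A C x1 x2 y1 y2.
move: A0 C0 P0 v0 hv0 hw0.
move: (th A) (th C) (th P) (th v) (th (h + v)) (th (h + w)) (th h) (th w)
  (th (P - v)) (th (P + v)) (th (P - w)) (th (h - v)) (th (P - h)) (th (P + h))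
  r1 r2 r3 r4 r5 r6.
move=> tA tC tP tv thv thw t_h tw tPmv tPpv tPmw thmv tPmh tPph r1 r2 r3 r4 r5 r6.
move=> A0 C0 P0 v0 hv0 hw0 E1 E2.
apply/eqP; rewrite -subr_eq0; apply/eqP.
set kap := if b then 1 else _.
set kap' := if ~~ b then 1 else _.
have kk : kap * kap' = tPmh * tPph / tP ^+ 2.
  by rewrite {}/kap {}/kap'; case: b; rewrite ?mul1r ?mulr1 // ; field.
(* The difference of the two sides is linear in [g1] and [g2]: the [g1] part vanishes by [E2] and by
   the product formula [kk], the [g2] part by [E1]. *)
transitivity (g1 / (tP ^+ 2 * thw * tv * tA * tC) *
  ((tP * t_h * tPmv * thw * r1 - tP ^+ 2 * thmv * thw * r5) -
   (t_h ^+ 2 * tPmw * tPmv * r2 - tP * t_h * tPmw * thmv * r6 +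
    tw * tv * tPmh * tPph * r3)) +
  g1 * tw * r3 / (thw * tA * tC) * (tPmh * tPph / tP ^+ 2 - kap * kap') +
  g2 * kap / (tP * thw * tv * tA * tC) * (tP * thw * tv * r1 -
   (t_h * tPmw * tv * r2 + tw * (t_h * tPpv * r3 - tP * thmv * r4)))).
  by field; rewrite A0 C0 P0 v0 hv0 hw0.
by rewrite E1 E2 kk !subrr !mulr0 !addr0.
Qed.

(** For two equal letters the first raises the dynamical argument of the second by [h]. Thus
    [P = - h] in [exch_diag], and its last term, which contains [th (P + h)], drops out. *)
Lemma exch_equal A x1 x2 y1 y2 :
  th A != 0 -> th (A + h) != 0 -> th h != 0 -> th (x1 - x2) != 0 ->
  th (h + (y1 - y2)) != 0 ->
  pair_weight A (A + h) x1 x2 y2 y1 + pair_weight A (A + h) x2 x1 y2 y1 =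
  pair_weight A (A + h) x1 x2 y1 y2 + pair_weight A (A + h) x2 x1 y1 y2.
Proof.
move=> A0 C0 h0 v0 hw0.
have := @exch_diag _ _ th_odd th_fay h A (A + h) x1 x2 y1 y2 v0.
set v := x1 - x2 in v0 *; set w := y1 - y2 in hw0 *.
rewrite (_ : A - (A + h) = - h); last by ring.
rewrite addNr odd_at0 mulr0 mul0r addr0.
rewrite (_ : - h - v = - (h + v)); last by ring.
rewrite (_ : - h - w = - (h + w)); last by ring.
rewrite !(pair_weightE _ _ x1 x2) !(pair_weight_swapE _ _ x1 x2) -/v !th_odd => E.
apply/eqP; rewrite -subr_eq0; apply/eqP.
move: E; set r1 := pair_numerator _ _ _ _ _ _ _ _; set r2 := pair_numerator _ _ _ _ _ _ _ _.
set r3 := pair_numerator _ _ _ _ _ _ _ _; set r4 := pair_numerator _ _ _ _ _ _ _ _.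
move=> /eqP; rewrite -subr_eq0 => /eqP E.
transitivity ((th h ^+ 2 * th (h + w))^-1 / (th A * th (A + h) * th v) * 0); last by rewrite mulr0.
by rewrite -[in RHS]E; field; rewrite A0 C0 v0 h0 hw0.
Qed.

(** Only one of the two letters lies below the level, so there is a single own variable [x] and one
    instance of the three-term relation is enough. On the left-hand side the top letter comes second
    here and first in [exch_one2]. *)
Lemma exch_one1 P x y1 y2 : let w := y1 - y2 in
  th P != 0 -> th (P + h) != 0 -> th (h + w) != 0 ->
  th (y2 - x + (h + P)) / th (h + P) * th (y1 - x) =
  acoef P w * (th (y1 - x + (h + P)) / th (h + P) * th (y2 - x)) +
  bcoef true P w * (th (h + y1 - x) * (th (y2 - x + P) / th P)).
Proof.
move=> w P0 Ph0 hw0; rewrite /acoef /bcoef mulr1 -/w.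
have H := @th_fay (h + w) P (y2 - x + (h + P)) (y1 - x) (y1 - x + (h + P))
  ltac:(rewrite /w; ring).
have e1 : y1 - x + (h + P) - (y2 - x + (h + P)) - (y1 - x) = - (y2 - x) by ring.
have e2 : y1 - x + (h + P) - P - (y1 - x) = h by ring.
have e3 : y1 - x + (h + P) - P - (y2 - x + (h + P)) = - (P - w) by rewrite /w; ring.
have e4 : y1 - x + (h + P) - (h + w) = y2 - x + P by rewrite /w; ring.
have e5 : y1 - x + (h + P) - P = h + y1 - x by ring.
have e6 : y1 - x + (h + P) - (y2 - x + (h + P)) = w by rewrite /w; ring.
have e7 : y1 - x + (h + P) - (y1 - x) = h + P by ring.
rewrite e1 e2 e3 e4 e5 e6 e7 !th_odd in H.
rewrite [P + h]addrC in Ph0.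
transitivity ((th (h + w) * th P * th (y2 - x + (h + P)) * th (y1 - x)) /
   (th (h + w) * th P * th (h + P))); first by field; rewrite P0 Ph0 hw0.
by rewrite H; field; rewrite P0 Ph0 hw0.
Qed.

Lemma exch_one2 P x y1 y2 : let w := y1 - y2 in
  th P != 0 -> th (P + h) != 0 -> th (h + w) != 0 ->
  th (h + y2 - x) * (th (y1 - x + P) / th P) =
  acoef (- P) w * (th (h + y1 - x) * (th (y2 - x + P) / th P)) +
  bcoef false (- P) w * (th (y1 - x + (h + P)) / th (h + P) * th (y2 - x)).
Proof.
move=> w P0 Ph0 hw0; rewrite /acoef /bcoef -/w.
have H := @th_fay (h + w) P (h + y2 - x) (y1 - x + P) (h + y1 - x + P)
  ltac:(rewrite /w; ring).
have e1 : h + y1 - x + P - (h + y2 - x) - (y1 - x + P) = - (y2 - x) by ring.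
have e2 : h + y1 - x + P - P - (y1 - x + P) = - (P - h) by ring.
have e3 : h + y1 - x + P - P - (h + y2 - x) = w by rewrite /w; ring.
have e4 : h + y1 - x + P - (h + w) = y2 - x + P by rewrite /w; ring.
have e5 : h + y1 - x + P - P = h + y1 - x by ring.
have e6 : h + y1 - x + P - (h + y2 - x) = P + w by rewrite /w; ring.
have e7 : h + y1 - x + P - (y1 - x + P) = h by ring.
have e8 : h + y1 - x + P = y1 - x + (h + P) by ring.
rewrite e1 e2 e3 e4 e5 e6 e7 e8 !th_odd in H.
have f1 : th (- P - w) = - th (P + w) by rewrite -th_odd; congr th; ring.
have f2 : th (- P - h) = - th (h + P) by rewrite -th_odd; congr th; ring.
have f3 : th (- P + h) = - th (P - h) by rewrite -th_odd; congr th; ring.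
rewrite f1 f2 f3 th_odd; rewrite [P + h]addrC in Ph0.
transitivity ((th (h + w) * th P * th (h + y2 - x) * th (y1 - x + P)) /
   (th (h + w) * th P * th P)); first by field; rewrite P0 hw0.
by rewrite H; field; rewrite P0 Ph0 hw0.
Qed.
End LocalExchange.

(** * Weight functions of words *)

Section SwapSeq.
Variable T : eqType.
Implicit Types s : seq T.

(** The sequence is left unchanged when fewer than two entries remain from [p] on; this makes the
    map an involution on all sequences. *)
Definition swapat p s :=
  if drop p s is a :: b :: r then take p s ++ b :: a :: r else s.

Lemma swapat_cat p s1 a b s2 : size s1 = p ->
  swapat p (s1 ++ a :: b :: s2) = s1 ++ b :: a :: s2.
Proof. by move=> sz; rewrite /swapat drop_size_cat // take_size_cat. Qed.

Lemma swapatK p : involutive (swapat p).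
Proof.
move=> s; rewrite {2}/swapat; case E: (drop p s) => [|a [|b r]].
- by rewrite /swapat E.
- by rewrite /swapat E.
rewrite swapat_cat; first by rewrite -E cat_take_drop.
rewrite size_takel // leqNgt; apply/negP => /ltnW ps.
by rewrite drop_oversize in E.
Qed.

Lemma perm_swapat p s : perm_eq (swapat p s) s.
Proof.
rewrite /swapat; case E: (drop p s) => [|a [|b r]] //.
rewrite -[X in perm_eq _ X](cat_take_drop p s) E perm_cat2l.
by rewrite (perm_catCA [:: b] [:: a] r).
Qed.

Lemma perm_permutations_swapat p s :
  perm_eq (permutations s) (map (swapat p) (permutations s)).
Proof.
have inj := can_inj (swapatK p).
apply: uniq_perm; rewrite ?map_inj_uniq ?permutations_uniq // => r.
rewrite mem_permutations; apply/idP/mapP => [pr|[r' pr' ->]]; last first.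
  by rewrite (perm_trans (perm_swapat p r')) // -mem_permutations.
exists (swapat p r); rewrite ?swapatK // mem_permutations.
exact: perm_trans (perm_swapat p r) pr.
Qed.

(** Reindexing by the involution and adding both expressions gives twice the sum. This avoids
    choosing one member of each pair and also covers fixed points; characteristic 0 then removes the
    factor 2. *)
Lemma sum_permutations_swap_eq0 (F : numFieldType) p s (f : seq T -> F) :
  (forall r, perm_eq r s -> f r + f (swapat p r) = 0) ->
  \sum_(r <- permutations s) f r = 0.
Proof.
move=> f0; apply/eqP; rewrite -[_ == 0](mulrn_eq0 _ 2) mulr2n.
rewrite {2}(perm_big _ (perm_permutations_swapat p s)) /= big_map -big_split /=.
rewrite big_seq big1 // => r; rewrite mem_permutations; exact: f0.
Qed.

(** Adjacent transpositions move the head [x] of [s] to the front of [s']; the tails are then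
    compared by induction for the function [f \o cons x], which inherits the invariance. *)
Lemma swap_invariant_perm (A : Type) (f : seq T -> A) :
  (forall s1 a b s2, f (s1 ++ a :: b :: s2) = f (s1 ++ b :: a :: s2)) ->
  forall s s', perm_eq s s' -> f s = f s'.
Proof.
move=> fsw s s'; elim: s => [|x s IH] in f fsw s' *.
  by rewrite perm_sym => /perm_nilP ->.
move=> ps; have xs' : x \in s' by rewrite -(perm_mem ps) mem_head.
case/splitPr: s' / xs' ps => a b; rewrite perm_sym perm_catC cat_cons perm_cons.
rewrite perm_catC perm_sym => pb.
transitivity (f (x :: a ++ b)).
  by apply: (IH (f \o cons x)) => // s1 c d s2; exact: (fsw (x :: s1)).
elim/last_ind: a {pb} b => [//|a y IHa] b.
rewrite !cat_rcons IHa; exact: fsw.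
Qed.

Lemma split_seq m1 d m2 (xs : seq T) : size xs = (m1 + d + m2)%N ->
  exists xa xm xb, [/\ xs = xa ++ xm ++ xb, size xa = m1, size xm = d & size xb = m2].
Proof.
move=> sz; exists (take m1 xs), (take d (drop m1 xs)), (drop d (drop m1 xs)).
split; first by rewrite !cat_take_drop.
- by rewrite size_takel // sz -addnA leq_addr.
- by rewrite size_takel // size_drop sz -addnA addKn leq_addr.
- by rewrite !size_drop sz -addnA !addKn.
Qed.

End SwapSeq.

Section Words.
Variables (F : numFieldType) (th : F -> F) (h : F).
Hypothesis th_odd : forall u, th (- u) = - th u.
Hypothesis th_fay : three_term th.
Implicit Types (mu : nat -> F) (u v w : seq nat) (xs ys : seq F).
Implicit Types (t : nat -> seq F) (j k c : nat).

(* (c, x, y): a letter c, its own variable x and its variable y of the next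
   level. The top letter has no variable of its own: x is then a dummy. *)
Definition item := (nat * F * F)%type.
Implicit Types (i : item) (its : seq item).

(* The logarithm of h^(p_j - p_k) mu_k / mu_j, where p counts the letters of the
   prefix u. *)
Definition dyn_diff mu u j k : F :=
  ((count_mem j u)%:R - (count_mem k u)%:R) * h + mu k - mu j.

Definition own_factor mu k u i : F :=
  if (i.1.1 < k)%N then
    th (i.2 - i.1.2 + (h + dyn_diff mu u i.1.1 k)) / th (h + dyn_diff mu u i.1.1 k)
  else 1.

(** The item [i] stands to the left of [i']. The first factor is psi for the variable of [i']
    against an earlier element, the second is psi for the variable of [i] against a later one, and
    the third is the kernel of the symmetrization. *)
Definition pair_factor k i i' : F :=
  (if (i'.1.1 < k)%N then th (h + i.2 - i'.1.2) else 1) *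
  (if (i.1.1 < k)%N then th (i'.2 - i.1.2) else 1) *
  (if (i.1.1 < k)%N && (i'.1.1 < k)%N then
     th (h + i'.1.2 - i.1.2) / th (i'.1.2 - i.1.2) else 1).

(* The factors of W^ell that involve levels k and k.+1, with the letters read
   from left to right after the prefix u. *)
Fixpoint level_weight mu k u its : F :=
  if its is i :: r then
    own_factor mu k u i * (\prod_(i' <- r) pair_factor k i i') * level_weight mu k (rcons u i.1.1) r
  else 1.

Fixpoint level_items k w xs ys : seq item :=
  match w, ys with
  | c :: w', y :: ys' =>
    if (c < k)%N then (c, head 0 xs, y) :: level_items k w' (behead xs) ys'
    else (c, 0, y) :: level_items k w' xs ys'
  | _, _ => [::]
  end.

(* W_I^ell without the power of theta(h): w lists the blocks containing 1, 2, ...,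
   ys are the variables of level k and t those of the lower levels. *)
Fixpoint word_weight mu k w ys t : F :=
  if k is k'.+1 then
    \sum_(xs <- permutations (t k'))
      word_weight mu k' [seq c <- w | (c < k')%N] xs t *
      level_weight mu k' [::] (level_items k' w xs ys)
  else 1.

Lemma word_weightS mu k w ys t : word_weight mu k.+1 w ys t =
  \sum_(xs <- permutations (t k))
    word_weight mu k [seq c <- w | (c < k)%N] xs t * level_weight mu k [::] (level_items k w xs ys).
Proof. by []. Qed.
Arguments word_weight : simpl never.

Lemma dyn_diffC mu u j k : dyn_diff mu u k j = - dyn_diff mu u j k.
Proof. rewrite /dyn_diff; ring. Qed.

Lemma dyn_diff_perm mu u u' j k : perm_eq u u' -> dyn_diff mu u j k = dyn_diff mu u' j k.
Proof. by move=> /seq.permP p; rewrite /dyn_diff !p. Qed.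

Lemma level_weight_perm mu k u u' its : perm_eq u u' ->
  level_weight mu k u its = level_weight mu k u' its.
Proof.
elim: its u u' => [//|i r IH] u u' p /=.
rewrite /own_factor (dyn_diff_perm mu _ _ p) (IH _ (rcons u' i.1.1)) //.
by rewrite -!cats1 perm_cat2r.
Qed.

Lemma level_weight_cat mu k u a b : level_weight mu k u (a ++ b) =
  level_weight mu k u a * (\prod_(i <- a) \prod_(i' <- b) pair_factor k i i') *
  level_weight mu k (u ++ [seq i.1.1 | i <- a]) b.
Proof.
elim: a u => [|i a IH] u /=; first by rewrite big_nil cats0 !mul1r.
rewrite IH big_cat big_cons /= cat_rcons; ring.
Qed.

(** Everything in the weight of [a ++ m ++ b] except the internal factors of [m]. It depends on [m]
    only through products over its entries and the multiset of its letters, so an exchange inside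
    [m] reduces to the weight of a two-letter word. *)
Definition context_factor mu k a m b : F :=
  level_weight mu k [::] a * (\prod_(i <- a) \prod_(i' <- m) pair_factor k i i') *
  (\prod_(i <- a) \prod_(i' <- b) pair_factor k i i') *
  (\prod_(i' <- b) \prod_(i <- m) pair_factor k i i') *
  level_weight mu k ([seq i.1.1 | i <- a] ++ [seq i.1.1 | i <- m]) b.

Lemma level_weight_split mu k a m b : level_weight mu k [::] (a ++ m ++ b) =
  context_factor mu k a m b * level_weight mu k [seq i.1.1 | i <- a] m.
Proof.
rewrite !level_weight_cat /context_factor [X in _ = _ * X * _ * _]exchange_big /=.
under eq_bigr do rewrite big_cat.
rewrite big_split /=; ring.
Qed.

Lemma eq_context_factor mu k a m m' b :
  (forall i, \prod_(i' <- m) pair_factor k i i' = \prod_(i' <- m') pair_factor k i i') ->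
  (forall i', \prod_(i <- m) pair_factor k i i' = \prod_(i <- m') pair_factor k i i') ->
  perm_eq [seq i.1.1 | i <- m] [seq i.1.1 | i <- m'] ->
  context_factor mu k a m b = context_factor mu k a m' b.
Proof.
move=> e1 e2 p; rewrite /context_factor; congr (_ * _ * _ * _ * _).
- by apply: eq_bigr => i _.
- by apply: eq_bigr => i _.
- by apply: level_weight_perm; rewrite perm_cat2l.
Qed.

Lemma level_items_cat k w1 w2 x1 x2 y1 y2 :
  size y1 = size w1 -> size x1 = count (fun c => c < k)%N w1 ->
  level_items k (w1 ++ w2) (x1 ++ x2) (y1 ++ y2) = level_items k w1 x1 y1 ++ level_items k w2 x2 y2.
Proof.
elim: w1 x1 y1 => [|c w1 IH] x1 [|y y1] //=; first by move=> _ /size0nil ->.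
move=> [sy]; case: ifP => ck /=.
  by case: x1 => // x x1 /= [sx]; rewrite IH.
by move=> sx; rewrite IH.
Qed.

Lemma level_items_colors k w xs ys : size ys = size w ->
  [seq i.1.1 | i <- level_items k w xs ys] = w.
Proof.
elim: w xs ys => [|c w IH] xs [|y ys] //= [sz].
by case: ifP => _ /=; rewrite IH.
Qed.

(* No dynamical denominator vanishes, for any word of length at most M. *)
Definition dyn_generic mu M K := forall j k p q, (j < k < K)%N -> (p <= M)%N ->
  (q <= M)%N -> th ((p%:R - q%:R) * h + mu k - mu j) != 0.

Lemma dyn_genericW mu M M' K K' : (M' <= M)%N -> (K' <= K)%N ->
  dyn_generic mu M K -> dyn_generic mu M' K'.
Proof.
move=> lM lK g j k p q /andP[jk kK] pM qM.
by apply: g; rewrite ?jk ?(leq_trans _ lM) ?(leq_trans kK).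
Qed.

Lemma dyn_generic_diff mu M K u c1 c2 : dyn_generic mu M K -> (size u <= M)%N ->
  (c1 < K)%N -> (c2 < K)%N -> c1 != c2 -> th (dyn_diff mu u c1 c2) != 0.
Proof.
move=> g su k1 k2; rewrite neq_ltn => /orP[lt|lt].
  by apply: g; rewrite ?lt ?k2 ?(leq_trans (count_size _ _)).
rewrite dyn_diffC th_odd oppr_eq0.
by apply: g; rewrite ?lt ?k1 ?(leq_trans (count_size _ _)).
Qed.

(** The additional [h] acts as one more letter [j] in the prefix; hence the strict bound on the size
    of [u]. *)
Lemma dyn_generic_shift mu M K u j k : dyn_generic mu M K -> (size u < M)%N -> (j < k < K)%N ->
  th (h + dyn_diff mu u j k) != 0.
Proof.
move=> g su jk.
have -> : h + dyn_diff mu u j k =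
    ((count_mem j u).+1%:R - (count_mem k u)%:R) * h + mu k - mu j.
  by rewrite /dyn_diff -natr1; ring.
apply: g => //; first exact: leq_ltn_trans (count_size _ _) su.
exact: leq_trans (count_size _ _) (ltnW su).
Qed.

Definition regular_vars xs := [/\ uniq xs,
  {in xs &, forall a b, a != b -> th (a - b) != 0} &
  {in xs &, forall a b, th (h + (a - b)) != 0}].

Lemma regular_vars_perm xs xs' : perm_eq xs xs' -> regular_vars xs -> regular_vars xs'.
Proof.
move=> p [un d hd]; split; first by rewrite -(perm_uniq p).
  by move=> a b; rewrite -!(perm_mem p); exact: d.
by move=> a b; rewrite -!(perm_mem p); exact: hd.
Qed.

(** One row of the R-matrix: [g1] belongs to the word with the letters [c1], [c2] in this order,
    [g2] to the word with these two letters exchanged. *)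
Definition exch_rhs mu u c1 c2 y1 y2 (g1 g2 : F) : F :=
  if c1 == c2 then g1 else
  acoef th h (dyn_diff mu u c1 c2) (y1 - y2) * g1 +
  bcoef th h (c1 < c2)%N (dyn_diff mu u c1 c2) (y1 - y2) * g2.

Lemma level_weight_pair k c1 c2 x1 x2 y1 y2 mu u : (c1 < k)%N -> (c2 < k)%N ->
  level_weight mu k u [:: (c1, x1, y1); (c2, x2, y2)] =
  pair_weight th h (h + dyn_diff mu u c1 k) (h + dyn_diff mu (rcons u c1) c2 k) x1 x2 y1 y2.
Proof.
move=> l1 l2; rewrite /= big_seq1 big_nil /own_factor /pair_factor /pair_weight /= l1 l2 /= !mulr1.
reflexivity.
Qed.

Lemma dyn_diff_rcons mu u c j k : c != j -> c != k ->
  dyn_diff mu (rcons u c) j k = dyn_diff mu u j k.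
Proof.
by move=> cj ck; rewrite /dyn_diff -cats1 !count_cat /= (negPf cj) (negPf ck) !addn0.
Qed.

Lemma dyn_diff_rcons1 mu u j k : j != k -> dyn_diff mu (rcons u j) j k = dyn_diff mu u j k + h.
Proof.
move=> jk; rewrite /dyn_diff -cats1 !count_cat /= eqxx (negPf jk) !addn0 addn1 -natr1.
ring.
Qed.

Lemma dyn_diff_rcons2 mu u j k : j != k -> dyn_diff mu (rcons u k) j k = dyn_diff mu u j k - h.
Proof.
move=> jk; rewrite dyn_diffC dyn_diff_rcons1 1?eq_sym // opprD -dyn_diffC; ring.
Qed.

(* Induction on the level: the permutations of the top variables are grouped in
   pairs by exchanging the variables of the two letters, and the lower weights of
   the two members of a pair are compared by the induction hypothesis. *)
Lemma word_weight_exch mu M K u v c1 c2 ya y1 y2 yb t :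
  dyn_generic mu M K -> ((size u).+1 < M)%N -> th h != 0 -> th (h + (y1 - y2)) != 0 ->
  all (fun c => c < K)%N (u ++ c1 :: c2 :: v) ->
  size ya = size u -> size yb = size v ->
  (forall l, (l < K)%N -> regular_vars (t l) /\
     size (t l) = count (fun c => c < l)%N (u ++ c1 :: c2 :: v)) ->
  word_weight mu K (u ++ c1 :: c2 :: v) (ya ++ y2 :: y1 :: yb) t =
  exch_rhs mu u c1 c2 y1 y2
    (word_weight mu K (u ++ c1 :: c2 :: v) (ya ++ y1 :: y2 :: yb) t)
    (word_weight mu K (u ++ c2 :: c1 :: v) (ya ++ y1 :: y2 :: yb) t).
Proof.
elim: K => [|K IH] in u v c1 c2 ya y1 y2 yb *.
  by rewrite all_cat /= => _ _ _ _; rewrite andbF.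
move=> g uM h0 hw0 wK sya syb tK.
have uM1 := ltnW uM.
have [gt szt] := tK K (ltnSn K).
have /and4P[uK c1K c2K vK] : [&& all (fun c => c < K.+1)%N u, (c1 < K.+1)%N,
  (c2 < K.+1)%N & all (fun c => c < K.+1)%N v] by move: wK; rewrite all_cat.
set fu := [seq c <- u | (c < K)%N]; set fv := [seq c <- v | (c < K)%N].
have fuM : ((size fu).+1 < M)%N.
  by rewrite (leq_ltn_trans _ uM) // ltnS size_filter count_size.
have gK : dyn_generic mu M K by apply: dyn_genericW g.
have Pfu c c' : (c < K)%N -> (c' < K)%N -> dyn_diff mu fu c c' = dyn_diff mu u c c'.
  move=> cK c'K; rewrite /dyn_diff.
  have E d : (d < K)%N -> count_mem d fu = count_mem d u.
    move=> dK; rewrite count_filter; apply: eq_count => x /=.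
    by case: eqP => //= ->.
  by rewrite !E.
have szE d1 d2 : count (fun c => c < K)%N (u ++ d1 :: d2 :: v) =
    (size fu + ((d1 < K) + (d2 < K)) + size fv)%N.
  by rewrite count_cat /= !size_filter !addnA.
have filE d1 d2 : [seq c <- u ++ d1 :: d2 :: v | (c < K)%N] =
   fu ++ [seq c <- [:: d1; d2] | (c < K)%N] ++ fv.
  by rewrite filter_cat -cat1s -(cat1s d2) catA filter_cat.
have itE d1 d2 xa xm xb z1 z2 : size xa = size fu ->
    size xm = ((d1 < K) + (d2 < K))%N ->
    level_items K (u ++ d1 :: d2 :: v) (xa ++ xm ++ xb) (ya ++ z1 :: z2 :: yb) =
    level_items K u xa ya ++ level_items K [:: d1; d2] xm [:: z1; z2] ++ level_items K v xb yb.
  move=> sxa sxm; rewrite level_items_cat //; last by rewrite sxa size_filter.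
  congr (_ ++ _); rewrite -[d1 :: d2 :: v]/([:: d1; d2] ++ v).
  by rewrite -[z1 :: z2 :: yb]/([:: z1; z2] ++ yb) level_items_cat //= addn0.
have colu xa : [seq i.1.1 | i <- level_items K u xa ya] = u by rewrite level_items_colors.
have filt_all d1 d2 l : (l < K)%N ->
    count (fun c => c < l)%N [seq c <- u ++ d1 :: d2 :: v | (c < K)%N] =
    count (fun c => c < l)%N (u ++ d1 :: d2 :: v).
  move=> lK; rewrite count_filter; apply: eq_count => x /=.
  by apply: andb_idr => /ltn_trans; apply.
have xsplit d1 d2 xs : size (t K) = (size fu + ((d1 < K) + (d2 < K)) + size fv)%N ->
    xs \in permutations (t K) -> exists xa xm xb, [/\ xs = xa ++ xm ++ xb,
      size xa = size fu, size xm = ((d1 < K) + (d2 < K))%N & size xb = size fv].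
  move=> sz; rewrite mem_permutations => /perm_size sx.
  by apply: split_seq; rewrite sx.
have it0 z1 z2 : level_items K [:: K; K] [::] [:: z1; z2] = [:: (K, 0, z1); (K, 0, z2)].
  by rewrite /= ltnn.
have it1 c x z1 z2 : (c < K)%N ->
    level_items K [:: c; K] [:: x] [:: z1; z2] = [:: (c, x, z1); (K, 0, z2)].
  by move=> cK; rewrite /= cK ltnn.
have it2 c x z1 z2 : (c < K)%N ->
    level_items K [:: K; c] [:: x] [:: z1; z2] = [:: (K, 0, z1); (c, x, z2)].
  by move=> cK; rewrite /= cK ltnn.
have it3 c c' x x' z1 z2 : (c < K)%N -> (c' < K)%N ->
    level_items K [:: c; c'] [:: x; x'] [:: z1; z2] = [:: (c, x, z1); (c', x', z2)].
  by move=> cK c'K; rewrite /= cK c'K.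
have Phi1 c x z1 z2 : (c < K)%N -> level_weight mu K u [:: (c, x, z1); (K, 0, z2)] =
    th (z1 - x + (h + dyn_diff mu u c K)) / th (h + dyn_diff mu u c K) * th (z2 - x).
  move=> cK; rewrite /= big_seq1 big_nil /own_factor /pair_factor /= cK ltnn /= !mulr1 mul1r.
  reflexivity.
have Phi2 c x z1 z2 : (c < K)%N -> level_weight mu K u [:: (K, 0, z1); (c, x, z2)] =
    th (h + z1 - x) * (th (z2 - x + dyn_diff mu u c K) / th (dyn_diff mu u c K)).
  move=> cK; rewrite /= big_seq1 big_nil /own_factor /pair_factor /= cK ltnn /= !mulr1 mul1r.
  (* The letter [K] in front of [c] lowers the dynamical difference by [h], which cancels the [h]
     added in [own_factor]. *)
  rewrite dyn_diff_rcons2 ?ltn_eqF //.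
  by rewrite (_ : h + (dyn_diff mu u c K - h) = dyn_diff mu u c K) //; ring.
have env1 c x z1 z2 a b : (c < K)%N ->
    context_factor mu K a [:: (c, x, z1); (K, 0, z2)] b =
    context_factor mu K a [:: (c, x, z2); (K, 0, z1)] b.
  move=> cK; apply: eq_context_factor => // i;
    rewrite !big_cons !big_nil /pair_factor /= cK ltnn /= ?andbF.
    by case: ifP => _; ring.
  by case: ifP => _; ring.
have env2 c x z1 z2 a b : (c < K)%N ->
    context_factor mu K a [:: (K, 0, z1); (c, x, z2)] b =
    context_factor mu K a [:: (c, x, z1); (K, 0, z2)] b.
  move=> cK; apply: eq_context_factor => [i|i|].
  - rewrite !big_cons !big_nil /pair_factor /= cK ltnn /= ?andbF.
    by case: ifP => _; ring.
  - rewrite !big_cons !big_nil /pair_factor /= cK ltnn /= ?andbF.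
    by case: ifP => _; ring.
  - by rewrite /= (perm_catC [:: K] [:: c]).
rewrite szE in szt; rewrite !word_weightS.
have [c1lt|c1ge] := ltnP c1 K; last first.
  have c1E : c1 = K by apply/eqP; rewrite eqn_leq c1ge -ltnS c1K.
  rewrite {c1 c1ge c1K}c1E in tK wK szt *.
  have [c2lt|c2ge] := ltnP c2 K; last first.
    have c2E : c2 = K by apply/eqP; rewrite eqn_leq c2ge -ltnS c2K.
    rewrite {c2 c2ge c2K}c2E in tK wK szt *.
    (* Two top letters: neither has a variable of its own, so every summand is already symmetric in
       [y1] and [y2]. *)
    rewrite /exch_rhs eqxx /=; apply: eq_big_seq => xs xsP; congr (_ * _).
    have [xa [xm [xb [-> sa sm _]]]] := xsplit K K xs szt xsP.
    rewrite !itE //; rewrite ltnn in sm; rewrite (size0nil sm) !it0 !level_weight_split !colu.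
    congr (_ * _); last by rewrite /= !big_seq1 !big_nil /own_factor /pair_factor /= ltnn.
    apply: eq_context_factor => // i; rewrite !big_cons !big_nil /pair_factor /= ltnn /= ?andbF.
      by case: ifP => _; ring.
    by case: ifP => _; ring.
  (* Exactly one of the letters survives the filter, so both words have the same lower word and the
     sums can be compared term by term. *)
  rewrite /exch_rhs (gtn_eqF c2lt) ltnNge (ltnW c2lt) /= !mulr_sumr -big_split /=.
  apply: eq_big_seq => xs xsP.
  have [xa [xm [xb [-> sa sm _]]]] := xsplit K c2 xs szt xsP.
  rewrite !itE //; last by rewrite addnC.
  rewrite ltnn c2lt in sm; case: xm sm => [|x []] // sm.
  rewrite !it1 ?it2 // !level_weight_split !colu.
  rewrite !(env2 c2) // (env1 c2 x y2 y1) // Phi1 // !Phi2 //.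
  rewrite !filE /= ltnn c2lt /=.
  have := @exch_one2 _ _ th_odd th_fay h (dyn_diff mu u c2 K) x y1 y2.
  rewrite -dyn_diffC => -> //; first by ring.
    by apply: (dyn_generic_diff g); rewrite ?(ltnW uM1) ?(ltnW c2lt) // ltn_eqF.
  by rewrite addrC; apply: (dyn_generic_shift g); rewrite ?uM1 // c2lt ltnSn.
have [c2lt|c2ge] := ltnP c2 K; last first.
  have c2E : c2 = K by apply/eqP; rewrite eqn_leq c2ge -ltnS c2K.
  rewrite {c2 c2ge c2K}c2E in tK wK szt *.
  rewrite /exch_rhs (ltn_eqF c1lt) c1lt /= !mulr_sumr -big_split /=.
  apply: eq_big_seq => xs xsP.
  have [xa [xm [xb [-> sa sm _]]]] := xsplit c1 K xs szt xsP.
  rewrite !itE //; last by rewrite addnC.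
  rewrite ltnn c1lt in sm; case: xm sm => [|x []] // sm.
  rewrite !it1 ?it2 // !level_weight_split !colu.
  rewrite !(env2 c1) // (env1 c1 x y2 y1) // !Phi1 // !Phi2 //.
  rewrite !filE /= ltnn c1lt /=.
  rewrite (@exch_one1 _ _ th_odd th_fay h (dyn_diff mu u c1 K) x y1 y2) //; first by ring.
    by apply: (dyn_generic_diff g); rewrite ?(ltnW uM1) ?(ltnW c1lt) // ltn_eqF.
  by rewrite addrC; apply: (dyn_generic_shift g); rewrite ?uM1 // c1lt ltnSn.
have env3 c c' x x' z1 z2 a b : (c < K)%N -> (c' < K)%N ->
    [/\ context_factor mu K a [:: (c, x, z1); (c', x', z2)] b =
        context_factor mu K a [:: (c, x, z2); (c', x', z1)] b,
        context_factor mu K a [:: (c, x, z1); (c', x', z2)] b =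
        context_factor mu K a [:: (c, x', z1); (c', x, z2)] b &
        context_factor mu K a [:: (c, x, z1); (c', x', z2)] b =
        context_factor mu K a [:: (c', x, z1); (c, x', z2)] b].
  move=> cK c'K; have pc : perm_eq [:: c; c'] [:: c'; c] by rewrite (perm_catC [:: c]).
  by split; apply: eq_context_factor => // i;
    rewrite !big_cons !big_nil /pair_factor /= cK c'K /= ?andbT;
    case: ifP => _; ring.
have A0 : th (h + dyn_diff mu u c1 K) != 0.
  by apply: (dyn_generic_shift g) => //; rewrite c1lt ltnSn.
have C0 : th (h + dyn_diff mu u c2 K) != 0.
  by apply: (dyn_generic_shift g) => //; rewrite c2lt ltnSn.
have PE : (h + dyn_diff mu u c1 K) - (h + dyn_diff mu u c2 K) = dyn_diff mu u c1 c2.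
  by rewrite /dyn_diff; ring.
(* The induction hypothesis concerns the filtered prefix [fu], but by [Pfu] the discarded letters
   [K] do not affect the dynamical difference of two lower letters; the R-matrix can thus be written
   with [u] on both levels. *)
have IHK d1 d2 xa x1 x2 xb : (d1 < K)%N -> (d2 < K)%N ->
    (forall l, count (fun c => c < l)%N (u ++ d1 :: d2 :: v) =
               count (fun c => c < l)%N (u ++ c1 :: c2 :: v)) ->
    size xa = size fu -> size xb = size fv -> th (h + (x1 - x2)) != 0 ->
    word_weight mu K (fu ++ d1 :: d2 :: fv) (xa ++ x2 :: x1 :: xb) t =
    exch_rhs mu u d1 d2 x1 x2
      (word_weight mu K (fu ++ d1 :: d2 :: fv) (xa ++ x1 :: x2 :: xb) t)
      (word_weight mu K (fu ++ d2 :: d1 :: fv) (xa ++ x1 :: x2 :: xb) t).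
  move=> d1K d2K cntE sa sb hv; rewrite (IH _ _ _ _ _ _ _ _ gK) //.
  - by rewrite /exch_rhs Pfu.
  - by rewrite all_cat /= d1K d2K !filter_all.
  move=> l lK; have [gl sl] := tK l (ltnW lK); split=> //.
  by rewrite sl -cntE -filt_all // filE /= d1K d2K.
have goodr r : perm_eq r (t K) -> exists xa x1 x2 xb, [/\ r = xa ++ x1 :: x2 :: xb,
    size xa = size fu, size xb = size fv &
    [/\ th (x1 - x2) != 0, th (h + (x1 - x2)) != 0 & th (h + (x2 - x1)) != 0]].
  move=> pr; have [|xa [xm [xb [rE sa sm sb]]]] := xsplit c1 c2 r szt.
    by rewrite mem_permutations.
  rewrite c1lt c2lt in sm; case: xm rE sm => [|x1 [|x2 []]] // rE _.
  exists xa, x1, x2, xb; split=> //.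
  have [] := regular_vars_perm (_ : perm_eq (t K) r) gt; first by rewrite perm_sym.
  rewrite rE => un d hd.
  have m1 : x1 \in xa ++ [:: x1, x2 & xb] by rewrite mem_cat !inE eqxx orbT.
  have m2 : x2 \in xa ++ [:: x1, x2 & xb] by rewrite mem_cat !inE eqxx !orbT.
  split; [apply: d => // | exact: hd | exact: hd].
  move: un; rewrite cat_uniq => /and3P[_ _] /=; rewrite inE negb_or.
  by case/andP => /andP[].
have envN xa x1 x2 xb
    (ctx := fun m => context_factor mu K (level_items K u xa ya) m (level_items K v xb yb))
    (e := ctx [:: (c1, x1, y1); (c2, x2, y2)]) :
    [/\ ctx [:: (c1, x1, y2); (c2, x2, y1)] = e,
     ctx [:: (c1, x2, y2); (c2, x1, y1)] = e,
     ctx [:: (c1, x2, y1); (c2, x1, y2)] = e,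
     ctx [:: (c2, x1, y1); (c1, x2, y2)] = e &
     ctx [:: (c2, x2, y1); (c1, x1, y2)] = e].
  have E c c' x x' z1 z2 := env3 c c' x x' z1 z2 (level_items K u xa ya) (level_items K v xb yb).
  have [e1 e2 e3] := E c1 c2 x1 x2 y1 y2 c1lt c2lt.
  have [_ e4 _] := E c1 c2 x1 x2 y2 y1 c1lt c2lt.
  have [_ _ e5] := E c1 c2 x2 x1 y1 y2 c1lt c2lt.
  by rewrite /e /ctx; split; rewrite -?e4 -?e1 -?e3 -?e5 -?e2.
rewrite /exch_rhs; have [c12|c12] := eqVneq c1 c2.
  subst c2.
  apply/eqP; rewrite -subr_eq0 /= -sumrB; apply/eqP.
  apply: (@sum_permutations_swap_eq0 _ _ (size fu)) => r pr.
  have [xa [x1 [x2 [xb [-> sa sb [v0 hv hv']]]]]] := goodr r pr.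
  rewrite swapat_cat //.
  rewrite -![xa ++ _ :: _ :: xb]/(xa ++ [:: _; _] ++ xb).
  rewrite !itE ?c1lt // !it3 // !level_weight_split !colu !filE !level_weight_pair //= c1lt.
  rewrite [word_weight _ _ _ (xa ++ x2 :: _) _]IHK // /exch_rhs eqxx.
  have /= [-> -> -> _ _] := envN xa x1 x2 xb.
  rewrite dyn_diff_rcons1 ?ltn_eqF // (addrA h (dyn_diff _ _ _ _) h).
  set e := context_factor _ _ _ _ _; set g1 := word_weight _ _ _ _ _; set A := h + dyn_diff _ _ _ _.
  have Ah0 : th (A + h) != 0.
    rewrite /A -(addrA h) -dyn_diff_rcons1 ?ltn_eqF //.
    by apply: (dyn_generic_shift g); rewrite ?size_rcons // c1lt ltnSn.
  have := @exch_equal _ _ th_odd th_fay h A x1 x2 y1 y2 A0 Ah0 h0 v0 hw0.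
  move=> /eqP; rewrite -subr_eq0 => /eqP E.
  transitivity (g1 * e * 0); last by rewrite mulr0.
  by rewrite -E; ring.
rewrite !mulr_sumr -big_split /=.
apply/eqP; rewrite -subr_eq0 /= -sumrB; apply/eqP.
apply: (@sum_permutations_swap_eq0 _ _ (size fu)) => r pr.
have [xa [x1 [x2 [xb [-> sa sb [v0 hv hv']]]]]] := goodr r pr.
rewrite swapat_cat //.
rewrite -![xa ++ _ :: _ :: xb]/(xa ++ [:: _; _] ++ xb).
rewrite !itE ?c1lt ?c2lt // !it3 // !level_weight_split !colu !filE.
rewrite !level_weight_pair //= c1lt c2lt.
rewrite [word_weight _ _ (fu ++ c1 :: _) (xa ++ x2 :: _) _]IHK //.
rewrite [word_weight _ _ (fu ++ c2 :: _) (xa ++ x2 :: _) _]IHK //; last first.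
  by move=> l; rewrite !count_cat /= (addnCA (c1 < l)%N).
rewrite /exch_rhs (negPf c12) eq_sym (negPf c12).
have /= [-> -> -> -> ->] := envN xa x1 x2 xb.
have c21 : c2 != c1 by rewrite eq_sym.
rewrite (dyn_diff_rcons _ _ c12) ?(negbT (ltn_eqF c1lt)) //.
rewrite (dyn_diff_rcons _ _ c21) ?(negbT (ltn_eqF c2lt)) //.
set e := context_factor _ _ _ _ _.
have P0 : th (dyn_diff mu u c1 c2) != 0.
  by apply: (dyn_generic_diff g); rewrite ?(ltnW uM1).
have ltE : (c2 < c1)%N = ~~ (c1 < c2)%N.
  by rewrite -leqNgt [RHS]leq_eqVlt eq_sym (negPf c12).
rewrite (dyn_diffC mu u c1 c2) ltE.
set g1 := word_weight _ _ (fu ++ c1 :: _) _ _; set g2 := word_weight _ _ (fu ++ c2 :: _) _ _.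
have := @exch_both _ _ th_odd th_fay h (c1 < c2)%N (h + dyn_diff mu u c1 K)
  (h + dyn_diff mu u c2 K) x1 x2 y1 y2 g1 g2 A0 C0.
rewrite PE => /(_ P0 v0 hv hw0) /eqP; rewrite -subr_eq0 => /eqP E.
transitivity (e * 0); last by rewrite mulr0.
by rewrite -E; ring.
Qed.

End Words.

(** * Symmetry and triangularity *)

Section WordOrthogonality.
Variables (F : numFieldType) (th : F -> F) (h : F).
Hypothesis th_odd : forall u, th (- u) = - th u.
Hypothesis th_fay : three_term th.
Implicit Types (mu : nat -> F) (u v w : seq nat) (xs ys : seq F).
Implicit Types (t : nat -> seq F) (j k c : nat).
Local Notation word_weight := (word_weight th h).
Local Notation level_weight := (level_weight th h).

(* The exchange matrices for the two families of dynamical parameters are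
   inverse transposes of each other. *)
Lemma exch_dual (b : bool) (P w X Y X' Y' : F) :
  th P != 0 -> th (h + w) != 0 -> th (h - w) != 0 ->
  (acoef th h P w * X + bcoef th h b P w * Y) *
  (acoef th h P (- w) * X' + bcoef th h (~~ b) P (- w) * Y') +
  (acoef th h (- P) w * Y + bcoef th h (~~ b) (- P) w * X) *
  (acoef th h (- P) (- w) * Y' + bcoef th h b (- P) (- w) * X') =
  X * X' + Y * Y'.
Proof.
move=> P0 hw hw'; have U := unitarity th_fay h P w.
rewrite /acoef /bcoef.
have e1 : th (- P - w) = - th (P + w) by rewrite -th_odd; congr th; ring.
have e2 : th (- P - h) = - th (P + h) by rewrite -th_odd; congr th; ring.
have e3 : th (- P + h) = - th (P - h) by rewrite -th_odd; congr th; ring.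
have e4 : th (- P + w) = - th (P - w) by rewrite -th_odd; congr th; ring.
rewrite !opprK e1 e2 e3 e4 !th_odd.
set a := th h in U *; set Pm := th (P - w) in U *; set Pp := th (P + w) in U *.
set d := th (h + w) in U hw *; set d' := th (h - w) in U hw' *.
set hm := th (P - h) in U *; set hp := th (P + h) in U *.
set p := th P in U P0 *; set s := th w in U *.
move/eqP: U; rewrite -subr_eq0 => /eqP U.
apply/eqP; rewrite -subr_eq0; apply/eqP.
transitivity ((X * X' + Y * Y') / (p ^+ 2 * d * d') * 0); last by rewrite mulr0.
rewrite -U; move: p d d' P0 hw hw' {U} => p d d' P0 hw hw'.
by case: b => /=; field; rewrite P0 hw hw'.
Qed.

(** Reversal is the effect of sigma_0 both on words and on [z]. An exchange of two neighbours then
    takes place in both factors, with the reversed suffix of [w] as the prefix seen by the second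
    one. *)
Definition word_pairing mu mu' N w0 ys t t' :=
  \sum_(w <- permutations w0) word_weight mu N w ys t * word_weight mu' N (rev w) (rev ys) t'.

Section Symmetry.
Variables (mu mu' : nat -> F) (N : nat) (w0 : seq nat) (t t' : nat -> seq F).
Hypothesis w0N : all (fun c => c < N)%N w0.
Hypothesis mu'E : forall k, (k < N)%N -> mu' k = (count_mem k w0)%:R * h - mu k.
Hypothesis (g : dyn_generic th h mu (size w0) N) (g' : dyn_generic th h mu' (size w0) N).
Hypothesis h0 : th h != 0.
Hypothesis tP : forall l, (l < N)%N -> regular_vars th h (t l) /\
  size (t l) = count (fun c => c < l)%N w0.
Hypothesis t'P : forall l, (l < N)%N -> regular_vars th h (t' l) /\
  size (t' l) = count (fun c => c < l)%N w0.

Lemma word_pairing_swap s1 a b s2 : size (s1 ++ a :: b :: s2) = size w0 ->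
  th (h + (a - b)) != 0 -> th (h + (b - a)) != 0 ->
  word_pairing mu mu' N w0 (s1 ++ b :: a :: s2) t t' =
  word_pairing mu mu' N w0 (s1 ++ a :: b :: s2) t t'.
Proof.
move=> sz ab ba; apply/eqP; rewrite /word_pairing -subr_eq0 -sumrB; apply/eqP.
apply: (@sum_permutations_swap_eq0 _ _ (size s1)) => r pr.
have [|u [m [v [rE su sm sv]]]] := @split_seq _ (size s1) 2 (size s2) r.
  by rewrite (perm_size pr) -sz size_cat /= -addnA.
case: m rE sm => [|c1 [|c2 []]] // rE _; rewrite {r}rE /= in pr *.
rewrite swapat_cat //.
have [pu pv] : count_mem c1 w0 = (count_mem c1 u + 1 + (c2 == c1) + count_mem c1 v)%N /\
    count_mem c2 w0 = (count_mem c2 u + 1 + (c1 == c2) + count_mem c2 v)%N.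
  by rewrite -!(seq.permP pr) !count_cat /= !eqxx; split; lia.
have wN : all (fun c => c < N)%N (u ++ [:: c1, c2 & v]) by rewrite (perm_all _ pr).
have /and4P[uN c1N c2N vN] : [&& all (fun c => c < N)%N u, (c1 < N)%N, (c2 < N)%N &
  all (fun c => c < N)%N v] by move: wN; rewrite all_cat.
have szE : size w0 = (size u + (size v).+2)%N by rewrite -(perm_size pr) size_cat.
have cE d1 d2 : perm_eq [:: d1; d2] [:: c1; c2] ->
    forall l, count (fun c => c < l)%N w0 = count (fun c => c < l)%N (u ++ d1 :: d2 :: v) /\
    count (fun c => c < l)%N w0 = count (fun c => c < l)%N (rev v ++ d1 :: d2 :: rev u).
  move=> p l; have /= := seq.permP p (fun c => c < l)%N; rewrite !addn0 => e.
  rewrite -(seq.permP pr) !count_cat /= !count_rev !addnA -!(addnA _ (nat_of_bool (d1 < l)%N)).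
  by rewrite e; split; lia.
have sz1 : size s1 = size u by [].
have sz2 : size s2 = size v by [].
have E d1 d2 : perm_eq [:: d1; d2] [:: c1; c2] -> (d1 < N)%N -> (d2 < N)%N ->
    word_weight mu N (u ++ [:: d1, d2 & v]) (s1 ++ [:: b, a & s2]) t =
    exch_rhs th h mu u d1 d2 a b
      (word_weight mu N (u ++ [:: d1, d2 & v]) (s1 ++ [:: a, b & s2]) t)
      (word_weight mu N (u ++ [:: d2, d1 & v]) (s1 ++ [:: a, b & s2]) t).
  move=> p d1N d2N; apply: (word_weight_exch th_odd th_fay g) => //.
  - by rewrite szE !addnS !ltnS leq_addr.
  - by rewrite all_cat /= uN d1N d2N.
  by move=> l lN; have [? ->] := tP lN; have [-> _] := cE _ _ p l.
have E' d1 d2 : perm_eq [:: d1; d2] [:: c1; c2] -> (d1 < N)%N -> (d2 < N)%N ->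
    word_weight mu' N (rev v ++ [:: d1, d2 & rev u]) (rev s2 ++ [:: a, b & rev s1]) t' =
    exch_rhs th h mu' (rev v) d1 d2 b a
      (word_weight mu' N (rev v ++ [:: d1, d2 & rev u]) (rev s2 ++ [:: b, a & rev s1]) t')
      (word_weight mu' N (rev v ++ [:: d2, d1 & rev u]) (rev s2 ++ [:: b, a & rev s1]) t').
  move=> p d1N d2N; apply: (word_weight_exch th_odd th_fay g'); rewrite ?size_rev //.
  - by rewrite szE !addnS !ltnS leq_addl.
  - by rewrite all_cat /= !all_rev uN d1N d2N vN.
  by move=> l lN; have [? ->] := t'P lN; have [_ ->] := cE _ _ p l.
have revE (T : eqType) (l1 : seq T) x y l2 :
  rev (l1 ++ [:: x, y & l2]) = rev l2 ++ [:: y, x & rev l1].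
  by rewrite rev_cat !rev_cons -!cats1 -!catA.
rewrite !revE.
have p12 : perm_eq [:: c1; c2] [:: c1; c2] by [].
have p21 : perm_eq [:: c2; c1] [:: c1; c2] by rewrite (perm_catC [:: c2]).
rewrite !E // !E' //.
have [c12|c12] := eqVneq c1 c2; first by subst c2; rewrite /exch_rhs eqxx; ring.
have c21 : c2 != c1 by rewrite eq_sym.
rewrite /exch_rhs (negPf c12) (negPf c21).
(* Prefix, exchanged pair and suffix together have the letters of [w0]. The term h^lambda in [mu']
   therefore turns the letter counts of the suffix into those of the prefix: both factors see the
   same dynamical variable. *)
have PE : dyn_diff h mu' (rev v) c2 c1 = dyn_diff h mu u c1 c2.
  rewrite /dyn_diff !mu'E // pu pv !count_rev (negPf c12) (negPf c21) !natrD; ring.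
rewrite (dyn_diffC h mu u c1 c2) (dyn_diffC h mu' (rev v) c2 c1) !PE.
have ltE : (c2 < c1)%N = ~~ (c1 < c2)%N.
  by rewrite -leqNgt [RHS]leq_eqVlt eq_sym (negPf c12).
rewrite ltE -(opprB a b).
set X := word_weight _ _ _ (s1 ++ _) _; set Y := word_weight _ _ (u ++ c2 :: _) (s1 ++ _) _.
set X' := word_weight _ _ (rev v ++ c2 :: _) _ _; set Y' := word_weight _ _ (rev v ++ c1 :: _) _ _.
have P0 : th (dyn_diff h mu u c1 c2) != 0.
  by apply: (dyn_generic_diff th_odd g) => //; rewrite szE leq_addr.
have ba' : th (h - (a - b)) != 0 by rewrite opprB.
have := @exch_dual (c1 < c2)%N _ _ X Y X' Y' P0 ab ba'.
move=> /eqP; rewrite -subr_eq0 => /eqP <-; ring.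
Qed.

Lemma word_pairing_perm ys ys' : perm_eq ys ys' -> size ys = size w0 ->
  {in ys &, forall a b, th (h + (a - b)) != 0} ->
  word_pairing mu mu' N w0 ys t t' = word_pairing mu mu' N w0 ys' t t'.
Proof.
move=> p sz hd.
(* [swap_invariant_perm] asks for invariance on all sequences, whereas the swap lemma needs
   nonvanishing differences; extending by 0 outside the rearrangements of [ys] reconciles the
   two. *)
pose f s := if perm_eq s ys then word_pairing mu mu' N w0 s t t' else 0.
suff: f ys = f ys' by rewrite /f perm_refl perm_sym p.
apply: (swap_invariant_perm _ p) => s1 a b s2; rewrite /f.
have pab : perm_eq (s1 ++ [:: b, a & s2]) (s1 ++ [:: a, b & s2]).
  by rewrite perm_cat2l (perm_catCA [:: b] [:: a]).
have -> : perm_eq (s1 ++ [:: b, a & s2]) ys = perm_eq (s1 ++ [:: a, b & s2]) ys.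
  by apply/idP/idP; apply: perm_trans; rewrite // perm_sym.
case: ifP => // pys; apply/esym/word_pairing_swap; first by rewrite (perm_size pys).
  by apply: hd; rewrite -(perm_mem pys) mem_cat !inE eqxx !orbT.
by apply: hd; rewrite -(perm_mem pys) mem_cat !inE eqxx !orbT.
Qed.

End Symmetry.

(** The source of all triangularity: an own variable that reappears as the upper variable of a later
    letter produces a factor [th 0]. *)
Lemma level_weight_eq0 mu k u i its : (i.1.1 < k)%N -> i.1.2 \in [seq i'.2 | i' <- its] ->
  level_weight mu k u (i :: its) = 0.
Proof.
move=> ik /mapP[i' i'its xE] /=.
have pr0 : pair_factor th h k i i' = 0.
  by rewrite /pair_factor ik -xE subrr (odd_at0 th_odd) mulr0 mul0r.
by rewrite (big_rem i') //= pr0 !(mulr0, mul0r).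
Qed.

Lemma level_items_y k w xs ys : size ys = size w -> [seq i.2 | i <- level_items k w xs ys] = ys.
Proof.
elim: w xs ys => [|c w IH] xs [|y ys] //= [sz].
by case: ifP => _ /=; rewrite IH.
Qed.

(** Over [Bl] a letter below [k] would use an own variable from [Y], which still lies to its right,
    and the weight would vanish; so all these letters are [k]. Over [Y] every own variable must
    equal the current upper one for the same reason. *)
Lemma level_weight_triangular_sorted mu k u w xs Bl Y :
  all (fun c => c <= k)%N w -> size w = (size Bl + size Y)%N ->
  count (fun c => c < k)%N w = size Y -> perm_eq xs Y ->
  level_weight mu k u (level_items k w xs (Bl ++ Y)) != 0 ->
  w = nseq (size Bl) k ++ [seq c <- w | (c < k)%N] /\ xs = Y.
Proof.
elim: Bl Y w xs u => [|b Bl IH] Y w xs u /=; last first.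
  case: w => [//|c w] /= /andP[ck wk] [sz].
  case: (ltnP c k) => [clt|cge].
    case: xs => [|x xs]; first by move=> cnt /perm_size sY; rewrite -sY in cnt.
    move=> _ p; rewrite level_weight_eq0 ?eqxx //= level_items_y ?size_cat //.
    by rewrite mem_cat -(perm_mem p) mem_head orbT.
  rewrite add0n => cnt p; rewrite !mulf_eq0 !negb_or => /andP[_ nz].
  have [-> <-] := IH _ _ _ _ wk sz cnt p nz.
  have -> : c = k by apply/eqP; rewrite eqn_leq ck.
  split=> //; congr (_ :: _); rewrite {1}filter_cat.
  rewrite (_ : [seq c <- nseq _ _ | _] = [::]) ?filter_id //.
  by elim: (size Bl) => //= m; rewrite ltnn.
elim: Y w xs u => [|y Y IHY] w xs u /=.
  by case: w => // _ _ _ /perm_nilP ->.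
case: w => [//|c w] /= /andP[ck wk]; rewrite add0n => -[sz].
case: (ltnP c k) => [clt|cge]; last first.
  by rewrite add0n => e; have := count_size (fun c => c < k)%N w; rewrite e sz ltnn.
rewrite add1n => -[cnt]; case: xs => [|x xs]; first by move/perm_size.
move=> p /=; have [xy|xy] := eqVneq x y.
  subst x; rewrite perm_cons in p; rewrite !mulf_eq0 !negb_or => /andP[_ nz].
  by have [{1}-> ->] := IHY w xs _ wk sz cnt p nz.
have xY : x \in Y by have := mem_head x xs; rewrite (perm_mem p) inE (negPf xy).
by rewrite -[_ * _]/(level_weight mu k u ((c, x, y) :: _)) level_weight_eq0 ?eqxx //= level_items_y.
Qed.

(** Now the letters below [k] come first and the word is given; of the own variables one knows only
    that they are distinct and lie among the upper ones. If the first is not the head of [Y], it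
    occurs further right and kills the weight; if it is, distinctness excludes it from the remaining
    ones. *)
Lemma level_weight_triangular_rev mu k u w p xs Bl Y :
  all (fun c => c < k)%N w -> size w = size Y -> size Bl = p ->
  uniq xs -> {subset xs <= Y ++ Bl} -> size xs = size Y ->
  level_weight mu k u (level_items k (w ++ nseq p k) xs (Y ++ Bl)) != 0 -> xs = Y.
Proof.
elim: Y w xs u => [|y Y IH] w xs u /=; first by move=> _ _ _ _ _ /size0nil.
case: w => [//|c w] /= /andP[ck wk] [sw] sB; rewrite ck.
case: xs => [//|x xs] /= /andP[xxs uxs] sub [sx].
have [xy|xy] := eqVneq x y.
  subst x; rewrite !mulf_eq0 !negb_or => /andP[_ nz].
  congr (_ :: _); apply: (IH w _ _ wk sw sB uxs) nz => // z zxs.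
  have := sub z; rewrite !inE zxs orbT => /(_ isT) /orP[/eqP zy|//].
  by move: xxs; rewrite -zy zxs.
have xY : x \in Y ++ Bl by have := sub x; rewrite !inE eqxx (negPf xy) => /(_ isT).
rewrite -[_ * _]/(level_weight mu k u ((c, x, y) :: _)) level_weight_eq0 ?eqxx //= level_items_y //.
by rewrite !size_cat size_nseq sw sB.
Qed.

Lemma sum_permutations_single (T : eqType) (s r0 : seq T) (f : seq T -> F) :
  perm_eq r0 s -> (forall r, perm_eq r s -> r != r0 -> f r = 0) ->
  \sum_(r <- permutations s) f r = f r0.
Proof.
move=> p f0; rewrite (bigD1_seq r0) ?permutations_uniq ?mem_permutations //=.
rewrite big_seq_cond big1 ?addr0 // => r /andP[]; rewrite mem_permutations.
exact: f0.
Qed.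

Section Sorted.
Variable bl : nat -> seq F.

(* The blocks in decreasing order, so that the variables of each level are a suffix
   of those of the next one. *)
Fixpoint sorted_vars k := if k is k'.+1 then bl k' ++ sorted_vars k' else [::].
Fixpoint sorted_word k := if k is k'.+1 then nseq (size (bl k')) k' ++ sorted_word k' else [::].

Lemma size_sorted_word k : size (sorted_word k) = size (sorted_vars k).
Proof. by elim: k => //= k IH; rewrite !size_cat size_nseq IH. Qed.

Lemma all_sorted_word k : all (fun c => c < k)%N (sorted_word k).
Proof.
elim: k => //= k IH; rewrite all_cat all_nseq ltnSn orbT /=.
by apply: sub_all IH => c /ltnW.
Qed.

Lemma filter_sorted_word k : [seq c <- sorted_word k.+1 | (c < k)%N] = sorted_word k.
Proof.
rewrite /= filter_cat (all_filterP (all_sorted_word k)).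
by rewrite (_ : [seq c <- nseq _ _ | _] = [::]) //; elim: (size _) => //= m; rewrite ltnn.
Qed.

Lemma filter_sorted_word_le k l : (l <= k)%N ->
  [seq c <- sorted_word k | (c < l)%N] = sorted_word l.
Proof.
elim: k => [|k IH]; first by rewrite leqn0 => /eqP ->.
rewrite leq_eqVlt => /orP[/eqP ->|lk]; first exact/all_filterP/all_sorted_word.
rewrite -IH // -(filter_sorted_word k) -filter_predI; apply: eq_filter => c /=.
by apply/esym/andb_idr => cl; apply: leq_trans cl _.
Qed.

Lemma count_sorted_word k l : (l <= k)%N ->
  count (fun c => c < l)%N (sorted_word k) = size (sorted_vars l).
Proof. by move=> lk; rewrite -size_filter filter_sorted_word_le // size_sorted_word. Qed.

Definition sorted_item l := level_items l (sorted_word l.+1) (sorted_vars l) (sorted_vars l.+1).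

(** On each level triangularity leaves the single summand [sorted_vars], and a nonzero weight forces
    the letters of the top block to the front; the recursion then deals with the word of the lower
    letters. *)
Lemma word_weight_sorted mu K w t : all (fun c => c < K)%N w ->
  (forall l, (l <= K)%N -> count (fun c => c < l)%N w = size (sorted_vars l)) ->
  (forall l, (l < K)%N -> perm_eq (sorted_vars l) (t l)) ->
  word_weight mu K w (sorted_vars K) t = if w == sorted_word K then
    \prod_(l < K) level_weight mu l [::] (sorted_item l) else 0.
Proof.
elim: K w => [|K IH] w wK cnt tK.
  by case: w wK {cnt} => [_|c w //]; rewrite big_ord0 eqxx.
have cw : size w = (size (bl K) + size (sorted_vars K))%N.
  rewrite -size_cat -[_ ++ _]/(sorted_vars K.+1) -cnt //.
  by apply/esym/eqP; rewrite -all_count.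
rewrite word_weightS (sum_permutations_single (tK K (ltnSn K))); last first.
  move=> r pr rY; apply/eqP; rewrite mulf_eq0; apply/orP; right.
  apply: contraNT rY => nz; have [] := level_weight_triangular_sorted _ cw _ _ nz => //.
  - exact: cnt.
  - by rewrite (perm_trans pr) // perm_sym tK.
  - by move=> _ ->.
have IHw : word_weight mu K [seq c <- w | (c < K)%N] (sorted_vars K) t =
    if [seq c <- w | (c < K)%N] == sorted_word K then
    \prod_(l < K) level_weight mu l [::] (sorted_item l) else 0.
  apply: IH => [|l lK|l lK]; [exact: filter_all | | exact/tK/ltnW].
  rewrite -cnt ?(leqW lK) // count_filter; apply: eq_count => c /=.
  by apply: andb_idr => cl; apply: leq_trans cl lK.
have [wE|wne] := eqVneq.
  by rewrite IHw wE filter_sorted_word eqxx [RHS]big_ord_recr.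
rewrite IHw; case: eqP => [wE|_]; last by rewrite mul0r.
apply/eqP; rewrite mulf_eq0; apply/orP; right.
apply: contraNT wne => nz; have [] := level_weight_triangular_sorted _ cw _ _ nz => //.
  exact: cnt.
by move=> -> _; rewrite wE.
Qed.

Definition rev_item l := level_items l (rev (sorted_word l.+1))
  (rev (sorted_vars l)) (rev (sorted_vars l.+1)).

Lemma rev_sorted_wordS l : rev (sorted_word l.+1) = rev (sorted_word l) ++ nseq (size (bl l)) l.
Proof. by rewrite /= rev_cat rev_nseq. Qed.

Lemma word_weight_rev_single mu K t : (forall l, (l < K)%N -> perm_eq (sorted_vars l) (t l)) ->
  (forall l, (l <= K)%N -> uniq (sorted_vars l)) ->
  word_weight mu K (rev (sorted_word K)) (rev (sorted_vars K)) t =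
  \prod_(l < K) level_weight mu l [::] (rev_item l).
Proof.
elim: K => [|K IH] tK uY; first by rewrite big_ord0.
rewrite word_weightS (@sum_permutations_single _ _ (rev (sorted_vars K))); last first.
- move=> r pr rY; apply/eqP; rewrite mulf_eq0; apply/orP; right.
  apply: contraNT rY; rewrite rev_sorted_wordS /= rev_cat => nz; apply/eqP.
  have pY : perm_eq r (sorted_vars K) by rewrite (perm_trans pr) // perm_sym tK.
  apply: (level_weight_triangular_rev _ _ _ _ _ _ nz).
  + by rewrite all_rev all_sorted_word.
  + by rewrite !size_rev size_sorted_word.
  + by rewrite size_rev.
  + by rewrite (perm_uniq pY) uY.
  + by move=> z; rewrite (perm_mem pY) mem_cat mem_rev => ->.
  + by rewrite size_rev (perm_size pY).
- by rewrite (perm_trans _ (tK K _)) // perm_rev.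
rewrite filter_rev filter_sorted_word IH ?big_ord_recr //.
  by move=> l lK; apply/tK/ltnW.
by move=> l lK; apply/uY/ltnW.
Qed.

(** Descent through the levels: a nonzero summand forces [t K] to be a rearrangement of
    [sorted_vars K]. Since the families are nested, the next lower one is then contained in
    [sorted_vars K], which is the hypothesis needed to continue. *)
Lemma word_weight_rev_neq0 mu K t :
  (forall l, (l < K)%N -> uniq (t l) /\ size (t l) = size (sorted_vars l)) ->
  (forall l, (l.+1 < K)%N -> {subset t l <= t l.+1}) ->
  (forall l, l.+1 = K -> {subset t l <= sorted_vars K}) ->
  word_weight mu K (rev (sorted_word K)) (rev (sorted_vars K)) t != 0 ->
  forall l, (l < K)%N -> perm_eq (sorted_vars l) (t l).
Proof.
elim: K => [//|K IH] tK sub subK nz.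
have [xs xsP] : exists2 xs, xs \in permutations (t K) &
   word_weight mu K [seq c <- rev (sorted_word K.+1) | (c < K)%N] xs t *
   level_weight mu K [::] (level_items K (rev (sorted_word K.+1)) xs (rev (sorted_vars K.+1))) != 0.
  apply/hasP; apply: contraNT nz => /hasPn z.
  by rewrite word_weightS big_seq big1 // => xs /z; rewrite negbK => /eqP.
rewrite filter_rev filter_sorted_word mulf_eq0 negb_or => /andP[Wnz Pnz].
have [uK szK] := tK K (ltnSn K).
rewrite mem_permutations in xsP.
have xsE : xs = rev (sorted_vars K).
  move: Pnz; rewrite rev_sorted_wordS [sorted_vars K.+1]/= rev_cat.
  apply: level_weight_triangular_rev.
  - by rewrite all_rev all_sorted_word.
  - by rewrite !size_rev size_sorted_word.
  - by rewrite size_rev.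
  - by rewrite (perm_uniq xsP).
  - move=> z; rewrite (perm_mem xsP) => /(subK K erefl).
    by rewrite /= !mem_cat !mem_rev orbC.
  - by rewrite size_rev (perm_size xsP).
rewrite {}xsE in xsP Wnz.
have pK : perm_eq (sorted_vars K) (t K) by rewrite (perm_trans _ xsP) // perm_sym perm_rev.
move=> l; rewrite ltnS leq_eqVlt => /orP[/eqP ->//|lK].
apply: (IH _ _ _ Wnz l lK) => [m mK|m mK|m mK].
- by apply: tK; apply: ltnW.
- by apply: sub; apply: ltnW.
- by move=> z /(sub m); rewrite mK (perm_mem pK); apply.
Qed.

Lemma level_items_top k ys : level_items k (nseq (size ys) k) [::] ys = [seq (k, 0, y) | y <- ys].
Proof. by elim: ys => //= y ys ->; rewrite ltnn. Qed.

Lemma level_weight_top mu k u ys : level_weight mu k u [seq (k, 0, y) | y <- ys] = 1.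
Proof.
elim: ys u => //= y ys IH u; rewrite IH mulr1 /own_factor /= ltnn mul1r big_map.
by rewrite big1 // => z _; rewrite /pair_factor /= ltnn /= !mulr1.
Qed.

Lemma prod_level_items_diag k w xs (f : item F -> F) (f' : F -> F) :
  all (fun c => c < k)%N w -> size w = size xs ->
  (forall c x, (c < k)%N -> x \in xs -> f (c, x, x) = f' x) ->
  \prod_(i <- level_items k w xs xs) f i = \prod_(x <- xs) f' x.
Proof.
elim: w xs => [|c w IH] [|x xs] //=; first by rewrite !big_nil.
move=> /andP[ck wk] [sz] fE; rewrite ck !big_cons /= fE ?mem_head //.
by rewrite IH // => c' y c'k ys; rewrite fE // inE ys orbT.
Qed.

(** When own and upper variables coincide, the dynamical factors are 1 and the factors [th (y - x)]
    cancel the denominators of the kernel. There remain the factors [th (h + y - x)] for all ordered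
    pairs of different positions; the diagonal ones are supplied by the power of [th h]. *)
Lemma level_weight_diag mu M K k u w xs : dyn_generic th h mu M K -> (k < K)%N ->
  (size u + size w <= M)%N -> all (fun c => c < k)%N w -> size w = size xs ->
  uniq xs -> {in xs &, forall a b, a != b -> th (a - b) != 0} ->
  th h ^+ size xs * level_weight mu k u (level_items k w xs xs) =
  \prod_(x <- xs) \prod_(y <- xs) th (h + y - x).
Proof.
move=> g kK; elim: w u xs => [|c w IH] u [|x xs] //= szM.
  by rewrite big_nil mulr1.
move=> /andP[ck wk] [sz] /andP[xxs uxs] d; rewrite ck /=.
have {}IH := IH (rcons u c) xs _ wk sz uxs.
rewrite {1}/own_factor /= ck subrr add0r divff ?mul1r; last first.
  by apply: (dyn_generic_shift g); rewrite ?ck // (leq_trans _ szM) // addnS ltnS leq_addr.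
rewrite (@prod_level_items_diag _ _ _ _ (fun y => th (h + x - y) * th (h + y - x))) //; last first.
  move=> c' y c'k yxs; rewrite /pair_factor /= c'k ck /= -mulrA; congr (_ * _).
  rewrite mulrCA divff ?mulr1 // d ?mem_head ?inE ?yxs ?orbT //.
  by apply: contraNneq xxs => <-.
rewrite exprS mulrACA IH; last 2 first.
- by rewrite size_rcons addSnnS.
- by move=> a b aX bX; apply: d; rewrite inE ?aX ?bX orbT.
rewrite !big_cons big_split /= addrK [X in _ = _ * X](eq_bigr _ (fun i _ => big_cons _ _ _ _ _ _)).
rewrite big_split /=; ring.
Qed.

Definition level_square l := \prod_(x <- sorted_vars l) \prod_(y <- sorted_vars l) th (h + y - x).
Definition level_cross (f : F -> F -> F) l :=
  \prod_(b <- bl l) \prod_(a <- sorted_vars l) f b a.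

Section LevelValues.
Variables (mu : nat -> F) (M K l : nat).
Hypotheses (g : dyn_generic th h mu M K) (lK : (l < K)%N) (lM : (size (sorted_vars l.+1) <= M)%N).
Hypotheses (uY : uniq (sorted_vars l))
  (dY : {in sorted_vars l &, forall a b, a != b -> th (a - b) != 0}).

(** The letters of the top block stand to the left of all others and contribute [th (h + b - a)], a
    part of Q. In [level_weight_rev_level] they stand to the right and contribute [th (b - a)], a
    part of R. Both times the remaining letters give the same part of E. *)
Lemma level_weight_sorted_level :
  th h ^+ size (sorted_vars l) * level_weight mu l [::] (sorted_item l) =
  level_square l * level_cross (fun b a => th (h + b - a)) l.
Proof.
have count0 : count (fun c => c < l)%N (nseq (size (bl l)) l) = 0%N.
  by elim: (size _) => //= m; rewrite ltnn.
rewrite /sorted_item -[X in level_items _ _ X _]cat0s level_items_cat ?size_nseq ?count0 //.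
rewrite level_weight_cat level_items_top level_weight_top mul1r mulrCA.
rewrite (level_weight_diag g) //; last 3 first.
- by rewrite !size_map size_sorted_word -size_cat.
- exact: all_sorted_word.
- exact: size_sorted_word.
rewrite mulrC big_map; congr (_ * _); apply: eq_bigr => b _.
apply: prod_level_items_diag; rewrite ?all_sorted_word ?size_sorted_word // => c x cl _.
by rewrite /pair_factor /= ltnn cl /= !mulr1.
Qed.

Lemma level_weight_rev_level :
  th h ^+ size (sorted_vars l) * level_weight mu l [::] (rev_item l) =
  level_square l * level_cross (fun b a => th (b - a)) l.
Proof.
rewrite /rev_item rev_sorted_wordS [sorted_vars l.+1]/= rev_cat.
rewrite -[X in level_items _ _ X _]cats0 level_items_cat ?size_rev ?size_sorted_word //; last first.
  by rewrite count_rev count_sorted_word.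
rewrite level_weight_cat -[X in nseq X _]size_rev level_items_top level_weight_top mulr1 mulrA.
rewrite -[in LHS](size_rev (sorted_vars l)) (level_weight_diag g) //; last 5 first.
- by rewrite /= size_rev size_sorted_word (leq_trans _ lM) // size_cat leq_addl.
- by rewrite all_rev all_sorted_word.
- by rewrite !size_rev size_sorted_word.
- by rewrite rev_uniq.
- by move=> a b; rewrite !mem_rev; exact: dY.
congr (_ * _).
  rewrite (perm_big (sorted_vars l)) ?perm_rev //=; apply: eq_bigr => x _.
  by rewrite (perm_big (sorted_vars l)) ?perm_rev.
rewrite exchange_big big_map /= (perm_big (bl l)) ?perm_rev //=.
apply: eq_bigr => b _; rewrite -[RHS](perm_big _ (permEl (perm_rev _))) /=.
apply: prod_level_items_diag => [||c x cl _].
- by rewrite all_rev all_sorted_word.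
- by rewrite !size_rev size_sorted_word.
by rewrite /pair_factor /= ltnn cl /= !mulr1 mul1r.
Qed.
End LevelValues.

Lemma sub_sorted_vars k l : (l <= k)%N -> {subset sorted_vars l <= sorted_vars k}.
Proof.
elim: k => [|k IH]; first by rewrite leqn0 => /eqP ->.
rewrite leq_eqVlt => /orP[/eqP ->//|lk] x /(IH lk) xk.
by rewrite mem_cat xk orbT.
Qed.

Lemma sorted_vars_uniq k l : (l <= k)%N -> uniq (sorted_vars k) -> uniq (sorted_vars l).
Proof.
elim: k => [|k IH]; first by rewrite leqn0 => /eqP ->.
rewrite leq_eqVlt => /orP[/eqP ->//|lk]; rewrite /= cat_uniq => /and3P[_ _].
exact: IH.
Qed.

Lemma regular_vars_sub xs xs' : {subset xs' <= xs} -> uniq xs' ->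
  regular_vars th h xs -> regular_vars th h xs'.
Proof.
move=> sub u [_ d hd]; split=> //.
  by move=> a b aX bX; apply: d; apply: sub.
by move=> a b aX bX; apply: hd; apply: sub.
Qed.

Section Orthogonality.
Variables (mu mu' : nat -> F) (N : nat) (t t' : nat -> seq F) (ys : seq F).
Hypothesis mu'E : forall k, (k < N)%N -> mu' k = (count_mem k (sorted_word N))%:R * h - mu k.
Hypothesis (g : dyn_generic th h mu (size (sorted_vars N)) N).
Hypothesis (g' : dyn_generic th h mu' (size (sorted_vars N)) N).
Hypothesis h0 : th h != 0.
Hypothesis ysP : perm_eq ys (sorted_vars N).
Hypothesis good : regular_vars th h (sorted_vars N).
Hypothesis tP : forall l, (l < N)%N -> perm_eq (sorted_vars l) (t l).
Hypothesis t'u : forall l, (l < N)%N -> uniq (t' l) /\ size (t' l) = size (sorted_vars l).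
Hypothesis t's : forall l, (l.+1 < N)%N -> {subset t' l <= t' l.+1}.
Hypothesis t'N : forall l, (l < N)%N -> {subset t' l <= sorted_vars N}.

(** Symmetry replaces [ys] by the sorted variables in both factors without changing [t] and [t'];
    after that the first factor alone annihilates every word except the sorted one. *)
Lemma word_pairing_sorted : word_pairing mu mu' N (sorted_word N) ys t t' =
  (\prod_(l < N) level_weight mu l [::] (sorted_item l)) *
  word_weight mu' N (rev (sorted_word N)) (rev (sorted_vars N)) t'.
Proof.
have [uN _ hd] := good.
rewrite (@word_pairing_perm _ _ _ _ _ _ _ _ _ _ _ _ _ ys (sorted_vars N))
  ?size_sorted_word //; last 5 first.
- exact: all_sorted_word.
- move=> l lN; rewrite count_sorted_word ?(ltnW lN) // -(perm_size (tP lN)); split=> //.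
  apply: regular_vars_sub good; last by rewrite -(perm_uniq (tP lN)) (sorted_vars_uniq (ltnW lN)).
  by move=> x; rewrite -(perm_mem (tP lN)); apply/sub_sorted_vars/ltnW.
- move=> l lN; rewrite count_sorted_word ?(ltnW lN) //.
  have [u ->] := t'u lN; split=> //; apply: regular_vars_sub good => //; exact: t'N.
- by rewrite (perm_size ysP).
- by move=> a b; rewrite !(perm_mem ysP); exact: hd.
rewrite /word_pairing (sum_permutations_single (perm_refl _)); last first.
  move=> r pr rw; rewrite word_weight_sorted ?(negPf rw) ?mul0r //.
    by rewrite (perm_all _ pr) all_sorted_word.
  by move=> l lN; rewrite (seq.permP pr) count_sorted_word.
by rewrite word_weight_sorted ?eqxx ?all_sorted_word //; exact: count_sorted_word.
Qed.

Lemma word_pairing_eq0 l : (l < N)%N -> ~~ perm_eq (sorted_vars l) (t' l) ->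
  word_pairing mu mu' N (sorted_word N) ys t t' = 0.
Proof.
move=> lN np; rewrite word_pairing_sorted; apply/eqP; rewrite mulf_eq0; apply/orP; right.
apply: contraNT np => nz; apply: (word_weight_rev_neq0 t'u t's _ nz) => // k kN.
by apply: t'N; rewrite -kN.
Qed.

Lemma word_pairing_diag : (forall l, (l < N)%N -> perm_eq (sorted_vars l) (t' l)) ->
  (\prod_(l < N) th h ^+ size (sorted_vars l)) ^+ 2 *
  word_pairing mu mu' N (sorted_word N) ys t t' =
  \prod_(l < N) (level_square l ^+ 2 *
    (level_cross (fun b a => th (h + b - a)) l * level_cross (fun b a => th (b - a)) l)).
Proof.
move=> t'P; have [uN d _] := good.
rewrite word_pairing_sorted word_weight_rev_single //; last first.
  by move=> l lN; apply: sorted_vars_uniq uN.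
rewrite expr2 mulrACA -!big_split; apply: eq_bigr => l _ /=.
have lS : (size (sorted_vars l.+1) <= size (sorted_vars N))%N.
  by apply: uniq_leq_size; [exact: sorted_vars_uniq uN | exact: sub_sorted_vars].
have uY : uniq (sorted_vars l) by apply: sorted_vars_uniq uN; apply: ltnW.
have dY : {in sorted_vars l &, forall a b, a != b -> th (a - b) != 0}.
  by move=> a b aY bY; apply: d; apply: (sub_sorted_vars (ltnW (ltn_ord l))).
rewrite (level_weight_sorted_level g (ltn_ord l) lS) //.
rewrite (level_weight_rev_level g' (ltn_ord l) lS) //.
by rewrite mulrACA.
Qed.
End Orthogonality.
End Sorted.
End WordOrthogonality.

(** * Ordered partitions as words *)

Section PartitionWords.
Variables (n N : nat).
Implicit Types (I : N.-tuple {set 'I_n}) (lam : N.-tuple nat).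

(** The same search as in [block], with the element given directly instead of by its position in a
    level, so that the two agree by conversion. *)
Definition color I (i : nat) : nat :=
  find (fun A : {set 'I_n} => [exists x in A, val x == i]) I.

Definition word I : seq nat := [seq color I i | i <- iota 0 n].

Definition elts I k : seq nat := [seq val i | i <- enum (level I k)].

Lemma size_word I : size (word I) = n.
Proof. by rewrite size_map size_iota. Qed.

Lemma nth_word I i c : (i < n)%N -> nth c (word I) i = color I i.
Proof. by move=> lti; rewrite (nth_map 0%N) ?size_iota // nth_iota. Qed.

Section Ordpart.
Variables (lam : N.-tuple nat) (I : N.-tuple {set 'I_n}).
Hypothesis hI : I \in ordpart n lam.

Lemma ordpartP : [/\ forall k, #|tnth I k| = tnth lam k,
  forall k l, k != l -> [disjoint tnth I k & tnth I l] &
  forall i : 'I_n, exists k, i \in tnth I k].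
Proof.
move: hI; rewrite inE => /and3P[/forallP sz /forallP dis /eqP cov]; split.
- by move=> k; apply/eqP.
- by move=> k l kl; have /forallP/(_ l)/implyP := dis k; apply.
by move=> i; have := in_setT i; rewrite -cov => /bigcupP[k _ ik]; exists k.
Qed.

Lemma colorE (i : 'I_n) (k : 'I_N) : (color I i == k :> nat) = (i \in tnth I k).
Proof.
have exE (A : {set 'I_n}) : [exists x in A, val x == val i] = (i \in A).
  apply/existsP/idP => [[x /andP[xA /eqP/val_inj <-]]//|iA].
  by exists i; rewrite iA eqxx.
have [_ dis cov] := ordpartP; have [l il] := cov i.
have hasI : has (fun A : {set 'I_n} => [exists x in A, val x == val i]) I.
  by apply/hasP; exists (tnth I l); rewrite ?mem_tnth ?exE.
have lt : (color I i < N)%N by rewrite -[X in (_ < X)%N](size_tuple I) -has_find.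
have cI : i \in tnth I (Ordinal lt).
  by have := nth_find set0 hasI; rewrite exE (tnth_nth set0).
apply/eqP/idP => [cE|ik]; first by rewrite (_ : k = Ordinal lt) //; apply: val_inj.
apply/eqP; rewrite -[color I i]/(val (Ordinal lt)) (inj_eq val_inj).
by apply: contraTT cI => /dis /disjointFl ->.
Qed.

Lemma color_lt (i : 'I_n) : (color I i < N)%N.
Proof. by have [_ _ /(_ i)[k]] := ordpartP; rewrite -colorE => /eqP ->. Qed.

Lemma mem_level k (i : 'I_n) : (i \in level I k) = (color I i < k)%N.
Proof.
apply/bigcupP/idP => [[j jk]|lt]; first by rewrite -colorE => /eqP ->.
by exists (Ordinal (color_lt i)); rewrite -?colorE.
Qed.

Lemma eltsE k : elts I k = [seq i <- iota 0 n | (color I i < k)%N].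
Proof.
rewrite -val_enum_ord filter_map; congr map; rewrite /enum_mem -filter_predI.
by apply: eq_filter => x /=; rewrite !inE andbT mem_level.
Qed.

Lemma elts_sorted k : sorted ltn (elts I k).
Proof. by rewrite eltsE sorted_filter ?iota_ltn_sorted //; exact: ltn_trans. Qed.

Lemma map_color_elts k : [seq color I i | i <- elts I k] =
  [seq c <- word I | (c < k)%N].
Proof. by rewrite eltsE filter_map. Qed.

Lemma elts_filter k : [seq i <- elts I k.+1 | (color I i < k)%N] = elts I k.
Proof.
rewrite !eltsE -filter_predI; apply: eq_filter => x /=.
by apply: andb_idr => /ltnW.
Qed.

Lemma count_word (k : 'I_N) : count_mem (val k) (word I) = tnth lam k.
Proof.
have [<- _ _] := ordpartP; rewrite cardE size_filter /word count_map.
rewrite -val_enum_ord count_map enumT; apply: eq_count => x /=.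
by rewrite -[RHS]colorE eq_sym.
Qed.

Lemma all_word : all (fun c => c < N)%N (word I).
Proof.
apply/allP => c; case/mapP => i; rewrite mem_iota => /= iN ->.
exact: (color_lt (Ordinal iN)).
Qed.

Lemma size_elts k : size (elts I k) = lamsum lam k.
Proof.
rewrite size_map -cardE -sum1_card.
rewrite (partition_big (fun x => Ordinal (color_lt x)) (fun j : 'I_N => j < k)%N) /=;
  last by move=> x; rewrite mem_level.
rewrite /lamsum; apply: eq_bigr => j jk; have [<- _ _] := ordpartP.
rewrite -sum1_card; apply: eq_bigl => x.
rewrite mem_level -colorE -(inj_eq val_inj) /=.
by apply: andb_idl => /eqP ->.
Qed.

(** As [j <= k], block [j] lies in level [k.+1], whose enumeration is increasing; its elements below
    [e] are therefore exactly those of color [j] in the prefix [E1]. *)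
Lemma pcountE k j (e : nat) E1 E2 : (j <= k < N)%N -> elts I k.+1 = E1 ++ e :: E2 ->
  count_mem j [seq color I i | i <- E1] = pcount I j e.
Proof.
move=> /andP[jk kN] EE.
have jN : (j < N)%N by apply: leq_ltn_trans kN.
have srt := elts_sorted k.+1; rewrite EE in srt.
have E1E : E1 = [seq i <- elts I k.+1 | (i < e)%N].
  move: srt; rewrite EE (sorted_pairwise ltn_trans) pairwise_cat /= filter_cat.
  move=> /and3P[/allrelP lt _ /andP[/allP gt _]].
  rewrite /= ltnn (_ : [seq i <- E2 | _] = [::]) ?cats0.
    by symmetry; apply/all_filterP/allP => x xE; apply: lt; rewrite ?mem_head.
  apply/eqP; rewrite -(negbK (_ == _)) -has_filter; apply/hasPn => x /gt ex.
  by rewrite -leqNgt ltnW.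
rewrite E1E eltsE -filter_predI count_map count_filter /pcount.
rewrite -val_enum_ord count_map cardE size_filter enumT; apply: eq_count => x /=.
rewrite inE -[nth set0 I j]/(nth set0 I (Ordinal jN)) -tnth_nth -colorE /=.
case: eqP => //= ->; rewrite andbC; apply: andb_idl => _.
by rewrite ltnS.
Qed.

End Ordpart.

Lemma eq_word lam I I' : I \in ordpart n lam -> I' \in ordpart n lam ->
  word I = word I' -> I = I'.
Proof.
move=> hI hI' e; apply: eq_from_tnth => k; apply/setP => i.
by rewrite -(colorE hI) -(colorE hI') -!(nth_word _ 0%N (ltn_ord i)) e.
Qed.

Definition unword (w : seq nat) : N.-tuple {set 'I_n} :=
  [tuple [set i : 'I_n | nth 0%N w i == k] | k < N].

Section Unword.
Variables (lam : N.-tuple nat) (w : seq nat).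
Hypothesis sw : size w = n.
Hypothesis wN : all (fun c => c < N)%N w.
Hypothesis wlam : forall k : 'I_N, count_mem (val k) w = tnth lam k.

Lemma unword_ordpart : unword w \in ordpart n lam.
Proof.
rewrite inE; apply/and3P; split.
- apply/forallP => k; rewrite tnth_mktuple -wlam cardE size_filter.
  rewrite -[w in count_mem _ w](mkseq_nth 0%N) sw count_map -val_enum_ord count_map.
  by rewrite enumT; apply/eqP/eq_count => i /=; rewrite inE.
- apply/forallP => k; apply/forallP => l; apply/implyP => kl.
  rewrite !tnth_mktuple -setI_eq0; apply/eqP/setP => i; rewrite !inE.
  by apply: contraNF kl => /andP[/eqP e1 /eqP e2]; apply/eqP/val_inj; rewrite /= -e1.
apply/eqP/setP => i; rewrite in_setT; apply/bigcupP.
have lt : (nth 0%N w i < N)%N by apply: (allP wN); rewrite mem_nth ?sw.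
by exists (Ordinal lt) => //; rewrite tnth_mktuple inE.
Qed.

Lemma word_unword : word (unword w) = w.
Proof.
apply: (@eq_from_nth _ 0%N); rewrite size_word ?sw // => i lti.
have h := unword_ordpart; rewrite nth_word //.
have lt := color_lt h (Ordinal lti).
have := colorE h (Ordinal lti) (Ordinal lt); rewrite eqxx tnth_mktuple inE.
by move=> /esym/eqP.
Qed.
End Unword.

Lemma perm_word lam I w0 : I \in ordpart n lam -> all (fun c => c < N)%N w0 ->
  (forall k : 'I_N, count_mem (val k) w0 = tnth lam k) -> perm_eq (word I) w0.
Proof.
move=> hI w0N w0lam; apply/allP => c; rewrite mem_cat => cw /=.
have cN : (c < N)%N by case/orP: cw; [apply: (allP (all_word hI)) | apply: (allP w0N)].
by have := w0lam (Ordinal cN); rewrite -(count_word hI) /= => ->.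
Qed.

(** Words give a bijection with the rearrangements of [w0]: [eq_word] is injectivity, and [unword]
    provides the preimages. *)
Lemma sum_ordpart (F : zmodType) lam w0 (f : seq nat -> F) : size w0 = n ->
  all (fun c => c < N)%N w0 ->
  (forall k : 'I_N, count_mem (val k) w0 = tnth lam k) ->
  \sum_(J in ordpart n lam) f (word J) = \sum_(w <- permutations w0) f w.
Proof.
move=> sw w0N w0lam; rewrite -big_enum -(big_map (@word) predT f) /=.
apply: perm_big; apply: uniq_perm; last 1 first.
- move=> w; rewrite mem_permutations; apply/mapP/idP => [[J]|pw].
    by rewrite mem_enum => hJ ->; apply: perm_word w0lam.
  have sw' : size w = n by rewrite (perm_size pw).
  have wN : all (fun c => c < N)%N w by rewrite (perm_all _ pw).
  have wlam (k : 'I_N) : count_mem (val k) w = tnth lam k by rewrite (seq.permP pw).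
  exists (unword w); last by rewrite (word_unword sw' wN wlam).
  by rewrite mem_enum; apply: unword_ordpart.
- rewrite map_inj_in_uniq ?enum_uniq // => I I'; rewrite !mem_enum.
  exact: eq_word.
exact: permutations_uniq.
Qed.

Lemma permpart_ordpart lam I (s : 'S_n) : I \in ordpart n lam ->
  permpart s I \in ordpart n lam.
Proof.
move=> /ordpartP[sz dis cov]; rewrite inE; apply/and3P; split.
- by apply/forallP => k; rewrite tnth_map card_imset ?sz //; exact: perm_inj.
- apply/forallP => k; apply/forallP => l; apply/implyP => kl; rewrite !tnth_map.
  by rewrite imset_disjoint ?dis //; exact: perm_inj.
apply/eqP/setP => i; rewrite in_setT; apply/bigcupP.
have [k ik] := cov (s^-1%g i); exists k => //.
by rewrite tnth_map -(permKV s i) imset_f.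
Qed.

Lemma color_permpart lam I (s : 'S_n) (i : 'I_n) : I \in ordpart n lam ->
  color (permpart s^-1%g I) i = color I (s i).
Proof.
move=> hI; have hp := permpart_ordpart s^-1%g hI.
have mE (A : {set 'I_n}) : (i \in s^-1%g @: A) = (s i \in A).
  by rewrite -{1}(permK s i) mem_imset //; exact: perm_inj.
have := colorE hp i (Ordinal (color_lt hI (s i))); rewrite tnth_map mE.
by rewrite -(colorE hI) eqxx => /eqP.
Qed.

Lemma word_longest lam I : I \in ordpart n lam ->
  word (permpart (longest n)^-1%g I) = rev (word I).
Proof.
move=> hI; apply: (@eq_from_nth _ 0%N); rewrite ?size_rev ?size_word // => i lti.
rewrite nth_rev ?size_word // !nth_word //; last by rewrite ltn_subrL (leq_trans _ lti).
by have := color_permpart (longest n) (Ordinal lti) hI; rewrite permE.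
Qed.

Lemma permpart1 I : permpart 1^-1%g I = I.
Proof.
apply: eq_from_tnth => k; rewrite tnth_map invg1; apply/setP => x.
by apply/imsetP/idP => [[y yI ->]|xI]; [rewrite perm1 | exists x; rewrite ?perm1].
Qed.

End PartitionWords.

(** * From products over indices to products over letters *)

Section LevelWeightIndex.
Variables (F : numFieldType) (th : F -> F) (h : F).
Implicit Types (E : seq nat) (xs ys : seq F) (col : nat -> nat) (d : nat -> F).

Definition psi_at d (e e' : nat) (u : F) : F :=
  if (e' < e)%N then th (h + u) else if (e < e')%N then th u
  else th (u + d e) / th (d e).

Lemma prod_level_items k w xs ys (f g : F -> F) : size ys = size w ->
  size xs = count (fun c => c < k)%N w ->
  \prod_(i <- level_items k w xs ys) (f i.2 * (if (i.1.1 < k)%N then g i.1.2 else 1)) =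
  \prod_(y <- ys) f y * \prod_(x <- xs) g x.
Proof.
elim: w xs ys => [|c w IH] xs [|y ys] //=.
  by move=> _ /size0nil ->; rewrite !big_nil mulr1.
move=> [sy]; case: ifP => ck.
  case: xs => [//|x xs] /= [sx]; rewrite !big_cons /= ck IH //; ring.
by move=> sx; rewrite !big_cons /= ck IH //; ring.
Qed.

(** Induction on the increasing list [E]: its head is smaller than all later elements, so every
    comparison in psi with it is decided, and it consumes the first own variable exactly when its
    letter is below [k]. The function [d] abstracts the dynamical argument, whose dependence on the
    prefix is recorded in the last hypothesis. *)
Lemma level_weight_index mu k u col d E xs ys : sorted ltn E ->
  size ys = size E -> size xs = count (fun e => col e < k)%N E ->
  (forall E1 e E2, E = E1 ++ e :: E2 -> (col e < k)%N ->
     h + dyn_diff h mu (u ++ [seq col i | i <- E1]) (col e) k = d e) ->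
  let E' := [seq e <- E | (col e < k)%N] in
  \prod_(0 <= a < size E')
    ((\prod_(0 <= c < size E) psi_at d (nth 0%N E' a) (nth 0%N E c) (ys`_c - xs`_a)) *
     \prod_(a.+1 <= b < size E') (th (h + xs`_b - xs`_a) / th (xs`_b - xs`_a))) =
  level_weight th h mu k u (level_items k [seq col e | e <- E] xs ys).
Proof.
elim: E u xs ys => [|e E IH] u xs ys /=; first by rewrite big_geq.
case: ys => [//|y ys] srt [sy] sx dE.
have srtE : sorted ltn E by apply: path_sorted srt.
have eE : all (ltn e) E by rewrite (order_path_min ltn_trans srt).
have dE' : forall E1 e' E2, E = E1 ++ e' :: E2 -> (col e' < k)%N ->
     h + dyn_diff h mu (rcons u (col e) ++ [seq col i | i <- E1]) (col e') k = d e'.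
  by move=> E1 e' E2 EE ek; rewrite cat_rcons -(dE (e :: E1) e' E2) // EE.
set E' := [seq e <- E | (col e < k)%N] in sx *.
have lt (a : nat) : (a < size E')%N -> (e < (nth 0%N E' a))%N.
  move=> aE; have : (nth 0%N E' a) \in E' by apply: mem_nth.
  by rewrite mem_filter => /andP[_ /(allP eE)].
have psi0 a z : (a < size E')%N -> psi_at d (nth 0%N E' a) e z = th (h + z).
  by move=> aE; rewrite /psi_at lt.
have sizE' : size E' = count (fun e => col e < k)%N E by rewrite size_filter.
have tail_prod x1 : size x1 = size E' ->
    \prod_(0 <= a < size E')
    ((\prod_(0 <= c < (size E).+1) psi_at d (nth 0%N E' a) (nth 0%N (e :: E) c)
        (nth 0 (y :: ys) c - x1`_a)) *
     \prod_(a.+1 <= b < size E') (th (h + x1`_b - x1`_a) / th (x1`_b - x1`_a))) =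
    \prod_(x <- x1) th (h + y - x) *
    level_weight th h mu k (rcons u (col e)) (level_items k [seq col e | e <- E] x1 ys).
  move=> s1; rewrite -(IH _ x1 ys srtE sy _ dE') ?s1 // (big_nth 0) s1 -big_split.
  rewrite !big_mkord; apply: eq_bigr => a _.
  by rewrite big_nat_recl //= psi0 // !mulrA addrA.
case: ifP sx => [ek|ek] /= sx; last first.
  rewrite tail_prod ?sizE' //= /own_factor /= ek mul1r; congr (_ * _).
  have := @prod_level_items k [seq col e | e <- E] xs ys (fun=> 1) (fun x => th (h + y - x)).
  rewrite big1_eq mul1r size_map count_map => <- //.
  apply: eq_bigr => i _; rewrite /pair_factor /= ek /= !mulr1 mul1r; reflexivity.
case: xs sx => [//|x xs] [sx] /=.
rewrite big_nat_recl // [X in _ * X = _](_ : _ = \prod_(x <- xs) th (h + y - x) *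
    level_weight th h mu k (rcons u (col e))
      (level_items k [seq col e | e <- E] xs ys)); last first.
  rewrite -tail_prod ?sizE' //; apply: eq_bigr => a _; rewrite big_add1; reflexivity.
rewrite big_nat_recl //=.
have d0 : d e = h + dyn_diff h mu u (col e) k.
  by rewrite -(dE [::] e E) ?cats0.
have -> : psi_at d e e (y - x) = own_factor th h mu k u (col e, x, y).
  by rewrite /psi_at ltnn /own_factor /= ek d0.
rewrite big_add1 /= -!mulrA; congr (_ * _); rewrite !mulrA; congr (_ * _).
have := @prod_level_items k [seq col e | e <- E] xs ys (fun y' => th (y' - x))
    (fun x' => th (h + y - x') * (th (h + x' - x) / th (x' - x))).
rewrite size_map count_map => e1.
rewrite (eq_bigr (fun i : item F => th (i.2 - x) * (if (i.1.1 < k)%N then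
   th (h + y - i.1.2) * (th (h + i.1.2 - x) / th (i.1.2 - x)) else 1))); last first.
  by move=> i _; rewrite /pair_factor /= ek /=; case: ifP => _; ring.
rewrite e1 // [LHS]mulrAC -[LHS]mulrA; congr (_ * _).
  rewrite [RHS](big_nth 0) sy !big_mkord; apply: eq_bigr => c _.
  have lt' : (e < nth 0%N E c)%N by apply: (allP eE); rewrite mem_nth.
  by rewrite /psi_at ltnNge (ltnW lt') /= lt'.
by rewrite [RHS]big_split; congr (_ * _); rewrite [RHS](big_nth 0) sx -sizE'.
Qed.
End LevelWeightIndex.

(** * Symmetrization one level at a time *)

Section Chain.
Variables (R : realType) (N : nat) (lam : N.-tuple nat).
Implicit Types (t : nat -> nat -> R[i]) (x y : nat -> R[i]).
Local Notation L := (lamsum lam).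
Local Notation sym := (foldr (symvar lam)).

Definition permseq m (s : 'S_m) x : nat -> R[i] :=
  fun a => x (oapp (fun i => val (s i)) a (insub a)).

Lemma permvar_eq k (s : 'S_(L k)) t : permvar s t k = permseq s (t k).
Proof. by apply: funext => a; rewrite /permvar eqxx. Qed.

Lemma permvar_neq k (s : 'S_(L k)) t m : m != k -> permvar s t m = t m.
Proof. by move=> mk; apply: funext => a; rewrite /permvar (negPf mk). Qed.

Lemma foldr_symvar_ext m ks (f g : (nat -> nat -> R[i]) -> R[i]) t : m \notin ks ->
  (forall t', t' m = t m -> f t' = g t') -> sym f ks t = sym g ks t.
Proof.
elim: ks t => [|k ks IH] t /=; first by move=> _; apply.
rewrite inE negb_or => /andP[mk mks] fg; apply: eq_bigr => s _; apply: IH => // t' tm.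
by apply: fg; rewrite tm permvar_neq.
Qed.

Lemma foldr_symvar_sum (I : finType) (c : I -> R[i])
    (g : I -> (nat -> nat -> R[i]) -> R[i]) ks t :
  sym (fun t' => \sum_i c i * g i t') ks t = \sum_i c i * sym (g i) ks t.
Proof.
elim: ks t => [//|k ks IH] t.
transitivity (\sum_(s : 'S_(L k)) \sum_i c i * sym (g i) ks (permvar s t)).
  by apply: eq_bigr => s _; apply: IH.
by rewrite exchange_big; apply: eq_bigr => i _; rewrite mulr_sumr.
Qed.

Variable Fk : nat -> (nat -> R[i]) -> (nat -> R[i]) -> R[i].

(** The simultaneous symmetrization rewritten as a recursion from the top level, in the form of
    [word_weight]. It stops at level 1, the lowest level that is symmetrized. *)
Fixpoint chain m y t : R[i] :=
  if m is m'.+1 then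
    if m' == 0%N then 1 else
    \sum_(s : 'S_(L m')) Fk m' y (permseq s (t m')) * chain m' (permseq s (t m')) t
  else 1.

Definition chainprod m y t :=
  \prod_(1 <= k < m) Fk k (if k.+1 == m then y else t k.+1) (t k).

Lemma chainprodS m y t : (0 < m)%N ->
  chainprod m.+1 y t = Fk m y (t m) * chainprod m (t m) t.
Proof.
move=> m0; rewrite /chainprod big_nat_recr //= eqxx mulrC; congr (_ * _).
rewrite !big_nat; apply: eq_bigr => k /andP[_ km].
by rewrite eqSS (ltn_eqF km); case: eqP => [->|].
Qed.

Lemma chainprod_permvar m (s : 'S_(L m)) y t :
  chainprod m y (permvar s t) = chainprod m y t.
Proof.
rewrite /chainprod !big_nat; apply: eq_bigr => k /andP[_ km].
rewrite (permvar_neq s t (negbT (ltn_eqF km))); case: eqP => // /eqP km'.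
by rewrite permvar_neq.
Qed.

(** The highest level is innermost in the fold. The outer symmetrizations do not touch [t m], so its
    sum can be expanded with [t m] fixed and then moved outside by linearity. *)
Lemma foldr_symvar_chain m y t : sym (chainprod m y) (index_iota 1 m) t = chain m y t.
Proof.
elim: m y t => [|m IH] y t; first by rewrite /= /chainprod big_geq.
rewrite /=; case: eqP => [->|/eqP]; first by rewrite /= /chainprod big_geq.
rewrite -lt0n => m0; have -> : index_iota 1 m.+1 = rcons (index_iota 1 m) m.
  case: m m0 {IH} => // m _.
  by rewrite /index_iota !subn1 -[m.+2.-1]addn1 iotaD cats1 add1n.
rewrite foldr_rcons (@foldr_symvar_ext m _ _ (fun t' =>
   \sum_(s : 'S_(L m)) Fk m y (permseq s (t m)) * chainprod m (permseq s (t m)) t')).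
- by rewrite foldr_symvar_sum; apply: eq_bigr => s _; rewrite IH.
- by rewrite mem_index_iota ltnn andbF.
move=> t' tm; apply: eq_bigr => s _.
by rewrite chainprodS // permvar_eq tm chainprod_permvar.
Qed.

End Chain.

Section SumPerm.
Variables (R : realType) (m : nat) (x : nat -> R[i]).

Lemma mkseq_permseq (s : 'S_m) :
  mkseq (permseq s x) m = [seq x (s i) | i <- enum 'I_m].
Proof.
rewrite /mkseq -val_enum_ord -map_comp; apply: eq_map => i /=.
by rewrite /permseq valK.
Qed.

Lemma perm_mkseq_permseq (s : 'S_m) : perm_eq (mkseq (permseq s x) m) (mkseq x m).
Proof.
rewrite mkseq_permseq /mkseq -val_enum_ord -map_comp (map_comp (fun i : 'I_m => x i) s).
apply: perm_map; apply: uniq_perm.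
- by rewrite map_inj_uniq ?enum_uniq //; apply: perm_inj.
- exact: enum_uniq.
move=> i; rewrite mem_enum; apply/mapP; exists (s^-1%g i); rewrite ?permKV //.
by rewrite mem_enum.
Qed.

(** [permutations] lists each rearrangement once, while Sym sums over the permutations themselves;
    the two agree because distinct values make a permutation recoverable from its rearrangement. *)
Lemma sum_perm_permutations (f : seq R[i] -> R[i]) : uniq (mkseq x m) ->
  \sum_(s : 'S_m) f (mkseq (permseq s x) m) = \sum_(xs <- permutations (mkseq x m)) f xs.
Proof.
move=> ux; rewrite -(big_map (fun s : 'S_m => mkseq (permseq s x) m) predT f) /=.
have um : uniq [seq mkseq (permseq s x) m | s <- index_enum 'S_m].
  rewrite map_inj_uniq ?index_enum_uniq // => s s'; rewrite !mkseq_permseq => /eq_in_map e.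
  apply/permP => i; apply: val_inj.
  have := e i; rewrite mem_enum => /(_ isT) /eqP.
  have := nth_uniq 0 _ _ ux; rewrite size_mkseq.
  by move=> /(_ _ _ (ltn_ord (s i)) (ltn_ord (s' i))); rewrite !nth_mkseq // => -> /eqP.
apply: perm_big; apply: uniq_perm; rewrite ?permutations_uniq //.
apply: (uniq_min_size um _ _).2.
  by move=> r /mapP[s _ ->]; rewrite mem_permutations perm_mkseq_permseq.
rewrite size_permutations // size_mkseq size_map -card_Sn.
by rewrite cardE enumT.
Qed.
End SumPerm.

Section WeightWord.
Variables (R : realType) (n N : nat) (tau h : R[i]) (lam : N.-tuple nat).
Variables (I : N.-tuple {set 'I_n}) (mu : N.-tuple R[i]).
Hypothesis hI : I \in ordpart n lam.
Hypothesis N0 : (0 < N)%N.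
Local Notation L := (lamsum lam).
Local Notation th := (theta tau).
Implicit Types (x y : nat -> R[i]) (t : nat -> nat -> R[i]).

Definition mu_fun : nat -> R[i] := fun k => mu`_k.

Definition level_factor k y x : R[i] :=
  \prod_(0 <= a < L k)
    ((\prod_(0 <= c < L k.+1) psi tau I k a c h mu (y c - x a)) *
     \prod_(a.+1 <= b < L k) (th (h + x b - x a) / th (x b - x a))).

Lemma WsummandE (z : n.-tuple R[i]) t :
  Wsummand tau lam I z h mu t = chainprod level_factor N (fun a => z`_a) t.
Proof.
rewrite /Wsummand /chainprod !big_nat; apply: eq_bigr => k /andP[_ kN].
have wE j : withz N t z j = if j == N then (fun a => z`_a) else t j.
  by apply: funext => a; rewrite /withz; case: eqP.
by rewrite !wE (ltn_eqF kN).
Qed.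

Lemma level_factorE k y x : (k < N)%N -> level_factor k y x =
  level_weight th h mu_fun k [::] (level_items k [seq c <- word I | (c < k.+1)%N]
    (mkseq x (L k)) (mkseq y (L k.+1))).
Proof.
move=> kN; pose d e := (1 + (pcount I (color I e) e)%:R - (pcount I k e)%:R) * h +
  mu`_k - mu`_(color I e).
rewrite -(map_color_elts hI) -(@level_weight_index _ _ _ _ _ _ _ d) ?size_mkseq ?(size_elts hI) //.
- rewrite (elts_filter hI) (size_elts hI) /level_factor !big_mkord.
  apply: eq_bigr => a _; congr (_ * _).
    rewrite !big_mkord; apply: eq_bigr => c _; rewrite !nth_mkseq //.
  by rewrite !big_nat; apply: eq_bigr => b /andP[_ bL]; rewrite !nth_mkseq.
- exact: (elts_sorted hI).
- by rewrite -size_filter (elts_filter hI) (size_elts hI).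
move=> E1 e E2 EE ek; rewrite cat0s /dyn_diff /d /mu_fun.
rewrite !(pcountE hI _ EE) ?leqnn ?(ltnW ek) ?kN //; ring.
Qed.

Lemma level_weight0 (F : numFieldType) (th' : F -> F) h' mu' u its :
  level_weight th' h' mu' 0 u its = 1.
Proof.
elim: its u => //= i its IH u; rewrite IH /own_factor ltn0 mul1r mulr1.
by rewrite big1 // => j _; rewrite /pair_factor !ltn0 !mulr1.
Qed.

Lemma chain_W m y t : (m <= N)%N ->
  (forall k, (0 < k < m)%N -> uniq (mkseq (t k) (L k))) ->
  chain lam level_factor m y t =
  word_weight th h mu_fun m [seq c <- word I | (c < m)%N] (mkseq y (L m))
    (fun k => mkseq (t k) (L k)).
Proof.
elim: m y => [//|m IH] y mN ut; rewrite word_weightS [LHS]/=.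
(* Level 0 is empty: [word_weight] has a sum with one trivial term there, whereas [chain] omits
   it. *)
have [m0|m0] := eqVneq m 0%N.
  have L0 : L 0 = 0%N by rewrite /lamsum big_pred0.
  have -> : permutations (mkseq (t m) (L m)) = [:: [::]] by rewrite m0 L0.
  by rewrite big_seq1 m0 level_weight0 mulr1.
have filE : [seq c <- [seq c <- word I | (c < m.+1)%N] | (c < m)%N] =
    [seq c <- word I | (c < m)%N].
  by rewrite -filter_predI; apply: eq_filter => c /=; apply: andb_idr => /ltnW.
rewrite filE -sum_perm_permutations; last by rewrite ut // ltnSn lt0n m0.
apply: eq_bigr => s _; rewrite level_factorE // mulrC IH ?(ltnW mN) //.
by move=> k /andP[k0 km]; rewrite ut // k0 ltnW.
Qed.

Lemma Well_word (z : n.-tuple R[i]) t : lamsum lam N = n ->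
  (forall k, (0 < k < N)%N -> uniq (mkseq (t k) (L k))) ->
  Well tau lam I t z h mu = th h ^+ lamtot lam *
    word_weight th h mu_fun N (word I) z (fun k => mkseq (t k) (L k)).
Proof.
move=> LN ut; rewrite /Well; congr (_ * _).
rewrite (funext (WsummandE z)) foldr_symvar_chain chain_W //.
rewrite (all_filterP (all_word hI)) LN; congr (word_weight _ _ _ _ _ _ _).
by rewrite -[RHS](mkseq_nth 0) size_tuple.
Qed.

End WeightWord.

(** * Levels and blocks at the points z_I *)

Section Blocks.
Variables (R : realType) (n N : nat) (tau h : R[i]) (lam : N.-tuple nat).
Variables (z : n.-tuple R[i]) (I : N.-tuple {set 'I_n}).
Hypothesis hI : I \in ordpart n lam.
Hypothesis N0 : (0 < N)%N.
Local Notation L := (lamsum lam).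
Local Notation th := (theta tau).

Definition blocks (k : nat) : seq R[i] := [seq z`_(val i) | i <- enum (nth set0 I k)].
Definition subst_level k : seq R[i] := [seq z`_i | i <- elts I k].
Local Notation sorted_vars := (sorted_vars blocks).
Local Notation sorted_word := (sorted_word blocks).

Lemma mkseq_substz k : mkseq (substz I z k) (L k) = subst_level k.
Proof.
rewrite -(size_elts hI) /subst_level -[in RHS](mkseq_nth 0%N (elts I k)) -map_comp.
exact: eq_map.
Qed.

Lemma size_blocks (k : 'I_N) : size (blocks k) = tnth lam k.
Proof. by have [sz _ _] := ordpartP hI; rewrite size_map -cardE -tnth_nth sz. Qed.

Lemma perm_sorted_vars k : (k <= N)%N -> perm_eq (sorted_vars k) (subst_level k).
Proof.
elim: k => [_|k IH kN].
  rewrite /subst_level (eltsE hI) (_ : [seq i <- _ | _] = [::]) //.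
  by elim: (iota _ _).
have -> : subst_level k.+1 = [seq z`_i | i <- elts I k.+1] by [].
apply: (@perm_trans _ [seq z`_i | i <- [seq val i | i <- enum (nth set0 I k)] ++ elts I k]).
  by rewrite map_cat -map_comp; apply: perm_cat; [exact: perm_refl | apply/IH/ltnW].
apply: perm_map; rewrite (eltsE hI) (eltsE hI).
apply: uniq_perm; rewrite ?filter_uniq ?iota_uniq //.
  rewrite cat_uniq filter_uniq ?iota_uniq // andbT map_inj_uniq ?enum_uniq /=; last exact: val_inj.
  apply/hasPn => i; rewrite mem_filter => /andP[ik _]; apply/negP; case/mapP => j.
  rewrite mem_enum -[k]/(val (Ordinal kN)) -tnth_nth -(colorE hI) /= => /eqP jk ij.
  by rewrite ij jk ltnn in ik.
move=> i; rewrite mem_cat !mem_filter mem_iota /= add0n.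
have [iN|iN] := ltnP i n; last first.
  rewrite !andbF orbF; apply/negP; case/mapP => j _ ij.
  by rewrite ij leqNgt ltn_ord in iN.
rewrite !andbT [RHS]leq_eqVlt eqSS ltnS; congr (_ || _).
have [j <-] : exists j : 'I_n, val j = i by exists (Ordinal iN).
rewrite mem_map ?mem_enum; last exact: val_inj.
by rewrite -[X in nth _ _ X]/(val (Ordinal kN)) -tnth_nth -(colorE hI).
Qed.

Lemma count_sorted_word_mem k l : count_mem k (sorted_word l) =
  if (k < l)%N then size (blocks k) else 0%N.
Proof.
elim: l => //= l IH; rewrite count_cat count_nseq IH ltnS /= eq_sym.
by case: ltngtP => [kl|kl|->] /=; rewrite ?mul0n ?mul1n ?addn0 ?add0n.
Qed.

Lemma subst_levelN : subst_level N = z.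
Proof.
rewrite /subst_level (eltsE hI) (_ : [seq i <- _ | _] = iota 0 n).
  by rewrite -[RHS](mkseq_nth 0) size_tuple.
apply/all_filterP/allP => i; rewrite mem_iota => /= iN.
exact: (color_lt hI (Ordinal iN)).
Qed.

Lemma level_squareE :
  \prod_(l < N) level_square th h blocks l = Eell tau lam (substz I z) h.
Proof.
rewrite -(big_mkord predT) big_ltn // {1}/level_square big_nil mul1r /Eell.
rewrite !big_nat; apply: eq_bigr => k /andP[_ kN].
rewrite /level_square (perm_big _ (perm_sorted_vars (ltnW kN))) -mkseq_substz.
rewrite (big_nth 0) size_mkseq !big_mkord; apply: eq_bigr => a _.
rewrite (perm_big _ (perm_sorted_vars (ltnW kN))) -mkseq_substz /=.
rewrite (big_nth 0) size_mkseq !big_mkord; apply: eq_bigr => b _.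
by rewrite !nth_mkseq.
Qed.

Lemma level_crossE (f : R[i] -> R[i] -> R[i]) :
  \prod_(l < N) level_cross blocks f l =
  \prod_(k < N) \prod_(l < N | (k < l)%N)
    \prod_(a in tnth I k) \prod_(b in tnth I l) f z`_b z`_a.
Proof.
have sorted_varsE l (F : R[i] -> R[i]) : (l <= N)%N ->
    \prod_(a <- sorted_vars l) F a = \prod_(k < N | (k < l)%N) \prod_(a in tnth I k) F z`_a.
  move=> lN.
  transitivity (\prod_(0 <= k < l) \prod_(a <- blocks k) F a).
    elim: l {lN} => [|l IH]; first by rewrite big_nil big_geq.
    by rewrite big_nat_recr //= big_cat /= IH mulrC.
  rewrite big_mkord (big_ord_widen _ (fun k => \prod_(a <- blocks k) F a) lN).
  apply: eq_bigr => k _.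
  by rewrite big_map big_enum -tnth_nth.
rewrite [RHS](exchange_big_dep predT) //=; apply: eq_bigr => l _.
rewrite /level_cross big_map big_enum -tnth_nth /=.
under eq_bigr do rewrite sorted_varsE ?(ltnW (ltn_ord l)) //.
by rewrite exchange_big; apply: eq_bigr => k _; rewrite exchange_big.
Qed.

Lemma lamtotE : th h ^+ lamtot lam = \prod_(l < N) th h ^+ size (sorted_vars l).
Proof.
rewrite prodrXr; congr (_ ^+ _).
rewrite -(big_mkord predT (fun l => size (sorted_vars l))) big_ltn // add0n /lamtot.
rewrite !big_nat; apply: eq_bigr => k /andP[_ kN].
by rewrite (perm_size (perm_sorted_vars (ltnW kN))) size_map (size_elts hI).
Qed.

End Blocks.

(** * Orthogonality for generic dynamical parameters *)

Lemma sum_pairing_inverse (F : fieldType) (T : finType) (A : {set T}) (X Y : T -> T -> F) :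
  {in A &, forall i k, \sum_(j in A) X i j * Y j k = (i == k)%:R} ->
  {in A &, forall j l, \sum_(i in A) Y l i * X i j = (l == j)%:R}.
Proof.
move=> XY j l jA lA.
pose mX := \matrix_(i < #|A|, k < #|A|) X (enum_val i) (enum_val k).
pose mY := \matrix_(i < #|A|, k < #|A|) Y (enum_val i) (enum_val k).
have sumE (f : T -> F) : \sum_(i in A) f i = \sum_(i < #|A|) f (enum_val i).
  by rewrite (reindex_onto enum_val (enum_rank_in jA)) /=;
    [apply: eq_bigl => i; rewrite enum_valP enum_valK_in eqxx
    | move=> i iA; rewrite enum_rankK_in].
have XY1 : mX *m mY = 1%:M.
  apply/matrixP => i k; rewrite !mxE (eq_bigr (fun j => X (enum_val i) (enum_val j) *
    Y (enum_val j) (enum_val k))) => [|? _]; last by rewrite !mxE.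
  rewrite -(sumE (fun j => X (enum_val i) j * Y j (enum_val k))) XY ?enum_valP //.
  by rewrite (inj_eq enum_val_inj).
have /matrixP/(_ (enum_rank_in lA l) (enum_rank_in lA j)) := mulmx1C XY1.
rewrite !mxE (eq_bigr (fun i => Y l (enum_val i) * X (enum_val i) j)) => [|? _]; last first.
  by rewrite !mxE !enum_rankK_in.
rewrite -(sumE (fun i => Y l i * X i j)) => ->; congr (_%:R); congr nat_of_bool.
by rewrite (can_in_eq (enum_rankK_in lA)).
Qed.

Section Generic.
Variables (R : realType) (n N : nat) (tau h : R[i]) (lam : N.-tuple nat).
Variables (z : n.-tuple R[i]) (mu : N.-tuple R[i]).
Local Notation L := (lamsum lam).
Local Notation th := (theta tau).
Hypothesis th_odd : forall u, th (- u) = - th u.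
Hypothesis th_fay : three_term th.
Hypothesis n0 : (0 < n)%N.
Hypothesis N0 : (0 < N)%N.
Hypothesis hlam : (\sum_(k < N) tnth lam k)%N = n.
Hypothesis hz : forall a b : 'I_n, a != b -> th (tnth z b - tnth z a) != 0.
Hypothesis hhz : forall a b : 'I_n, th (h + tnth z b - tnth z a) != 0.
Hypothesis g : dyn_generic th h (mu_fun mu) n N.
Hypothesis g' : dyn_generic th h (mu_fun (dualmu lam h mu)) n N.

Lemma regular_z : regular_vars th h z.
Proof.
have inz a : a \in (z : seq _) -> exists i, a = tnth z i by case/tnthP => i ->; exists i.
split.
- apply/tuple_uniqP => i j ij; apply/eqP; apply: contraTT isT => ne.
  by have := hz ne; rewrite ij subrr (odd_at0 th_odd) eqxx.
- move=> a b /inz[i ->] /inz[j ->] ne; apply: hz.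
  by apply: contraNneq ne => ->.
by move=> a b /inz[i ->] /inz[j ->]; rewrite addrA; apply: hhz.
Qed.

Lemma theta_h_neq0 : th h != 0.
Proof. by have := hhz (Ordinal n0) (Ordinal n0); rewrite addrK. Qed.

Lemma lamsumN : L N = n.
Proof. by rewrite -hlam /lamsum; apply: eq_bigl => j; rewrite ltn_ord. Qed.

Lemma uniq_subst_level I k : I \in ordpart n lam -> uniq (subst_level z I k).
Proof.
move=> hI; rewrite map_inj_in_uniq ?(eltsE hI) ?filter_uniq ?iota_uniq //.
move=> i j; rewrite !mem_filter !mem_iota !add0n /= => /andP[_ lti] /andP[_ ltj] /eqP.
by have [uz _ _] := regular_z; rewrite nth_uniq ?size_tuple // => /eqP.
Qed.

Lemma rev_tuple_longest : [tuple z`_(longest n a) | a < n] = rev z :> seq R[i].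
Proof.
apply: (@eq_from_nth _ 0); rewrite ?size_rev !size_tuple // => i lti.
rewrite nth_rev ?size_tuple //.
have [j <-] : exists j : 'I_n, val j = i by exists (Ordinal lti).
by rewrite -[LHS](tnth_nth 0) tnth_mktuple permE.
Qed.

Lemma Well_subst I J (mu1 : N.-tuple R[i]) : I \in ordpart n lam -> J \in ordpart n lam ->
  Well tau lam J (substz I z) z h mu1 =
  th h ^+ lamtot lam * word_weight th h (mu_fun mu1) N (word J) z (subst_level z I).
Proof.
move=> hI hJ; rewrite (Well_word _ _ _ hJ) ?lamsumN //; last first.
  by move=> k _; rewrite (mkseq_substz _ hI) uniq_subst_level.
congr (_ * word_weight _ _ _ _ _ _ _); apply: funext => k.
exact: mkseq_substz _ hI _.
Qed.

Lemma Wellperm_id I J : I \in ordpart n lam -> J \in ordpart n lam ->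
  Wellperm tau lam 1%g J (substz I z) z h mu =
  th h ^+ lamtot lam * word_weight th h (mu_fun mu) N (word J) z (subst_level z I).
Proof.
move=> hI hJ; rewrite /Wellperm permpart1.
have -> : [tuple z`_((1%g : 'S_n) a) | a < n] = z.
  by apply: eq_from_tnth => i; rewrite tnth_mktuple perm1 -tnth_nth.
exact: Well_subst.
Qed.

Lemma Wellperm_longest I J (mu1 : N.-tuple R[i]) :
  I \in ordpart n lam -> J \in ordpart n lam ->
  Wellperm tau lam (longest n) J (substz I z) z h mu1 =
  th h ^+ lamtot lam * word_weight th h (mu_fun mu1) N (rev (word J)) (rev z) (subst_level z I).
Proof.
move=> hI hJ; rewrite /Wellperm.
have hJ' := permpart_ordpart (longest n)^-1%g hJ.
rewrite (Well_word _ _ _ hJ') ?lamsumN //; last first.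
  by move=> k _; rewrite (mkseq_substz _ hI) uniq_subst_level.
rewrite (word_longest hJ) rev_tuple_longest; congr (_ * word_weight _ _ _ _ _ _ _).
by apply: funext => k; apply: mkseq_substz _ hI _.
Qed.

Section Pair.
Variables I I' : N.-tuple {set 'I_n}.
Hypotheses (hI : I \in ordpart n lam) (hI' : I' \in ordpart n lam).
Let bl := blocks z I.

Lemma sorted_word_count (k : 'I_N) : count_mem (val k) (sorted_word bl N) = tnth lam k.
Proof. by rewrite count_sorted_word_mem ltn_ord (size_blocks _ hI). Qed.

Lemma size_sorted_varsN : size (sorted_vars bl N) = n.
Proof. by rewrite (perm_size (perm_sorted_vars z hI (leqnn N))) (subst_levelN z hI) size_tuple. Qed.

Lemma pairing_word_sum :
  \sum_(J in ordpart n lam) word_weight th h (mu_fun mu) N (word J) z (subst_level z I) *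
    word_weight th h (mu_fun (dualmu lam h mu)) N (rev (word J)) (rev z) (subst_level z I') =
  word_pairing th h (mu_fun mu) (mu_fun (dualmu lam h mu)) N (sorted_word bl N) z
    (subst_level z I) (subst_level z I').
Proof.
rewrite (sum_ordpart (fun w => word_weight th h (mu_fun mu) N w z (subst_level z I) *
  word_weight th h (mu_fun (dualmu lam h mu)) N (rev w) (rev z) (subst_level z I'))
  (_ : size (sorted_word bl N) = n) (all_sorted_word bl N) sorted_word_count) //.
by rewrite size_sorted_word size_sorted_varsN.
Qed.

Lemma dualmu_count k : (k < N)%N ->
  mu_fun (dualmu lam h mu) k = (count_mem k (sorted_word bl N))%:R * h - mu_fun mu k.
Proof.
move=> kN; rewrite /mu_fun -[k]/(val (Ordinal kN)) -!tnth_nth tnth_mktuple.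
by rewrite sorted_word_count.
Qed.

Lemma regular_sorted_vars : regular_vars th h (sorted_vars bl N).
Proof.
apply: regular_vars_perm regular_z.
by have := perm_sorted_vars z hI (leqnn N); rewrite (subst_levelN z hI) perm_sym.
Qed.

Lemma z_sorted_vars : perm_eq z (sorted_vars bl N).
Proof. by have := perm_sorted_vars z hI (leqnn N); rewrite (subst_levelN z hI) perm_sym. Qed.

Lemma sub_subst_level l : {subset subst_level z I' l <= sorted_vars bl N}.
Proof.
move=> x /mapP[i il ->]; rewrite -(perm_mem z_sorted_vars) mem_nth // size_tuple.
by move: il; rewrite (eltsE hI') mem_filter mem_iota => /andP[_].
Qed.

Lemma sub_subst_levelS l : {subset subst_level z I' l <= subst_level z I' l.+1}.
Proof.
move=> x /mapP[i il ->]; apply: map_f; move: il.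
by rewrite !(eltsE hI') !mem_filter => /andP[/ltnW ? ->]; rewrite andbT.
Qed.

Lemma size_subst_level l : (l < N)%N -> size (subst_level z I' l) = size (sorted_vars bl l).
Proof.
move=> lN; rewrite (perm_size (perm_sorted_vars z hI (ltnW lN))).
have sz K : K \in ordpart n lam -> size (subst_level z K l) = L l.
  by move=> hK; rewrite size_map (size_elts hK).
by rewrite !sz.
Qed.

Lemma eq_ordpart : (forall l, (l < N)%N -> perm_eq (sorted_vars bl l) (subst_level z I' l)) ->
  I = I'.
Proof.
move=> p; apply: (eq_word hI hI'); rewrite /word -!val_enum_ord -!map_comp.
apply: eq_map => i /=; have [uz _ _] := regular_z.
have lvl l : (l < N)%N -> (color I i < l)%N = (color I' i < l)%N.
  move=> lN; have mE K : K \in ordpart n lam ->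
      (z`_i \in subst_level z K l) = (color K i < l)%N.
    move=> hK; apply/mapP/idP => [[j]|cl].
      rewrite (eltsE hK) mem_filter mem_iota => /andP[cl jn] /eqP.
      by rewrite nth_uniq ?size_tuple // => /eqP ->.
    by exists (val i); rewrite // (eltsE hK) mem_filter cl mem_iota /=.
  rewrite -!mE // -(perm_mem (p l lN)) (perm_mem (perm_sorted_vars z hI (ltnW lN))) //.
have cI := color_lt hI i; have cI' := color_lt hI' i.
case: (ltngtP (color I i) (color I' i)) => // lt.
  by have := lvl _ (leq_ltn_trans lt cI'); rewrite ltnSn ltnNge lt.
by have := lvl _ (leq_ltn_trans lt cI); rewrite ltnSn ltnNge lt.
Qed.

Lemma pairing_eq0 : I != I' ->
  \sum_(J in ordpart n lam) word_weight th h (mu_fun mu) N (word J) z (subst_level z I) *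
    word_weight th h (mu_fun (dualmu lam h mu)) N (rev (word J)) (rev z) (subst_level z I') = 0.
Proof.
move=> ne; rewrite pairing_word_sum.
have [l lN np] : exists2 l, (l < N)%N & ~~ perm_eq (sorted_vars bl l) (subst_level z I' l).
  apply: contrapT => nex; move/eqP: ne; apply; apply: eq_ordpart => l lN.
  by apply: contrapT => /negP np; apply: nex; exists l.
apply: (word_pairing_eq0 th_odd th_fay dualmu_count _ _ theta_h_neq0 z_sorted_vars
  regular_sorted_vars _ _ _ _ lN np).
- by rewrite size_sorted_varsN.
- by rewrite size_sorted_varsN.
- by move=> k kN; apply: (perm_sorted_vars z hI (ltnW kN)).
- by move=> k kN; rewrite uniq_subst_level ?size_subst_level.
- by move=> k _; apply: sub_subst_levelS.
- by move=> k _; apply: sub_subst_level.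
Qed.

End Pair.

Lemma pairing_diag I : I \in ordpart n lam ->
  (th h ^+ lamtot lam) ^+ 2 *
  (\sum_(J in ordpart n lam) word_weight th h (mu_fun mu) N (word J) z (subst_level z I) *
    word_weight th h (mu_fun (dualmu lam h mu)) N (rev (word J)) (rev z) (subst_level z I)) =
  Eell tau lam (substz I z) h ^+ 2 * (Rell tau I z * Qell tau I z h).
Proof.
move=> hI; rewrite pairing_word_sum // (lamtotE tau h z hI N0).
rewrite (word_pairing_diag th_odd th_fay (dualmu_count hI) _ _ theta_h_neq0
  (z_sorted_vars hI) (regular_sorted_vars hI)).
- rewrite big_split [X in _ * X = _]big_split /= prodrXl (level_squareE tau h z hI N0).
  by rewrite !(level_crossE z) [RHS]mulrA [RHS]mulrAC -mulrA.
- by rewrite size_sorted_varsN.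
- by rewrite size_sorted_varsN.
- by move=> k kN; apply: (perm_sorted_vars z hI (ltnW kN)).
- by move=> k kN; rewrite uniq_subst_level ?(size_subst_level hI).
- by move=> k _; apply: (sub_subst_level hI hI).
- by move=> k kN; apply: (perm_sorted_vars z hI (ltnW kN)).
Qed.

Lemma Eell_neq0 I : I \in ordpart n lam -> Eell tau lam (substz I z) h != 0.
Proof.
move=> hI; rewrite -(level_squareE tau h z hI N0); apply/prodf_neq0 => l _.
have [_ _ hd] := regular_sorted_vars hI.
have lY := sub_sorted_vars (ltnW (ltn_ord l)).
rewrite /level_square prodf_seq_neq0; apply/allP => x /lY xY; rewrite implyTb.
by rewrite prodf_seq_neq0; apply/allP => y /lY yY; rewrite implyTb -addrA hd.
Qed.

Lemma orthogonality_generic J K : J \in ordpart n lam -> K \in ordpart n lam ->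
  \sum_(I in ordpart n lam)
     (Welltilde tau lam 1%g J (substz I z) z h mu *
      Welltilde tau lam (longest n) K (substz I z) z h (dualmu lam h mu)) /
     (Rell tau I z * Qell tau I z h) = (J == K)%:R.
Proof.
move=> hJ hK.
have inz (i : 'I_n) : z`_i = tnth z i by rewrite (tnth_nth 0).
have RQ0 I : I \in ordpart n lam -> Rell tau I z * Qell tau I z h != 0.
  move=> hI; have [_ dis _] := ordpartP hI.
  apply: mulf_neq0; apply/prodf_neq0 => k _; apply/prodf_neq0 => l kl;
    apply/prodf_neq0 => a aI; apply/prodf_neq0 => b bI; rewrite !inz.
    apply: hz; apply: contraTneq bI => ba; rewrite -ba.
    apply/negP => al; have /disjointFr/(_ aI) : [disjoint tnth I k & tnth I l].
      by apply: dis; apply: contraTneq kl => ->; rewrite ltnn.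
    by rewrite al.
  exact: hhz.
(* The normalization by R and Q is put into one of the two matrices, so that their product is
   exactly the identity and can be commuted. *)
pose X (I J : N.-tuple {set 'I_n}) := Welltilde tau lam 1%g J (substz I z) z h mu /
  (Rell tau I z * Qell tau I z h).
pose Y (K I : N.-tuple {set 'I_n}) :=
  Welltilde tau lam (longest n) K (substz I z) z h (dualmu lam h mu).
have XY : {in ordpart n lam &, forall I I',
    \sum_(J in ordpart n lam) X I J * Y J I' = (I == I')%:R}.
  move=> I I' hI hI' /=; rewrite /X /Y /Welltilde.
  have E0 := Eell_neq0 hI; have E0' := Eell_neq0 hI'; have RQ0' := RQ0 I hI.
  transitivity ((th h ^+ lamtot lam) ^+ 2 / (Eell tau lam (substz I z) h *
      Eell tau lam (substz I' z) h * (Rell tau I z * Qell tau I z h)) *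
    \sum_(J in ordpart n lam) word_weight th h (mu_fun mu) N (word J) z (subst_level z I) *
      word_weight th h (mu_fun (dualmu lam h mu)) N (rev (word J)) (rev z) (subst_level z I')).
    rewrite mulr_sumr; apply: eq_bigr => J' hJ'.
    rewrite (Wellperm_id hI hJ') (Wellperm_longest _ hI' hJ') !invfM.
    set a := _ ^+ _; set b := word_weight _ _ _ _ _ _ _; set c := word_weight _ _ _ _ _ _ _.
    ring.
  have [II'|ne] := eqVneq I I'; last by rewrite (pairing_eq0 hI hI' ne) mulr0.
  rewrite -{I'}II' in hI' E0' *.
  rewrite mulrAC (pairing_diag hI) -expr2 divff //.
  exact: mulf_neq0 (expf_neq0 _ E0) RQ0'.
have := sum_pairing_inverse XY hJ hK; rewrite eq_sym => <-; apply: eq_bigr => I _.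
have divC (a b c : R[i]) : a * b / c = b * (a / c) by rewrite mulrCA mulrA.
exact: divC.
Qed.

End Generic.

(** * The three-term relation of theta *)

Section ComplexSequences.
Variable R : realType.
Implicit Types (x y : R[i]) (u v : nat -> R[i]).

Definition cnorm x : R := Normc.normc x.

Lemma normr_cnorm x : `|x| = (cnorm x)%:C%C.
Proof. by case: x => a b; rewrite normc_def. Qed.

Lemma cnormM x y : cnorm (x * y) = cnorm x * cnorm y.
Proof. exact: Normc.normcM. Qed.

Lemma cnormD x y : cnorm (x + y) <= cnorm x + cnorm y.
Proof. exact: le_normcD. Qed.

Lemma cnormN x : cnorm (- x) = cnorm x.
Proof. exact: normcN. Qed.

Lemma cnorm0 : cnorm 0 = 0. Proof. exact: Normc.normc0. Qed.
Lemma cnorm1 : cnorm 1 = 1. Proof. exact: Normc.normc1. Qed.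
Lemma cnormV x : cnorm x^-1 = (cnorm x)^-1. Proof. exact: Normc.normcV. Qed.

Lemma cnorm_ge0 x : 0 <= cnorm x.
Proof. by rewrite /cnorm /Normc.normc; case: x => a b; apply: sqrtr_ge0. Qed.

Lemma cnorm_eq0 x : (cnorm x == 0) = (x == 0).
Proof. by apply/eqP/eqP => [/Normc.eq0_normc|->]; last exact: cnorm0. Qed.

Lemma cnorm_gt0 x : (0 < cnorm x) = (x != 0).
Proof. by rewrite lt_def cnorm_ge0 andbT cnorm_eq0. Qed.

Lemma cnormB x y : cnorm (x - y) <= cnorm x + cnorm y.
Proof. by rewrite -(cnormN y) cnormD. Qed.

Lemma cnormBC x y : cnorm (x - y) = cnorm (y - x).
Proof. by rewrite -cnormN opprB. Qed.

Lemma cnormX x n : cnorm (x ^+ n) = cnorm x ^+ n.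
Proof. by elim: n => [|n IH]; rewrite ?expr0 ?cnorm1 // !exprS cnormM IH. Qed.

Lemma cnorm_prod (I : Type) (r : seq I) (P : pred I) (F : I -> R[i]) :
  cnorm (\prod_(i <- r | P i) F i) = \prod_(i <- r | P i) cnorm (F i).
Proof. by apply: (big_morph cnorm cnormM cnorm1). Qed.

Lemma cnorm_sum (I : Type) (r : seq I) (P : pred I) (F : I -> R[i]) :
  cnorm (\sum_(i <- r | P i) F i) <= \sum_(i <- r | P i) cnorm (F i).
Proof.
apply: (big_ind2 (fun a b => cnorm a <= b)) => [|a b c d ab cd|//]; first by rewrite cnorm0.
exact: le_trans (cnormD _ _) (lerD ab cd).
Qed.

Lemma cnorm_real (a : R) : cnorm (a%:C)%C = `|a|.
Proof. by rewrite /cnorm /Normc.normc /= expr0n addr0 sqrtr_sqr. Qed.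

Lemma cnorm_i : cnorm 'i%C = 1.
Proof. by rewrite /cnorm /Normc.normc /= expr0n expr1n add0r sqrtr1. Qed.

Lemma Re_le_cnorm x : `|complex.Re x| <= cnorm x.
Proof. by have := normc_ge_Re x; rewrite normr_cnorm lecR. Qed.

Lemma Im_le_cnorm x : `|complex.Im x| <= cnorm x.
Proof.
rewrite /cnorm /Normc.normc; case: x => a b /=; rewrite -sqrtr_sqr ler_wsqrtr //.
by rewrite lerDr sqr_ge0.
Qed.

Lemma cnorm_le_ReIm x : cnorm x <= `|complex.Re x| + `|complex.Im x|.
Proof.
rewrite {1}(complexE x) (le_trans (cnormD _ _)) // cnormM cnorm_i mul1r !cnorm_real //.
Qed.

Lemma geometric_small (K r e : R) : 0 <= r < 1 -> 0 <= K -> 0 < e ->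
  exists M, forall m, (M <= m)%N -> K * r ^+ m < e.
Proof.
move=> /andP[r0 r1] K0 e0; have := @cvg_expr _ r; rewrite ger0_norm // => /(_ r1).
have K1 : 0 < K + 1 by rewrite ltr_wpDl.
move=> /cvgrPdist_lt /(_ (e / (K + 1)) (divr_gt0 e0 K1)) [M _ MP]; exists M => m /MP /=.
rewrite sub0r normrN ger0_norm ?exprn_ge0 // ltr_pdivlMr //.
by have := exprn_ge0 m r0; nra.
Qed.

(* Real tolerances keep all the estimates in R; ccvg_limn is the link with the
   limit that defines qphi. *)
Definition ccvg u (l : R[i]) := forall e : R, 0 < e ->
  exists M, forall m, (M <= m)%N -> cnorm (u m - l) < e.

Lemma ccvg_limn u l : ccvg u l -> limn (u : nat -> R[i]^o) = l.
Proof.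
move=> ul; apply: cvg_lim; first exact: norm_hausdorff.
apply/cvgrPdist_lt => e e0.
have eR : e = (complex.Re e)%:C%C.
  by move: e0; rewrite ltcE /= => /andP[/eqP e1 _]; case: e e1 => a b /= ->.
have e0' : 0 < complex.Re e by move: e0; rewrite ltcE /= => /andP[].
have [M MP] := ul _ e0'; exists M => // m /= /MP lt.
by rewrite distrC normr_cnorm eR ltcR.
Qed.

Lemma ccvg_eq u l l' : ccvg u l -> ccvg u l' -> l = l'.
Proof. by move=> /ccvg_limn <- /ccvg_limn <-. Qed.

Lemma ccvg_cst l : ccvg (fun=> l) l.
Proof. by move=> e e0; exists 0%N => m _; rewrite subrr cnorm0. Qed.

Lemma ccvg_ext u v l : (forall m, u m = v m) -> ccvg u l -> ccvg v l.
Proof. by move=> uv ul e /ul[M MP]; exists M => m; rewrite -uv; exact: MP. Qed.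

Lemma ccvgD u v l k : ccvg u l -> ccvg v k -> ccvg (fun m => u m + v m) (l + k).
Proof.
move=> ul vk e e0; have e2 : 0 < e / 2 by rewrite divr_gt0.
have [M MP] := ul _ e2; have [M' MP'] := vk _ e2.
exists (maxn M M') => m; rewrite geq_max => /andP[/MP lt /MP' lt'].
rewrite opprD addrACA (le_lt_trans (cnormD _ _)) // (splitr e); exact: ltrD.
Qed.

Lemma ccvgM u v l k : ccvg u l -> ccvg v k -> ccvg (fun m => u m * v m) (l * k).
Proof.
move=> ul vk e e0; pose B := cnorm l + cnorm k + 1.
have B0 : 0 < B by rewrite ltr_wpDl ?ltr01 // addr_ge0 ?cnorm_ge0.
pose d := Num.min 1 (e / (2 * B)).
have d0 : 0 < d by rewrite lt_min ltr01 divr_gt0 // mulr_gt0.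
have [M MP] := ul _ d0; have [M' MP'] := vk _ d0.
exists (maxn M M') => m; rewrite geq_max => /andP[/MP lt /MP' lt'].
have -> : u m * v m - l * k = (u m - l) * (v m - k) + ((u m - l) * k + l * (v m - k)).
  by ring.
have d1 : d <= 1 by rewrite ge_min lexx.
have dB : d * (2 * B) <= e.
  by rewrite -ler_pdivlMr ?mulr_gt0 // ge_min lexx orbT.
have h1 := cnormD ((u m - l) * (v m - k)) ((u m - l) * k + l * (v m - k)).
have h2 := cnormD ((u m - l) * k) (l * (v m - k)).
rewrite !cnormM in h1 h2.
have [n1 n2 n3 n4] := And4 (cnorm_ge0 (u m - l)) (cnorm_ge0 (v m - k)) (cnorm_ge0 l) (cnorm_ge0 k).
move: lt lt' h1 h2 n1 n2 n3 n4 dB d1 d0; rewrite /B.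
move: (cnorm (u m - l)) (cnorm (v m - k)) (cnorm l) (cnorm k) => a b c f.
move: (cnorm ((u m - l) * _ + _ * _)) => i; move: (cnorm _) => g.
clearbody d; move=> lt lt' h1 h2 n1 n2 n3 n4 dB d1 d0 {B B0 MP MP'}.
have : a * b <= d * 1 by apply: ler_pM => //; [exact: ltW | lra].
have : a * f <= d * f by apply: ler_wpM2r => //; exact: ltW.
have : c * b <= d * c by rewrite mulrC; apply: ler_wpM2r => //; exact: ltW.
nra.
Qed.

Lemma ccvgN u l : ccvg u l -> ccvg (fun m => - u m) (- l).
Proof.
move=> ul; apply: (@ccvg_ext (fun m => - 1 * u m)) => [m|]; first by rewrite mulN1r.
by rewrite -(mulN1r l); apply: ccvgM => //; apply: ccvg_cst.
Qed.

Lemma ccvgB u v l k : ccvg u l -> ccvg v k -> ccvg (fun m => u m - v m) (l - k).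
Proof. by move=> ul vk; apply: ccvgD => //; apply: ccvgN. Qed.

Lemma ccvg_dist u v l : ccvg v l -> ccvg (fun m => u m - v m) 0 -> ccvg u l.
Proof.
move=> vl /ccvgD/(_ vl); rewrite add0r; apply: ccvg_ext => m; exact: subrK.
Qed.

Lemma ccvg_le u l (b : nat -> R) : (forall m, cnorm (u m - l) <= b m) ->
  (forall e, 0 < e -> exists M, forall m, (M <= m)%N -> b m < e) -> ccvg u l.
Proof.
move=> ub b0 e /b0[M MP]; exists M => m /MP; exact: le_lt_trans.
Qed.

Lemma ccvgV u l : l != 0 -> ccvg u l -> ccvg (fun m => (u m)^-1) l^-1.
Proof.
move=> l0 ul e e0; have nl : 0 < cnorm l by rewrite cnorm_gt0.
pose d := Num.min (cnorm l / 2) (e * (cnorm l * cnorm l) / 2).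
have d0 : 0 < d by rewrite lt_min !divr_gt0 // !mulr_gt0.
have [M MP] := ul _ d0; exists M => m /MP lt.
have d1 : d <= cnorm l / 2 by rewrite ge_min lexx.
have d2 : d <= e * (cnorm l * cnorm l) / 2 by rewrite ge_min lexx orbT.
have h1 : cnorm l <= cnorm (u m) + cnorm (u m - l).
  by rewrite cnormBC -{1}(subrK (u m) l) addrC (le_trans (cnormD _ _)).
have um : cnorm l / 2 < cnorm (u m) by lra.
have um0 : u m != 0 by rewrite -cnorm_gt0; lra.
have -> : (u m)^-1 - l^-1 = (l - u m) * (u m * l)^-1.
  by field; rewrite um0 l0.
rewrite cnormM cnormV cnormM cnormBC ltr_pdivrMr ?mulr_gt0 ?cnorm_gt0 //.
have : e * (cnorm l * cnorm l) / 2 < e * (cnorm (u m) * cnorm l).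
  by rewrite -mulrA ltr_pM2l // -mulrA mulrCA mulrC ltr_pM2r //; lra.
lra.
Qed.

Lemma ccvg_sum (I : Type) (r : seq I) (P : pred I) (f : I -> nat -> R[i]) (g : I -> R[i]) :
  (forall i, P i -> ccvg (f i) (g i)) ->
  ccvg (fun m => \sum_(i <- r | P i) f i m) (\sum_(i <- r | P i) g i).
Proof.
move=> fg; elim: r => [|i r IH].
  by rewrite big_nil; apply: ccvg_ext (ccvg_cst 0) => m; rewrite big_nil.
rewrite big_cons; case: ifP => Pi.
  by apply: ccvg_ext (ccvgD (fg i Pi) IH) => m; rewrite big_cons Pi.
by apply: ccvg_ext IH => m; rewrite big_cons Pi.
Qed.

Lemma ccvg_prod (I : eqType) (r : seq I) (P : pred I) (f : I -> nat -> R[i]) (g : I -> R[i]) :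
  (forall i, i \in r -> P i -> ccvg (f i) (g i)) ->
  ccvg (fun m => \prod_(i <- r | P i) f i m) (\prod_(i <- r | P i) g i).
Proof.
elim: r => [|i r IH] fg.
  by rewrite big_nil; apply: ccvg_ext (ccvg_cst 1) => m; rewrite big_nil.
have {}IH := IH (fun j jr => fg j (@mem_behead _ (i :: r) j jr)).
rewrite big_cons; case: ifP => Pi.
  by apply: ccvg_ext (ccvgM (fg i (mem_head _ _) Pi) IH) => m; rewrite big_cons Pi.
by apply: ccvg_ext IH => m; rewrite big_cons Pi.
Qed.

(** The increments are bounded by the decrease of [K * r ^+ m], so [a - K r^m] is nondecreasing and
    [a + K r^m] nonincreasing. The supremum of the former is the limit, and the bracketing gives the
    rate at once. *)
Lemma geometric_limit_real (a : nat -> R) (K r : R) : 0 <= r < 1 -> 0 <= K ->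
  (forall m, `|a m.+1 - a m| <= K * (1 - r) * r ^+ m) ->
  exists l, forall m, `|a m - l| <= K * r ^+ m.
Proof.
move=> /andP[r0 r1] K0 da.
pose b m := a m - K * r ^+ m; pose c m := a m + K * r ^+ m.
have bS m k : (m <= k)%N -> b m <= b k.
  elim: k => [|k IH]; first by rewrite leqn0 => /eqP ->.
  rewrite leq_eqVlt => /orP[/eqP -> //|/IH /le_trans]; apply.
  by have := da k; rewrite /b exprS ler_norml => /andP[h _]; move: h; nra.
have cS m k : (m <= k)%N -> c k <= c m.
  elim: k => [|k IH]; first by rewrite leqn0 => /eqP ->.
  rewrite leq_eqVlt => /orP[/eqP -> //|/IH]; apply: le_trans.
  by have := da k; rewrite /c exprS ler_norml => /andP[_ h]; move: h; nra.
have bc m k : b m <= c k.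
  have h : b (maxn m k) <= c (maxn m k).
    rewrite /b /c; have : 0 <= K * r ^+ maxn m k by rewrite mulr_ge0 ?exprn_ge0.
    lra.
  by rewrite (le_trans (bS _ _ (leq_maxl m k))) // (le_trans h) // cS ?leq_maxr.
exists (sup (range b)) => m.
have hb : has_ubound (range b) by exists (c 0%N) => _ [k _ <-]; apply: bc.
have h1 : b m <= sup (range b) by apply: ub_le_sup => //; exists m.
have h2 : sup (range b) <= c m.
  by apply: ge_sup => [|_ [k _ <-]]; [exists (b 0%N), 0%N | apply: bc].
by move: h1 h2; rewrite /b /c ler_norml; lra.
Qed.

Lemma geometric_limit u (K r : R) : 0 <= r < 1 -> 0 <= K ->
  (forall m, cnorm (u m.+1 - u m) <= K * (1 - r) * r ^+ m) ->
  exists l, forall m, cnorm (u m - l) <= 2 * K * r ^+ m.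
Proof.
move=> r01 K0 du.
have [|lr lrP] := @geometric_limit_real (fun m => complex.Re (u m)) K r r01 K0.
  move=> m; apply: le_trans (du m); rewrite -(raddfB (@complex.Re R)); exact: Re_le_cnorm.
have [|li liP] := @geometric_limit_real (fun m => complex.Im (u m)) K r r01 K0.
  move=> m; apply: le_trans (du m); rewrite -(raddfB (@complex.Im R)); exact: Im_le_cnorm.
exists (lr +i* li)%C => m; apply: le_trans (cnorm_le_ReIm _) _.
rewrite (raddfB (@complex.Re R)) (raddfB (@complex.Im R)) /=.
by have := lrP m; have := liP m; lra.
Qed.

End ComplexSequences.

Section Exponential.
Variable R : realType.
Implicit Types (u v w : R[i]).

Lemma cexpD w w' : cexp (w + w') = cexp w * cexp w'.
Proof.
rewrite /cexp; case: w => a b; case: w' => c d /=.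
rewrite expRD cosD sinD rmorphM /=; apply/eqP; rewrite eq_complex /=; apply/andP.
split; apply/eqP; ring.
Qed.

Lemma cexp0 : cexp 0 = 1 :> R[i].
Proof. by rewrite /cexp /= expR0 cos0 sin0 mul1r. Qed.

Lemma cnorm_cexp w : cnorm (cexp w) = expR (complex.Re w).
Proof.
rewrite /cexp cnormM cnorm_real ger0_norm ?expR_ge0 // /cnorm /Normc.normc /=.
by rewrite cos2Dsin2 sqrtr1 mulr1.
Qed.

Lemma e2piD u v : e2pi (u + v) = e2pi u * e2pi v.
Proof. by rewrite /e2pi mulrDr cexpD. Qed.

Lemma e2pi0 : e2pi 0 = 1 :> R[i].
Proof. by rewrite /e2pi mulr0 cexp0. Qed.

Lemma e2pi_neq0 u : e2pi u != 0.
Proof.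
have h : e2pi u * e2pi (- u) = 1 by rewrite -e2piD subrr e2pi0.
by apply: contra_eq_neq h => ->; rewrite mul0r eq_sym oner_neq0.
Qed.

Lemma e2piN u : e2pi (- u) = (e2pi u)^-1.
Proof.
by apply: (mulfI (e2pi_neq0 u)); rewrite -e2piD subrr e2pi0 divff ?e2pi_neq0.
Qed.

Lemma e2piMn u n : e2pi (u *+ n) = e2pi u ^+ n.
Proof. by elim: n => [|n IH]; rewrite ?e2pi0 // mulrS e2piD IH exprS. Qed.

Lemma cnorm_e2pi u : cnorm (e2pi u) = expR (- (2 * pi * complex.Im u)).
Proof.
rewrite /e2pi cnorm_cexp; congr expR; case: u => a b /=; ring.
Qed.

End Exponential.

(** * Convergence and nonvanishing of the q-products *)

Section QProducts.
Variables (R : realType) (q : R[i]).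
Local Notation r := (cnorm q).
Hypothesis r1 : r < 1.
Implicit Types (x : R[i]).

Definition qprod x m : R[i] := \prod_(s < m) (1 - q ^+ s * x).

Lemma prod1D_le (a : nat -> R) m : (forall s, 0 <= a s) ->
  \prod_(s < m) (1 + a s) <= expR (\sum_(s < m) a s).
Proof.
move=> a0; elim: m => [|m IH]; first by rewrite !big_ord0 expR0.
rewrite !big_ord_recr /= expRD ler_pM ?expR_ge1Dx //.
  by apply: prodr_ge0 => s _; rewrite addr_ge0.
by rewrite addr_ge0.
Qed.

Lemma prod1B_ge (a : nat -> R) m : (forall s, 0 <= a s <= 1) ->
  1 - \sum_(s < m) a s <= \prod_(s < m) (1 - a s).
Proof.
move=> a01; elim: m => [|m IH]; first by rewrite !big_ord0 subr0.
rewrite !big_ord_recr /=; have /andP[am0 am1] := a01 m.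
have : \prod_(s < m) (1 - a s) <= 1.
  by apply: prodr_ile1 => s _; have /andP[? ?] := a01 s; apply/andP; split; lra.
have : 0 <= \prod_(s < m) (1 - a s).
  by apply: prodr_ge0 => s _; have /andP[? ?] := a01 s; lra.
move: IH; set P := \prod_(s < m) _; set S := \sum_(s < m) _ => *; nra.
Qed.

Lemma sum_geometric_le m : \sum_(s < m) r ^+ s <= (1 - r)^-1.
Proof.
have r0 : 0 <= r := cnorm_ge0 q; have r1' : 0 < 1 - r by rewrite subr_gt0.
have : (1 - r) * \sum_(s < m) r ^+ s = 1 - r ^+ m.
  elim: m => [|m IH]; first by rewrite big_ord0 expr0; lra.
  by rewrite big_ord_recr /= mulrDr IH exprS; ring.
rewrite -(ler_pM2l r1') divff ?gt_eqF // => ->.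
by rewrite gerBl exprn_ge0.
Qed.

Lemma cnorm_factor_le x s : cnorm (1 - q ^+ s * x) <= 1 + cnorm x * r ^+ s.
Proof. by rewrite (le_trans (cnormB _ _)) // cnorm1 cnormM cnormX mulrC. Qed.

Lemma cnorm_qprod_le x m : cnorm (qprod x m) <= expR (cnorm x / (1 - r)).
Proof.
have r0 : 0 <= r := cnorm_ge0 q.
rewrite cnorm_prod; apply: le_trans (_ : \prod_(s < m) (1 + cnorm x * r ^+ s) <= _).
  by apply: ler_prod => s _; rewrite cnorm_ge0 cnorm_factor_le.
apply: le_trans (@prod1D_le (fun s => cnorm x * r ^+ s) m _) _ => [s|].
  by rewrite mulr_ge0 ?cnorm_ge0 ?exprn_ge0.
by rewrite ler_expR -mulr_sumr ler_wpM2l ?cnorm_ge0 ?sum_geometric_le.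
Qed.

(** A rate uniform in [cnorm x <= X]: the exponential bounds the partial products, [X] comes from
    the new factor, [1 - r] from summing the increments, and 2 from treating real and imaginary
    parts separately. *)
Definition qrate X : R := 2 * (expR (X / (1 - r)) * X / (1 - r)).

Lemma qphi_rate X x m : cnorm x <= X -> cnorm (qprod x m - qphi q x) <= qrate X * r ^+ m.
Proof.
move=> xX; have r0 : 0 <= r := cnorm_ge0 q; have r1' : 0 < 1 - r by rewrite subr_gt0.
have X0 : 0 <= X := le_trans (cnorm_ge0 x) xX.
have [|||l lP] := @geometric_limit _ (qprod x) (expR (X / (1 - r)) * X / (1 - r)) r.
- by rewrite r0 r1.
- by rewrite !mulr_ge0 ?expR_ge0 ?invr_ge0 ?(ltW r1').
- move=> k; rewrite /qprod big_ord_recr /= -/(qprod x k).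
  rewrite (_ : _ - _ = - (qprod x k * (q ^+ k * x))); last by ring.
  rewrite cnormN !cnormM cnormX divfK ?gt_eqF // -mulrA [X * r ^+ k]mulrC.
  apply: ler_pM; rewrite ?cnorm_ge0 ?mulr_ge0 ?exprn_ge0 ?cnorm_ge0 //.
    apply: le_trans (cnorm_qprod_le _ _) _.
    by rewrite ler_expR ler_wpM2r // invr_ge0 (ltW r1').
  by rewrite ler_wpM2l // exprn_ge0.
suff -> : qphi q x = l by apply: lP.
apply: ccvg_limn; apply: ccvg_le lP _ => e e0.
apply: geometric_small => //; first by rewrite r0 r1.
by rewrite !mulr_ge0 ?expR_ge0 ?invr_ge0 ?(ltW r1').
Qed.

Lemma qprod_ccvg x : ccvg (qprod x) (qphi q x).
Proof.
have r0 : 0 <= r := cnorm_ge0 q; have r1' : 0 < 1 - r by rewrite subr_gt0.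
apply: ccvg_le (fun m => qphi_rate m (lexx (cnorm x))) _ => e e0.
apply: geometric_small => //; first by rewrite r0 r1.
by rewrite /qrate !mulr_ge0 ?cnorm_ge0 ?expR_ge0 ?invr_ge0 ?(ltW r1').
Qed.

Lemma qprodD x m k : qprod x (m + k) = qprod x m * qprod (q ^+ m * x) k.
Proof.
rewrite /qprod big_split_ord /=; congr (_ * _); apply: eq_bigr => s _.
by rewrite exprD mulrA [q ^+ m * _]mulrC -!mulrA.
Qed.

(** Beyond a suitable [M] the deviations of the factors from 1 sum to at most 1/2, so every tail
    product is at least 1/2. For [m < M] the product up to [M] is compared with the one up to [m],
    the quotient being bounded by [B]. *)
Lemma qprod_lower x : (forall s, 1 - q ^+ s * x != 0) ->
  exists2 d : R, 0 < d & forall m, d <= cnorm (qprod x m).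
Proof.
move=> x0; have r0 : 0 <= r := cnorm_ge0 q; have r1' : 0 < 1 - r by rewrite subr_gt0.
have nx0 := cnorm_ge0 x.
have [||//|M MP] := @geometric_small _ (2 * cnorm x) r (1 - r).
- by rewrite r0 r1.
- by rewrite mulr_ge0.
have small : cnorm (q ^+ M * x) <= (1 - r) / 2.
  have := MP M (leqnn M); rewrite cnormM cnormX; move: (r ^+ M) => a; lra.
have tail k : 1 / 2 <= cnorm (qprod (q ^+ M * x) k).
  have n0 := cnorm_ge0 (q ^+ M * x).
  set y := q ^+ M * x in small n0 *.
  have rs s : 0 <= r ^+ s <= 1 by rewrite exprn_ge0 // exprn_ile1 // (ltW r1).
  rewrite cnorm_prod; apply: le_trans (_ : \prod_(s < k) (1 - cnorm y * r ^+ s) <= _); last first.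
    apply: ler_prod => s _; have /andP[? ?] := rs s; apply/andP; split; first by nra.
    have := cnormD (1 - q ^+ s * y) (q ^+ s * y).
    by rewrite subrK cnorm1 (cnormM _ y) cnormX lerBlDr [cnorm y * _]mulrC.
  apply: le_trans (@prod1B_ge (fun s => cnorm y * r ^+ s) k _); last first.
    move=> s.
    by have /andP[? ?] := rs s; apply/andP; split; nra.
  rewrite -mulr_sumr; have S := sum_geometric_le k.
  have : cnorm y * \sum_(s < k) r ^+ s <= (1 - r) / 2 * (1 - r)^-1.
    by apply: ler_pM => //; apply: sumr_ge0 => s _; have /andP[] := rs s.
  by rewrite mulrAC divff ?gt_eqF //; lra.
have pM0 : 0 < cnorm (qprod x M).
  rewrite cnorm_gt0; apply/prodf_neq0 => s _; exact: x0.
pose B := expR (cnorm x / (1 - r)); have B0 : 0 < B := expR_gt0 _.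
exists (Num.min (cnorm (qprod x M) / 2) (cnorm (qprod x M) / B)).
  by rewrite lt_min !divr_gt0.
move=> m; have [Mm|mM] := leqP M m.
  rewrite ge_min; apply/orP; left; rewrite -(subnKC Mm) qprodD cnormM.
  by have := tail (m - M)%N; nra.
rewrite ge_min; apply/orP; right; rewrite ler_pdivrMr //.
rewrite -(subnKC (ltnW mM)) qprodD cnormM ler_wpM2l ?cnorm_ge0 //.
apply: le_trans (cnorm_qprod_le _ _) _; rewrite ler_expR ler_wpM2r ?invr_ge0 ?(ltW r1') //.
rewrite cnormM cnormX; have : r ^+ m <= 1 by rewrite exprn_ile1 // (ltW r1).
by have := exprn_ge0 m r0; nra.
Qed.

Lemma qphi_neq0 x : (forall s, 1 - q ^+ s * x != 0) -> qphi q x != 0.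
Proof.
move=> /qprod_lower[d d0 dP]; have [M MP] := qprod_ccvg x d0.
apply/eqP => x0; have := MP M (leqnn M); rewrite x0 subr0 ltNge dP //.
Qed.

End QProducts.

(** * Zeros and continuity of theta *)

Section ThetaBasics.
Variables (R : realType) (tau : R[i]).
Hypothesis htau : 0 < complex.Im tau.
Local Notation q := (e2pi tau).
Local Notation th := (theta tau).
Implicit Types (u x : R[i]).

Lemma cnorm_q_lt1 : cnorm q < 1.
Proof.
by rewrite cnorm_e2pi -[X in _ < X]expR0 ltr_expR oppr_lt0 !mulr_gt0 ?pi_gt0.
Qed.

Lemma theta_odd u : th (- u) = - th u.
Proof.
rewrite /theta mulNr !e2piN !invrK.
set a := e2pi (u / 2); set A := qphi _ _; set B := qphi _ _; ring.
Qed.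

(* The imaginary parts of the zeros are enough: they form a discrete set. *)
Lemma theta_eq0 u : th u = 0 ->
  exists k : int, complex.Im u = k%:~R * complex.Im tau.
Proof.
have pi0 : 0 < 2 * pi :> R by rewrite mulr_gt0 ?pi_gt0.
have Im0 (w : R[i]) : cnorm (e2pi w) = 1 -> complex.Im w = 0.
  rewrite cnorm_e2pi => e1; have /expR_inj/eqP : expR (- (2 * pi * complex.Im w)) = expR 0.
    by rewrite e1 expR0.
  rewrite oppr_eq0 mulf_eq0 => /orP[/eqP p|/eqP //].
  by rewrite p ltxx in pi0.
have factor (w : R[i]) : qphi q (q * e2pi w) = 0 ->
    exists s : nat, s%:R * complex.Im tau + complex.Im w = 0.
  move=> /eqP p0; have [s sP] : exists s : nat, 1 - q ^+ s * (q * e2pi w) = 0.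
    apply: contrapT => /forallNP nex.
    by have := qphi_neq0 cnorm_q_lt1 (fun s => introN eqP (nex s)); rewrite p0.
  exists s.+1; move: sP; rewrite mulrA -exprSr -e2piMn -e2piD => /eqP.
  rewrite subr_eq0 => /eqP /esym e1.
  have := Im0 (tau *+ s.+1 + w); rewrite e1 cnorm1 => /(_ erefl).
  by rewrite (raddfD (@complex.Im R)) (raddfMn (@complex.Im R)) mulr_natl.
move=> /eqP; rewrite /theta !mulf_eq0 -orbA => /or3P[/eqP e0|/eqP p0|/eqP p0].
- exists 0; rewrite mul0r.
  have e1 : e2pi u = 1.
    have -> : u = u / 2 + u / 2 by field.
    rewrite e2piD; move/eqP: e0; rewrite subr_eq0 => /eqP e0.
    by rewrite {2}e0 divff // e2pi_neq0.
  by apply: Im0; rewrite e1 cnorm1.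
- have [s sP] := factor _ p0; exists (- (s : int)).
  by rewrite mulrNz mulNr -pmulrn; lra.
- rewrite -e2piN in p0; have [s] := factor _ p0.
  rewrite (raddfN (@complex.Im R)) => sP; exists (s : int).
  by rewrite -pmulrn; lra.
Qed.

Lemma theta_shift_neq0 u (c : R) : c != 0 -> exists2 e0 : R, 0 < e0 &
  forall e, 0 < e < e0 -> th (u + 'i%C * (c * e)%:C%C) != 0.
Proof.
move=> c0; have z0 := @theta_eq0.
move: (complex.Im tau) htau z0 => y y0 z0; set b := complex.Im u.
pose k := Num.floor (b / y); pose f := b - k%:~R * y.
have f0 : 0 <= f.
  by rewrite /f subr_ge0 -ler_pdivlMr // Num.Theory.ge_floor.
have fy : f < y.
  have := Num.Theory.floorD1_gt (b / y); rewrite ltr_pdivrMr // -/k intrD mulrDl mul1r.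
  by rewrite /f; lra.
(* [d] is the distance from [complex.Im u] to the nearest multiple of [complex.Im tau] different
   from it. *)
pose d := if f == 0 then y else Num.min f (y - f).
have d0 : 0 < d.
  rewrite /d; case: eqP => // /eqP fn0; rewrite lt_min lt_def fn0 f0 /=; lra.
have nc : 0 < `|c| by rewrite normr_gt0.
exists (d / `|c|); first by rewrite divr_gt0.
move=> e /andP[e0 ed]; apply/eqP => /z0 [m].
have -> : complex.Im (u + 'i%C * (c * e)%:C%C) = b + c * e.
  by rewrite (raddfD (@complex.Im R)) /=; congr (_ + _); ring.
move=> mE; set t := c * e in mE.
have td : `|t| < d by rewrite normrM (gtr0_norm e0) mulrC -ltr_pdivlMr.
have t0 : t != 0 by rewrite mulf_neq0 // gt_eqF.
have tE : t = (m - k)%:~R * y - f by rewrite intrB /f; lra.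
have [mk|mk|mk] := ltgtP m k.
- have h : (m - k + 1)%:~R <= 0 :> R by rewrite lerz0; clear -mk; lia.
  have : t <= - y.
    have := mulr_le0_ge0 h (ltW y0); rewrite tE intrD mulr1z mulrDl mul1r.
    by move: ((m - k)%:~R * y) => a; clear -f0; move: f f0 => g g0; lra.
  move=> ty; have dy : d <= y.
    by rewrite /d; case: eqP => // _; rewrite ge_min (ltW fy).
  by move: td; rewrite ltr_norml => /andP[]; move: ty dy; clear; lra.
- have h : 0 <= (m - k - 1)%:~R :> R by rewrite ler0z; clear -mk; lia.
  have tf : y - f <= t.
    have := mulr_ge0 h (ltW y0); rewrite tE (intrB _ (m - k) 1) mulr1z mulrBl mul1r.
    by move: ((m - k)%:~R * y) => a; clear -f0; move: f f0 => g g0; lra.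
  have dy : d <= y - f.
    rewrite /d; case: eqP => [->|_]; first by rewrite subr0.
    by rewrite ge_min lexx orbT.
  by move: td; rewrite ltr_norml => /andP[_]; move: tf dy; clear; move: (y - f) => g; lra.
move: tE td t0; rewrite mk subrr mul0r sub0r => ->.
rewrite oppr_eq0 normrN ger0_norm // /d => td /negPf fn.
by move: td; rewrite fn lt_min ltxx.
Qed.

(** Continuity in terms of the exponentials from which theta is built. The half argument is a
    separate hypothesis because the square root is not determined by [e2pi u]. For [qphi], the
    uniform rate reduces the question to a finite product. *)
Lemma ccvg_theta u (c : nat -> R[i]) : ccvg (fun m => e2pi (c m)) (e2pi u) ->
  ccvg (fun m => e2pi (c m / 2)) (e2pi (u / 2)) ->
  ccvg (fun m => th (c m)) (th u).
Proof.
move=> cu cu2; have q1 := cnorm_q_lt1; have q0 := cnorm_ge0 q.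
have qphi_cont x (xm : nat -> R[i]) : ccvg xm x ->
    ccvg (fun m => qphi q (xm m)) (qphi q x).
  move=> xx e e0; set X := cnorm x + 1.
  have e3 : 0 < e / 3 by rewrite divr_gt0.
  have K0 : 0 <= qrate q X.
    rewrite /qrate !mulr_ge0 ?expR_ge0 ?invr_ge0 ?subr_ge0 ?(ltW q1) //.
    by rewrite addr_ge0 ?cnorm_ge0.
  have [|k kP] := @geometric_small _ (qrate q X) (cnorm q) (e / 3) _ K0 e3.
    by rewrite q0 q1.
  have kk := kP k (leqnn k).
  have pk : ccvg (fun m => qprod q (xm m) k) (qprod q x k).
    apply: ccvg_prod => s _ _; apply: ccvgB (ccvg_cst _) _.
    exact: ccvgM (ccvg_cst _) xx.
  have [M1 M1P] := pk _ e3; have [M2 M2P] := xx _ (@ltr01 R).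
  exists (maxn M1 M2) => m; rewrite geq_max => /andP[/M1P h1 /M2P h2].
  have xmX : cnorm (xm m) <= X.
    rewrite -(subrK x (xm m)) (le_trans (cnormD _ _)) // addrC lerD2l; exact: ltW.
  have xX : cnorm x <= X by rewrite lerDl.
  have r1 := qphi_rate q1 k xmX; have r2 := qphi_rate q1 k xX.
  have -> : qphi q (xm m) - qphi q x = (qprod q (xm m) k - qprod q x k) +
     ((qprod q x k - qphi q x) - (qprod q (xm m) k - qphi q (xm m))) by ring.
  have t1 := cnormD (qprod q (xm m) k - qprod q x k)
    ((qprod q x k - qphi q x) - (qprod q (xm m) k - qphi q (xm m))).
  have t2 := cnormB (qprod q x k - qphi q x) (qprod q (xm m) k - qphi q (xm m)).
  by lra.
have V v (vm : nat -> R[i]) : ccvg (fun m => e2pi (vm m)) (e2pi v) ->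
  ccvg (fun m => (e2pi (vm m))^-1) (e2pi v)^-1 by apply: ccvgV; exact: e2pi_neq0.
apply: ccvgM; [apply: ccvgM|].
- exact: ccvgB cu2 (V _ _ cu2).
- by apply: qphi_cont; apply: ccvgM (ccvg_cst _) cu.
- by apply: qphi_cont; apply: ccvgM (ccvg_cst _) (V _ _ cu).
Qed.

(** Along an imaginary shift [e2pi] is multiplied by a real exponential, so continuity of [expR] at
    0 is all that is used. *)
Lemma ccvg_theta_shift u (c : R) (e : nat -> R) :
  (forall d, 0 < d -> exists M, forall m, (M <= m)%N -> `|e m| < d) ->
  ccvg (fun m => th (u + 'i%C * (c * e m)%:C%C)) (th u).
Proof.
move=> e0.
have shift v a : ccvg (fun m => e2pi (v + 'i%C * (a * e m)%:C%C)) (e2pi v).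
  have eE m : e2pi (v + 'i%C * (a * e m)%:C%C) =
      e2pi v * (expR (- (2 * pi * a) * e m))%:C%C.
    rewrite e2piD; congr (_ * _); rewrite /e2pi /cexp.
    have -> : (2 * pi)%:C%C * 'i%C * ('i%C * (a * e m)%:C%C) =
        (- (2 * pi * a) * e m)%:C%C.
      by apply/eqP; rewrite eq_complex /=; apply/andP; split; apply/eqP; ring.
    by rewrite /= cos0 sin0 mulr1.
  apply: (@ccvg_ext _ (fun m => e2pi v * (expR (- (2 * pi * a) * e m))%:C%C)) => //.
  rewrite -[X in ccvg _ X]mulr1; apply: ccvgM (ccvg_cst _) _ => d d0.
  have /cvgrPdist_lt/(_ _ d0) := @continuous_expR R 0.
  move=> /nbhs_ballP[r /= r0 rP]; set b := - (2 * pi * a).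
  have [|M MP] := e0 (r / (`|b| + 1)); first by rewrite divr_gt0 // ltr_wpDl.
  exists M => m /MP; rewrite ltr_pdivlMr ?ltr_wpDl // => h.
  change (cnorm ((expR (b * e m))%:C%C - 1) < d).
  have -> (y : R) : cnorm (y%:C%C - 1) = `|1 - y|.
    have -> : y%:C%C - 1 = (y - 1)%:C%C :> R[i] by rewrite rmorphB rmorph1.
    by rewrite cnorm_real distrC.
  have := rP (b * e m); rewrite expR0 /ball /= sub0r normrN normrM; apply.
  by have := normr_ge0 (e m); have := normr_ge0 b; move: h; clear; nra.
apply: ccvg_theta; first exact: shift.
apply: ccvg_ext (shift (u / 2) (c / 2)) => m; congr e2pi.
have -> : (c / 2 * e m)%:C%C = (c * e m)%:C%C / 2 :> R[i].
  by rewrite mulrAC (rmorphM (real_complex R)) (fmorphV (real_complex R)) rmorph_nat.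
by rewrite mulrDl mulrA.
Qed.
End ThetaBasics.

(** * The q-binomial theorem and the truncated theta product *)

Section QBinomial.
Variables (F : fieldType) (q : F).

Definition qfact n : F := \prod_(s < n) (1 - q ^+ s.+1).
Definition qbin n k : F := qfact n / (qfact k * qfact (n - k)).

Lemma qfactS n : qfact n.+1 = qfact n * (1 - q ^+ n.+1).
Proof. by rewrite /qfact big_ord_recr. Qed.

Hypothesis qfact_neq0 : forall n, qfact n != 0.

Lemma qbin0 n : qbin n 0 = 1.
Proof. by rewrite /qbin subn0 {2}/qfact big_ord0 mul1r divff. Qed.

Lemma qbinn n : qbin n n = 1.
Proof. by rewrite /qbin subnn {3}/qfact big_ord0 mulr1 divff. Qed.

Lemma qbinS n k : (k < n)%N ->
  qbin n.+1 k.+1 = qbin n k.+1 + q ^+ (n - k) * qbin n k.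
Proof.
move=> kn; rewrite /qbin subSS; have -> : (n - k)%N = (n - k.+1).+1 by lia.
have f1 := qfact_neq0 n; have f2 := qfact_neq0 k; have f3 := qfact_neq0 (n - k.+1).
have f4 := qfact_neq0 k.+1; have f5 := qfact_neq0 (n - k.+1).+1.
rewrite !qfactS in f4 f5 *; move: f4 f5; rewrite !mulf_eq0 !negb_or.
move=> /andP[_ f4] /andP[_ f5].
have -> : q ^+ n.+1 = q ^+ k.+1 * q ^+ (n - k.+1).+1.
  by rewrite -exprD; congr (_ ^+ _); lia.
by field; rewrite f2 f3 f4 f5.
Qed.

(** The sequence [c] is q^(k(k-1)/2), given by its recursion so that triangular exponents need not
    be handled. *)
Lemma qbinomial (c : nat -> F) (X : F) n : c 0%N = 1 ->
  (forall k, c k.+1 = c k * q ^+ k) ->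
  \prod_(i < n) (1 + q ^+ i * X) = \sum_(k < n.+1) qbin n k * c k * X ^+ k.
Proof.
move=> c0 cS; elim: n => [|n IH].
  by rewrite big_ord0 big_ord1 qbin0 c0 expr0 !mulr1.
rewrite big_ord_recr /= IH mulrDr mulr1 mulr_suml.
rewrite [in X in X + _ = _]big_ord_recl [in X in _ + X = _]big_ord_recr /=.
rewrite [RHS]big_ord_recl [in RHS]big_ord_recr /= !qbin0 !qbinn.
rewrite -[LHS]addrA; congr (_ + _).
rewrite addrA -big_split /=; congr (_ + _); last first.
  by rewrite cS exprS; ring.
apply: eq_bigr => k _; rewrite /bump /= !add1n qbinS // cS !exprS.
have -> : q ^+ n = q ^+ k * q ^+ (n - k).
  by rewrite -exprD subnKC // ltnW.
ring.
Qed.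

End QBinomial.

Section FiniteTheta.
Variables (R : realType) (tau : R[i]).
Hypothesis htau : 0 < complex.Im tau.
Local Notation q := (e2pi tau).
Local Notation th := (theta tau).
Implicit Types (u v : R[i]) (k m : nat).

Definition theta_fin m u : R[i] :=
  (e2pi (u / 2) - (e2pi (u / 2))^-1) * qprod q (q * e2pi u) m * qprod q (q / e2pi u) m.

Lemma theta_fin_ccvg u : ccvg (fun m => theta_fin m u) (th u).
Proof.
have q1 := cnorm_q_lt1 htau.
by apply: ccvgM; [apply: ccvgM; [exact: ccvg_cst|]|]; apply: qprod_ccvg.
Qed.

(* For 0 <= k <= 2 m + 1 this runs over the half-integers between -m - 1/2 and
   m + 1/2. *)
Definition half_index m k : R[i] := k%:R - m%:R - 1 / 2.

Definition gauss u (a : R[i]) : R[i] := e2pi (tau * a ^+ 2 / 2 + a * u).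

Definition theta_term m u k : R[i] := (-1) ^+ (m + k) * gauss u (half_index m k).

Lemma qfact_e2pi_neq0 n : qfact q n != 0.
Proof.
apply/prodf_neq0 => s _; rewrite subr_eq0; apply: contraTneq (cnorm_q_lt1 htau) => e.
rewrite -leNgt; have : cnorm (q ^+ s.+1) = 1 by rewrite -e cnorm1.
have q0 := cnorm_ge0 q; rewrite cnormX => e1; rewrite leNgt; apply/negP => q1.
by have := exprn_ilt1 s.+1 q0 q1; rewrite e1 ltxx.
Qed.

Definition tri_power k : R[i] := e2pi (tau * (k%:R * (k%:R - 1) / 2)).

Lemma tri_powerS k : tri_power k.+1 = tri_power k * q ^+ k.
Proof.
by rewrite /tri_power -e2piMn -e2piD; congr e2pi; rewrite -mulr_natl -natr1; field.
Qed.

Lemma tri_power0 : tri_power 0 = 1.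
Proof. by rewrite /tri_power mul0r mul0r mulr0 e2pi0. Qed.

Lemma prod_neg_powers m u : \prod_(s < m) (- (e2pi u * e2pi (- (tau *+ s.+1)))) =
  (-1) ^+ m * e2pi (m%:R * u - tau * (m%:R * (m%:R + 1) / 2)).
Proof.
elim: m => [|m IH].
  by rewrite big_ord0 expr0 mul1r !mul0r mulr0 subrr e2pi0.
rewrite big_ord_recr /= IH exprS.
rewrite [X in _ = _ * e2pi X](_ : _ = m%:R * u - tau * (m%:R * (m%:R + 1) / 2) +
  (u - tau *+ m.+1)); last by rewrite -[tau *+ _]mulr_natl -!natr1; field.
by rewrite !e2piD; ring.
Qed.

(** The shift by q^(-m) centres the product: the first [m] factors, read backwards, give the product
    in q/x up to monomials, the middle one is 1 - x, and the last [m] give the product in qx. *)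
Lemma theta_fin_product m u :
  \prod_(i < m + 1 + m) (1 + q ^+ i * (- (e2pi u * e2pi (- (tau *+ m))))) =
  - ((-1) ^+ m * e2pi (m%:R * u - tau * (m%:R * (m%:R + 1) / 2))) *
  e2pi (u / 2) * theta_fin m u.
Proof.
rewrite -prod_neg_powers !big_split_ord /= big_ord1 /theta_fin.
have x0 := e2pi_neq0 u.
have -> : \prod_(i < m) (1 + q ^+ i * - (e2pi u * e2pi (- (tau *+ m)))) =
    \prod_(s < m) (- (e2pi u * e2pi (- (tau *+ s.+1)))) * qprod q (q / e2pi u) m.
  rewrite (reindex_inj rev_ord_inj) /= /qprod -big_split /=; apply: eq_bigr => s _.
  have -> : q ^+ (m - s.+1) = e2pi (tau *+ m) * e2pi (- (tau *+ s.+1)).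
    rewrite -e2piMn -e2piD; congr e2pi.
    by rewrite -mulrnBr.
  rewrite (e2piN (tau *+ m)); set a := e2pi (- _); have a0 := e2pi_neq0 (tau *+ m).
  have qa : q ^+ s * q * a = 1.
    by rewrite -exprSr -e2piMn /a -e2piD subrr e2pi0.
  rewrite mulrBr mulr1 mulNr opprK.
  have -> : e2pi u * a * (q ^+ s * (q / e2pi u)) = q ^+ s * q * a by field.
  by rewrite qa; field.
have -> : \prod_(i < m) (1 + q ^+ (m + 1 + i) * - (e2pi u * e2pi (- (tau *+ m)))) =
    qprod q (q * e2pi u) m.
  rewrite /qprod; apply: eq_bigr => s _.
  rewrite -addnA exprD e2piN -(e2piMn tau) mulrN; congr (1 - _).
  have a0 := e2pi_neq0 (tau *+ m); rewrite exprD expr1 e2piMn.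
  by field; rewrite expf_neq0 ?e2pi_neq0.
have -> : 1 + q ^+ (m + 0) * - (e2pi u * e2pi (- (tau *+ m))) = 1 - e2pi u.
  by rewrite addn0 e2piN -e2piMn mulrN mulrCA divff ?mulr1 ?e2pi_neq0.
have -> : e2pi u = e2pi (u / 2) * e2pi (u / 2) by rewrite -e2piD; congr e2pi; field.
have h0 := e2pi_neq0 (u / 2).
by field.
Qed.

(** Completing the square in the exponent k(k-1)/2 - mk leads to the half-integer k - m - 1/2; the
    constant 1/8 left over is the source of the prefactor. *)
Lemma theta_fin_sum m u : theta_fin m u =
  - e2pi (- (tau / 8)) * \sum_(k < 2 * m + 2) qbin q (2 * m + 1) k * theta_term m u k.
Proof.
have := theta_fin_product m u.
rewrite (_ : (m + 1 + m = 2 * m + 1)%N); last by lia.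
rewrite (qbinomial qfact_e2pi_neq0 _ _ tri_power0 tri_powerS) => e.
have c0 : (-1) ^+ m * e2pi (m%:R * u - tau * (m%:R * (m%:R + 1) / 2)) * e2pi (u / 2) != 0.
  apply: mulf_neq0 (mulf_neq0 _ (e2pi_neq0 _)) (e2pi_neq0 _).
  by rewrite expf_neq0 // oppr_eq0 oner_eq0.
apply: (mulfI c0).
transitivity (- (\sum_(k < (2 * m + 1).+1) qbin q (2 * m + 1) k * tri_power k *
    (- (e2pi u * e2pi (- (tau *+ m)))) ^+ k)); first by rewrite e; ring.
rewrite addn1 addn2 mulNr mulrN !mulr_sumr; congr (- _); apply: eq_bigr => k _.
have -> : (- (e2pi u * e2pi (- (tau *+ m)))) ^+ k = (-1) ^+ k * e2pi ((u - tau *+ m) *+ k).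
  by rewrite -e2piD [LHS]exprNn (e2piMn (u - tau *+ m) k).
rewrite /theta_term exprD /tri_power /gauss /half_index.
have expE : e2pi (tau * (k%:R * (k%:R - 1) / 2)) * e2pi ((u - tau *+ m) *+ k) =
    e2pi (m%:R * u - tau * (m%:R * (m%:R + 1) / 2)) * e2pi (u / 2) * e2pi (- (tau / 8)) *
    e2pi (tau * (k%:R - m%:R - 1 / 2) ^+ 2 / 2 + (k%:R - m%:R - 1 / 2) * u).
  rewrite -!e2piD; congr e2pi.
  by rewrite -[(u - _) *+ _]mulr_natl -[tau *+ _]mulr_natl; field.
have sgn : (-1) ^+ m * (-1) ^+ m = 1 :> R[i] by rewrite -expr2 sqrr_sign.
set G := qbin _ _ _.
transitivity (G * (-1) ^+ k *
  (e2pi (tau * (k%:R * (k%:R - 1) / 2)) * e2pi ((u - tau *+ m) *+ k))); first by ring.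
rewrite expE; transitivity (((-1) ^+ m * (-1) ^+ m) * (G * (-1) ^+ k *
  (e2pi (m%:R * u - tau * (m%:R * (m%:R + 1) / 2)) * e2pi (u / 2) * e2pi (- (tau / 8)) *
    e2pi (tau * (k%:R - m%:R - 1 / 2) ^+ 2 / 2 + (k%:R - m%:R - 1 / 2) * u)))).
  by rewrite sgn [RHS]mul1r.
by ring.
Qed.

End FiniteTheta.

(** * Passage to the theta series *)

Section ThetaSeries.
Variables (R : realType) (tau : R[i]).
Hypothesis htau : 0 < complex.Im tau.
Local Notation q := (e2pi tau).
Local Notation th := (theta tau).
Implicit Types (u v : R[i]) (k m n d : nat).

Lemma gaussian_exponent_bound (p B t D : R) : 0 < p -> 0 <= t -> D <= t + 1 ->
  - (p * t ^+ 2) + B * t + 2 * p * D <= (B + 2 * p) ^+ 2 / (4 * p) + 2 * p.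
Proof.
move=> p0 t0 Dt.
(* complete the square in t *)
have h : - (p * t ^+ 2) + (B + 2 * p) * t <= (B + 2 * p) ^+ 2 / (4 * p).
  rewrite ler_pdivlMr ?mulr_gt0 //.
  have := sqr_ge0 (2 * p * t - (B + 2 * p)); rewrite !expr2; clear; nra.
nra.
Qed.

Lemma half_index_real m k : half_index R m k = (k%:R - m%:R - 1 / 2)%:C%C.
Proof.
rewrite /half_index !(rmorphB (real_complex R)) (rmorphM (real_complex R)).
by rewrite (fmorphV (real_complex R)) !rmorph_nat.
Qed.

Lemma cnorm_thterm m u k (a : R := k%:R - m%:R - 1 / 2) : cnorm (theta_term tau m u k) =
  expR (- (pi * complex.Im tau * a ^+ 2 + 2 * pi * complex.Im u * a)).
Proof.
have cnorms j : cnorm ((-1) ^+ j : R[i]) = 1 by rewrite cnormX cnormN cnorm1 expr1n.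
rewrite /theta_term cnormM cnorms mul1r /gauss half_index_real -/a cnorm_e2pi; congr (expR (- _)).
have -> : tau * a%:C%C ^+ 2 / 2 + a%:C%C * u =
    (a ^+ 2 / 2)%:C%C * tau + a%:C%C * u.
  rewrite (rmorphM (real_complex R)) (fmorphV (real_complex R)) rmorphXn rmorph_nat.
  by field.
by case: (tau) (u) => [b c] [e f] /=; field.
Qed.

Lemma cnorm_qX d : cnorm q ^+ d = expR (- (2 * pi * complex.Im tau) * d%:R).
Proof. by rewrite cnorm_e2pi -expRM_natl mulrC. Qed.

(** The quadratic exponent dominates the linear one from [u] and any fixed geometric rate; only the
    decay |q|^d, with [d] about the distance from the centre, is kept. *)
Lemma theta_term_bound u : exists2 C : R, 0 <= C & forall m k d,
  d%:R <= `|k%:R - m%:R - 1 / 2| + 1 :> R -> cnorm (theta_term tau m u k) <= C * cnorm q ^+ d.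
Proof.
set p := pi * complex.Im tau; have p0 : 0 < p by rewrite mulr_gt0 ?pi_gt0.
pose B := 2 * pi * `|complex.Im u|.
exists (expR ((B + 2 * p) ^+ 2 / (4 * p) + 2 * p)); first exact: expR_ge0.
move=> m k d; set a := k%:R - m%:R - 1 / 2 => da.
rewrite cnorm_thterm -/a -/p cnorm_qX -expRD ler_expR.
have h := gaussian_exponent_bound B p0 (normr_ge0 a) da.
have h2 : - (2 * pi * complex.Im u * a) <= B * `|a|.
  rewrite /B -mulrA -[X in _ <= X]mulrA -mulrN ler_wpM2l ?mulr_ge0 ?pi_ge0 //.
  by rewrite -normrM -normrN ler_norm.
have -> : - (2 * pi * complex.Im tau) * d%:R = - (2 * p * d%:R) by rewrite /p; ring.
rewrite real_normK ?num_real // in h; lra.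
Qed.

Lemma quadratic_geometric_small (K e : R) : 0 <= K -> 0 < e ->
  exists M, forall m, (M <= m)%N -> K * (m.+1%:R ^+ 2 * cnorm q ^+ m) < e.
Proof.
move=> K0 e0.
(* s is the cube root of |q|: two of the three factors s ^+ m absorb m.+1 ^+ 2 *)
pose s : R := expR (- (2 * pi * complex.Im tau) / 3).
have s0 : 0 < s := expR_gt0 _.
have s1 : s < 1.
  rewrite -[X in _ < X]expR0 ltr_expR mulNr oppr_lt0 divr_gt0 // !mulr_gt0 ?pi_gt0 //.
have s3 : s ^+ 3 = cnorm q.
  by rewrite -expRM_natl cnorm_e2pi; congr expR; field.
have is0 : 0 < (1 - s)^-1 by rewrite invr_gt0 subr_gt0.
pose S := (1 - s)^-1 + 1; have S0 : 0 < S by rewrite addr_gt0.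
have ms m : m.+1%:R * s ^+ m <= S.
  rewrite -natr1 mulrDl mul1r lerD //; last by rewrite exprn_ile1 // ltW.
  have := @sum_geometric_le _ s%:C%C; rewrite cnorm_real ger0_norm ?(ltW s0) // => /(_ s1 m).
  apply: le_trans; rewrite mulr_natl -[X in s ^+ m *+ X]card_ord -sumr_const.
  apply: ler_sum => i _; move: (nat_of_ord i) (ltnW (ltn_ord i)) => j jm.
  rewrite -(subnK jm) exprD ler_piMl //.
    by rewrite exprn_ge0 // ltW.
  by rewrite exprn_ile1 // ltW.
have [||//|M MP] := @geometric_small _ (K * S ^+ 2) s e.
- by rewrite (ltW s0) s1.
- by rewrite mulr_ge0 // exprn_ge0 // ltW.
exists M => m /MP h; apply: le_lt_trans h.
have -> : cnorm q ^+ m = s ^+ m * s ^+ m * s ^+ m.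
  by rewrite -s3 -exprM mulnC exprM !exprS expr0 mulr1 mulrA.
have sm0 : 0 <= s ^+ m by rewrite exprn_ge0 // ltW.
have h2 : (m.+1%:R * s ^+ m) ^+ 2 <= S ^+ 2.
  by rewrite ler_sqr ?nnegrE ?ms ?(ltW S0) // mulr_ge0.
have -> : K * (m.+1%:R ^+ 2 * (s ^+ m * s ^+ m * s ^+ m)) =
  K * (m.+1%:R * s ^+ m) ^+ 2 * s ^+ m by ring.
by rewrite ler_wpM2r // ler_wpM2l.
Qed.

Lemma qfact_qprod n : qfact q n = qprod q q n.
Proof. by apply: eq_bigr => s _; rewrite exprSr. Qed.

Lemma qphi_qq_neq0 : qphi q q != 0.
Proof.
apply: (qphi_neq0 (cnorm_q_lt1 htau)) => s; rewrite -exprSr.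
have := qfact_e2pi_neq0 htau s.+1; rewrite qfactS mulf_eq0 negb_or.
by case/andP.
Qed.

(** All three q-factorials tend to phi(q), so the q-binomial coefficient tends to its inverse; the
    error is governed by the shorter of [k] and [n - k]. *)
Lemma qbin_rate : exists2 K : R, 0 <= K & forall n k j, (k <= n)%N ->
  (j <= k)%N -> (j <= n - k)%N -> cnorm (qbin q n k - (qphi q q)^-1) <= K * cnorm q ^+ j.
Proof.
have q1 := cnorm_q_lt1 htau; have q0 := cnorm_ge0 q.
have [|dl dl0 dlP] := @qprod_lower _ q q1 q.
  move=> s; rewrite -exprSr; have := qfact_e2pi_neq0 htau s.+1.
  by rewrite qfactS mulf_eq0 negb_or => /andP[].
set Q := qphi q q; have Q0 : 0 < cnorm Q by rewrite cnorm_gt0 qphi_qq_neq0.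
pose Bd := expR (cnorm q / (1 - cnorm q)); pose K0 := qrate q (cnorm q).
have K00 : 0 <= K0.
  by rewrite /K0 /qrate !mulr_ge0 ?expR_ge0 ?invr_ge0 ?subr_ge0 ?(ltW q1).
have Bd0 : 0 < Bd := expR_gt0 _.
exists (K0 * (cnorm Q + (Bd + cnorm Q)) / (dl * dl * cnorm Q)).
  apply: divr_ge0; last by rewrite ltW // !mulr_gt0.
  by apply: mulr_ge0 => //; rewrite ltW // !addr_gt0.
move=> n k j kn jk jnk; rewrite /qbin !qfact_qprod.
set A := qprod q q k; set B := qprod q q (n - k); set P := qprod q q n.
have rate i : (j <= i)%N -> cnorm (qprod q q i - Q) <= K0 * cnorm q ^+ j.
  move=> ji; apply: le_trans (qphi_rate q1 i (lexx _)) _.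
  rewrite ler_wpM2l // -(subnKC ji) exprD ler_piMr ?exprn_ge0 //.
  by rewrite exprn_ile1 // ltW.
have A0 : 0 < cnorm A := lt_le_trans dl0 (dlP k).
have B0 : 0 < cnorm B := lt_le_trans dl0 (dlP _).
have -> : P / (A * B) - Q^-1 =
    ((P - Q) * Q - ((A - Q) * B + Q * (B - Q))) / (A * B * Q).
  by field; rewrite -!cnorm_gt0 A0 B0 Q0.
set r := cnorm q ^+ j in rate *; rewrite cnormM cnormV !cnormM.
have r0 : 0 <= r by rewrite exprn_ge0.
have num : cnorm ((P - Q) * Q - ((A - Q) * B + Q * (B - Q))) <=
    K0 * r * (cnorm Q + (Bd + cnorm Q)).
  have h1 := rate _ (leq_trans jk kn); have h2 := rate _ jk; have h3 := rate _ jnk.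
  have hB : cnorm B <= Bd by apply: cnorm_qprod_le.
  apply: le_trans (cnormB _ _) _; rewrite [X in _ <= X]mulrDr cnormM lerD //.
    by rewrite ler_wpM2r // ltW.
  apply: le_trans (cnormD _ _) _; rewrite [X in _ <= X]mulrDr !cnormM lerD //.
    by rewrite ler_pM ?cnorm_ge0.
  by rewrite mulrC ler_wpM2r // ltW.
have den : dl * dl * cnorm Q <= cnorm A * cnorm B * cnorm Q.
  by rewrite ler_wpM2r ?(ltW Q0) // ler_pM ?dlP // ltW.
rewrite ler_pdivrMr ?mulr_gt0 //; apply: le_trans num _.
set S := cnorm Q + (Bd + cnorm Q).
have S0 : 0 <= S by rewrite /S ltW // !addr_gt0.
have D0 : 0 < dl * dl * cnorm Q by rewrite !mulr_gt0.
have -> : K0 * S / (dl * dl * cnorm Q) * r * (cnorm A * cnorm B * cnorm Q) =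
    K0 * r * S * ((cnorm A * cnorm B * cnorm Q) / (dl * dl * cnorm Q)).
  by field; rewrite !gt_eqF.
apply: ler_peMr; first by apply: mulr_ge0 => //; apply: mulr_ge0.
by rewrite ler_pdivlMr // mul1r.
Qed.

Definition theta_sum m u : R[i] := \sum_(k < 2 * m + 2) theta_term tau m u k.

Definition theta_const : R[i] := - e2pi (- (tau / 8)) / qphi q q.

Lemma theta_sum_ccvg u : ccvg (fun m => theta_const * theta_sum m u) (th u).
Proof.
have [C C0 CP] := theta_term_bound u; have [K K0 KP] := qbin_rate.
have q0 := cnorm_ge0 q; have q1 := cnorm_q_lt1 htau.
apply: ccvg_dist (theta_fin_ccvg htau u) _.
pose E := cnorm (- e2pi (- (tau / 8))); have E0 : 0 <= E := cnorm_ge0 _.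
apply: (@ccvg_le _ _ _ (fun m => E * K * C * 2 * (m.+1%:R ^+ 2 * cnorm q ^+ m))); last first.
  by move=> e e0; apply: quadratic_geometric_small; rewrite // !mulr_ge0.
move=> m; rewrite subr0 cnormBC theta_fin_sum // /theta_const /theta_sum.
set c := - e2pi (- (tau / 8)) in E E0 *; clearbody c.
have -> : c * (\sum_(k < 2 * m + 2) qbin q (2 * m + 1) k * theta_term tau m u k) -
    c / qphi q q * (\sum_(k < 2 * m + 2) theta_term tau m u k) =
    c * \sum_(k < 2 * m + 2) (qbin q (2 * m + 1) k - (qphi q q)^-1) * theta_term tau m u k.
  rewrite -mulrA -mulrBr; congr (_ * _); rewrite mulr_sumr -sumrB.
  by apply: eq_bigr => k _; rewrite mulrBl.
rewrite cnormM -/E; apply: le_trans (_ : E * \sum_(k < 2 * m + 2) (K * C * cnorm q ^+ m) <= _).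
  rewrite ler_wpM2l //; apply: le_trans (cnorm_sum _ _ _) _; apply: ler_sum => k _.
  have kle : (k <= 2 * m + 1)%N by have := ltn_ord k; lia.
  (* The coefficients are close to their limit except near the two ends, where the Gaussian terms
     are small. With [j] the distance to the nearer end and [d] that to the centre, [j + d = m.+1],
     so each summand is of order |q|^(m+1). *)
  pose j := minn k (2 * m + 1 - k); pose d := (m + 1 - j)%N.
  have jd : (j + d = m.+1)%N by rewrite /d /j; lia.
  have h1 := KP _ _ j kle (geq_minl _ _) (geq_minr _ _).
  have h2 := CP m k d.
  apply: le_trans (_ : K * cnorm q ^+ j * (C * cnorm q ^+ d) <= _).
    rewrite (cnormM (_ - _)); apply: ler_pM; rewrite ?cnorm_ge0 //; apply: h2.
    rewrite /d /j; have [km|km] := leqP k m.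
      have -> : minn k (2 * m + 1 - k) = k by lia.
      rewrite ler0_norm; last first.
        have : k%:R <= m%:R :> R by rewrite ler_nat.
        lra.
      by rewrite natrB ?natrD; [lra | lia].
    have -> : minn k (2 * m + 1 - k) = (2 * m + 1 - k)%N by lia.
    have -> : (m + 1 - (2 * m + 1 - k) = k - m)%N by lia.
    rewrite natrB ?(ltnW km) // ger0_norm; first by lra.
    have : m.+1%:R <= k%:R :> R by rewrite ler_nat.
    by rewrite -natr1; lra.
  rewrite mulrACA -exprD jd; apply: ler_wpM2l; first by rewrite mulr_ge0.
  by rewrite exprS ler_piMl ?exprn_ge0 // ltW.
rewrite sumr_const card_ord -[_ *+ (2 * m + 2)]mulr_natr.
have -> : E * (K * C * cnorm q ^+ m * (2 * m + 2)%:R) =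
    E * K * C * 2 * (m.+1%:R * cnorm q ^+ m).
  rewrite (_ : (2 * m + 2 = 2 * m.+1)%N); last by lia.
  by rewrite natrM; ring.
rewrite ler_wpM2l ?mulr_ge0 // ler_wpM2r ?exprn_ge0 //.
by rewrite expr2 ler_peMl // ler1n.
Qed.

End ThetaSeries.

(** * Products of two theta series as determinants *)

Section ThetaFay.
Variables (R : realType) (tau : R[i]).
Hypothesis htau : 0 < complex.Im tau.
Local Notation q := (e2pi tau).
Local Notation th := (theta tau).
Implicit Types (u v : R[i]) (k m n d P Q : nat).

(** The quarter comes from a^2 + b^2 = (p^2 + q^2) / 2 for p = a + b and q = a - b; the linear part
    is a(u + v) + b(u - v) = pu + qv. *)
Definition gauss2 u (p : R[i]) : R[i] := e2pi (tau * p ^+ 2 / 4 + p * u).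

(* The product of the terms with half-integers a and b in the series of
   theta (u + v) and theta (u - v), where P - m = a + b and Q - m = a - b. *)
Definition boxterm m u v (P Q : nat) : R[i] :=
  (-1) ^+ (P + m.+1) * (gauss2 u (P%:R - m%:R) * gauss2 v (Q%:R - m%:R)).

(** The truncation is a square in the new indices, so that the variables separate. The parity
    condition says that p + q = 2a is odd, [a] being a half-integer. *)
Definition boxsum m u v : R[i] :=
  \sum_(P < (2 * m).+1) \sum_(Q < (2 * m).+1 | odd (P + Q)) boxterm m u v P Q.

Lemma theta_term_mul m u v (i j P Q : nat) : (P + m.+1 = i + j)%N -> (Q + j = i + m)%N ->
  theta_term tau m (u + v) i * theta_term tau m (u - v) j = boxterm m u v P Q.
Proof.
move=> PE QE; rewrite /theta_term /boxterm mulrACA -exprD.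
have -> : (-1) ^+ (m + i + (m + j)) = (-1) ^+ (P + m.+1) :> R[i].
  by rewrite PE addnACA addnn exprD -mul2n exprM sqrrN expr1n expr1n mul1r.
congr (_ * _); rewrite /gauss /gauss2 -!e2piD; congr e2pi.
have -> : P%:R = i%:R + j%:R - m%:R - 1 :> R[i].
  by rewrite -natrD -PE natrD -natr1; ring.
have -> : Q%:R = i%:R + m%:R - j%:R :> R[i] by rewrite -natrD -QE natrD; ring.
by rewrite /half_index; field.
Qed.

(** The same square |p|, |q| <= m, expressed through the indices [i] and [j] of the two series,
    where p = i + j - 2m - 1 and q = i - j. *)
Definition inbox m (ij : nat * nat) : bool :=
  [&& (m < ij.1 + ij.2)%N, (ij.1 + ij.2 <= 3 * m + 1)%N,
      (ij.2 <= ij.1 + m)%N & (ij.1 <= ij.2 + m)%N].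

Lemma boxsum_reindex m u v :
  \sum_(ij : 'I_(2 * m).+2 * 'I_(2 * m).+2 | inbox m (val ij.1, val ij.2))
    theta_term tau m (u + v) ij.1 * theta_term tau m (u - v) ij.2 = boxsum m u v.
Proof.
rewrite /boxsum pair_big_dep /=.
pose f (pq : 'I_(2 * m).+1 * 'I_(2 * m).+1) : 'I_(2 * m).+2 * 'I_(2 * m).+2 :=
  (inord ((pq.1 + pq.2).+1 %/ 2), inord ((pq.1 + 2 * m + 1 - pq.2) %/ 2)).
pose g (ij : 'I_(2 * m).+2 * 'I_(2 * m).+2) : 'I_(2 * m).+1 * 'I_(2 * m).+1 :=
  (inord (ij.1 + ij.2 - m.+1), inord (ij.1 + m - ij.2)).
have fE (P Q : 'I_(2 * m).+1) : (f (P, Q)).1 = ((P + Q).+1 %/ 2)%N :> nat /\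
    (f (P, Q)).2 = ((P + 2 * m + 1 - Q) %/ 2)%N :> nat.
  by have lP := ltn_ord P; have lQ := ltn_ord Q; rewrite /f /= !inordK //; lia.
have gE (i j : 'I_(2 * m).+2) : (i + j - m.+1 < (2 * m).+1)%N ->
    (i + m - j < (2 * m).+1)%N ->
    (g (i, j)).1 = (i + j - m.+1)%N :> nat /\ (g (i, j)).2 = (i + m - j)%N :> nat.
  by move=> h1 h2; rewrite /g /= !inordK.
clearbody f g.
rewrite (reindex_onto f g); last first.
  move=> [i j]; rewrite /inbox [val _]/= => /and4P[/= h1 h2 h3 h4].
  have li := ltn_ord i; have lj := ltn_ord j.
  have [||g1 g2] := gE i j; [lia | lia |].
  move: g1 g2; case: (g (i, j)) => P Q /= g1 g2.
  have [f1 f2] := fE P Q; move: f1 f2; case: (f (P, Q)) => i' j' /= f1 f2.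
  by congr (_, _); apply: val_inj => /=; rewrite ?f1 ?f2 g1 g2; clear -h1 h2 h3 h4; lia.
apply: eq_big => [[P Q]|[P Q]] /=.
  have [f1 f2] := fE P Q; move: f1 f2; case: (f (P, Q)) => i j /= f1 f2.
  have lP := ltn_ord P; have lQ := ltn_ord Q; have := gE i j; rewrite /inbox /= f1 f2.
  case: (g (i, j)) => P' Q' /=; rewrite xpair_eqE -!(inj_eq val_inj) /=.
  have [o|o] := boolP (odd (P + Q)) => gg.
    have [||-> ->] := gg; [lia | lia |]; lia.
  apply/negbTE/negP => /andP[/and4P[h1 h2 h3 h4] /andP[/eqP e1 /eqP e2]].
  have [||g1 g2] := gg; lia.
move=> /andP[bx /eqP gf].
have [f1 f2] := fE P Q; move: f1 f2 gf bx; case: (f (P, Q)) => i j /= f1 f2 gf.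
rewrite /inbox /= => /and4P[h1 h2 h3 h4].
have [||] := gE i j; [lia | lia |]; rewrite gf /= => e1 e2.
by apply: theta_term_mul; lia.
Qed.

(** Outside the box the distances of [i] and [j] from the centre add up to at least [m], so each
    missing product is of order |q|^m, and there are at most (2m + 2)^2 of them. *)
Lemma boxsum_ccvg u v :
  ccvg (fun m => theta_sum tau m (u + v) * theta_sum tau m (u - v) - boxsum m u v) 0.
Proof.
have [C C0 CP] := theta_term_bound htau (u + v); have [C' C'0 C'P] := theta_term_bound htau (u - v).
have q0 := cnorm_ge0 q; have q1 := cnorm_q_lt1 htau.
apply: (@ccvg_le _ _ _ (fun m => C * C' * 4 * (m.+1%:R ^+ 2 * cnorm q ^+ m))); last first.
  by move=> e e0; apply: (quadratic_geometric_small htau); rewrite // !mulr_ge0.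
move=> m; rewrite subr0 /theta_sum addn2 big_distrlr /= pair_big /=.
rewrite (bigID (fun ij : 'I_(2 * m).+2 * 'I_(2 * m).+2 => inbox m (val ij.1, val ij.2))) /=.
rewrite boxsum_reindex addrAC subrr add0r.
apply: le_trans (cnorm_sum _ _ _) _.
apply: le_trans (_ : \sum_(ij : 'I_(2 * m).+2 * 'I_(2 * m).+2) (C * C' * cnorm q ^+ m) <= _).
  rewrite big_mkcond; apply: ler_sum => -[i j] _ /=; case: ifP => [nb|_]; last first.
    by rewrite !mulr_ge0 ?exprn_ge0.
  have dist k : ((k - m) + (m - k))%:R <= `|k%:R - m%:R - 1 / 2| + 1 :> R.
    have [km|km] := leqP k m.
      have : k%:R <= m%:R :> R by rewrite ler_nat.
      rewrite (eqP (_ : (k - m == 0)%N)) ?subn_eq0 // add0n natrB // => h.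
      by rewrite ler0_norm; lra.
    have : m.+1%:R <= k%:R :> R by rewrite ler_nat.
    rewrite (eqP (_ : (m - k == 0)%N)) ?subn_eq0 ?(ltnW km) // addn0.
    by rewrite natrB ?(ltnW km) // -natr1 => h; rewrite ger0_norm; lra.
  have h1 := CP m i _ (dist i); have h2 := C'P m j _ (dist j).
  apply: le_trans (_ : C * cnorm q ^+ ((i - m) + (m - i)) *
    (C' * cnorm q ^+ ((j - m) + (m - j))) <= _).
    by rewrite cnormM ler_pM ?cnorm_ge0.
  rewrite mulrACA -exprD ler_wpM2l ?mulr_ge0 //.
  have le : (m <= (i - m + (m - i)) + (j - m + (m - j)))%N.
    by move: nb; rewrite /inbox /= => nb; lia.
  by rewrite -(subnK le) exprD ler_piMl ?exprn_ge0 // exprn_ile1 // ltW.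
rewrite sumr_const card_prod !card_ord.
have e2 : (2 * m).+2%:R = 2 * m.+1%:R :> R by rewrite -natrM; congr (_%:R); lia.
by rewrite -[X in X <= _]mulr_natr natrM e2 le_eqVlt; apply/orP; left; apply/eqP; ring.
Qed.

Definition boxpart (b : bool) m u : R[i] :=
  \sum_(P < (2 * m).+1 | odd P == b) gauss2 u (P%:R - m%:R).

(** Exactly one of [P] and [Q] is odd, and the sign depends only on the parity of [P]; each of the
    two cases is a product of a sum over [P] and a sum over [Q]. *)
Lemma boxsum_det m u v : boxsum m u v = (-1) ^+ m.+1 *
  (boxpart false m u * boxpart true m v - boxpart true m u * boxpart false m v).
Proof.
rewrite /boxsum (bigID (fun P : 'I_(2 * m).+1 => odd P)) /= addrC mulrBr; congr (_ + _).
  rewrite /boxpart mulr_suml mulr_sumr; apply: eq_big => [P|P oP]; first by case: odd.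
  rewrite mulr_sumr mulr_sumr; apply: eq_big => [Q|Q oQ].
    by rewrite oddD (negbTE oP); case: odd.
  by rewrite /boxterm exprD -signr_odd (negbTE oP) expr0 mul1r.
rewrite /boxpart mulr_suml mulr_sumr -sumrN; apply: eq_big => [P|P oP]; first by case: odd.
rewrite mulr_sumr mulr_sumr -sumrN; apply: eq_big => [Q|Q oQ].
  by rewrite oddD oP; case: odd.
by rewrite /boxterm exprD -signr_odd oP expr1 mulN1r mulNr.
Qed.

Lemma theta_addition u v :
  ccvg (fun m => theta_const tau ^+ 2 * boxsum m u v) (th (u + v) * th (u - v)).
Proof.
have h := ccvgM (theta_sum_ccvg htau (u + v)) (theta_sum_ccvg htau (u - v)).
apply: ccvg_dist h _.
have := ccvgN (ccvgM (ccvg_cst (theta_const tau ^+ 2)) (boxsum_ccvg u v)).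
by rewrite mulr0 oppr0; apply: ccvg_ext => m; ring.
Qed.

(** The relation already holds for every finite [m], as an identity between 2 by 2 determinants
    checked by [ring]; only then is the limit taken. *)
Lemma theta_plucker (a b c d : R[i]) :
  th (a + b) * th (a - b) * (th (c + d) * th (c - d)) -
  th (a + c) * th (a - c) * (th (b + d) * th (b - d)) +
  th (a + d) * th (a - d) * (th (b + c) * th (b - c)) = 0.
Proof.
have h x y := theta_addition x y.
apply: ccvg_eq (ccvgD (ccvgB (ccvgM (h a b) (h c d)) (ccvgM (h a c) (h b d)))
  (ccvgM (h a d) (h b c))) _.
apply: ccvg_ext (ccvg_cst 0) => m; rewrite !boxsum_det; ring.
Qed.

Lemma theta_three_term : three_term th.
Proof.
move=> p r s t e ee; have eE : e = (p + r + s + t) / 2 by rewrite -ee; field.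
have := theta_plucker ((p + r) / 2) ((p - r) / 2) ((s + t) / 2) ((s - t) / 2).
have -> : (p + r) / 2 + (p - r) / 2 = p by field.
have -> : (p + r) / 2 - (p - r) / 2 = r by field.
have -> : (s + t) / 2 + (s - t) / 2 = s by field.
have -> : (s + t) / 2 - (s - t) / 2 = t by field.
have -> : (p + r) / 2 + (s + t) / 2 = e by rewrite eE; field.
have -> : (p + r) / 2 - (s + t) / 2 = e - s - t by rewrite eE; field.
have -> : (p - r) / 2 + (s - t) / 2 = e - r - t by rewrite eE; field.
have -> : (p - r) / 2 - (s - t) / 2 = e - r - s by rewrite eE; field.
have -> : (p + r) / 2 + (s - t) / 2 = e - t by rewrite eE; field.
have -> : (p + r) / 2 - (s - t) / 2 = e - s by rewrite eE; field.
have -> : (p - r) / 2 + (s + t) / 2 = e - r by rewrite eE; field.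
have -> : (p - r) / 2 - (s + t) / 2 = - (e - p) by rewrite eE; field.
rewrite theta_odd => /eqP; rewrite addrAC subr_eq0 => /eqP h.
transitivity (th p * th r * (th s * th t)); first by ring.
transitivity (th p * th r * (th s * th t) + th (e - t) * th (e - s) * (th (e - r) * - th (e - p)) +
  th (e - p) * th (e - r) * th (e - s) * th (e - t)); first by ring.
by rewrite h; ring.
Qed.

End ThetaFay.

(** * Exceptional dynamical parameters *)

Section Perturbation.
Variables (R : realType) (n N : nat) (tau h : R[i]) (lam : N.-tuple nat).
Hypothesis htau : 0 < complex.Im tau.
Local Notation th := (theta tau).
Local Notation L := (lamsum lam).
Implicit Types (z : n.-tuple R[i]) (t : nat -> nat -> R[i]) (I : N.-tuple {set 'I_n}).

Lemma harmonic_small (d : R) : 0 < d ->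
  exists M, forall m, (M <= m)%N -> `|harmonic m : R| < d.
Proof.
move=> d0; have /cvgrPdist_lt/(_ _ d0)[M _ MP] := @cvg_harmonic R.
by exists M => m /MP; rewrite sub0r normrN.
Qed.

Lemma complexBM (a b s : R) :
  ((a - b) * s)%:C%C = (a * s)%:C%C - (b * s)%:C%C :> R[i].
Proof. by rewrite mulrBl (rmorphB (real_complex R)). Qed.

Lemma eventually_all (T : finType) (P : T -> nat -> Prop) :
  (forall x, exists M, forall m, (M <= m)%N -> P x m) ->
  exists M, forall m, (M <= m)%N -> forall x, P x m.
Proof.
move=> H; have [M MP] := choice H.
exists (\max_x M x) => m le x; apply: MP; apply: leq_trans le.
exact: leq_bigmax.
Qed.

Section Continuity.
Variables (w : nat -> R) (mu : N.-tuple R[i]) (mus : nat -> N.-tuple R[i]).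
Hypothesis musE : forall m k, (mus m)`_k = mu`_k + 'i%C * (w k * harmonic m)%:C%C.

Lemma ccvg_psi I k a c u : th (dynarg I k a h mu) != 0 ->
  ccvg (fun m => psi tau I k a c h (mus m) u) (psi tau I k a c h mu u).
Proof.
move=> reg; have dynE m : dynarg I k a h (mus m) =
    dynarg I k a h mu + 'i%C * ((w k - w (block I k a)) * harmonic m)%:C%C.
  by rewrite /dynarg !musE complexBM; ring.
have dyn_ccvg x : ccvg (fun m => th (x + dynarg I k a h (mus m))) (th (x + dynarg I k a h mu)).
  apply: ccvg_ext (ccvg_theta_shift htau (x + dynarg I k a h mu)
    (w k - w (block I k a)) harmonic_small) => m.
  by rewrite dynE (addrA x (dynarg _ _ _ _ _)).
rewrite /psi; case: ifP => _; first exact: ccvg_cst.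
case: ifP => _; first exact: ccvg_cst.
apply: ccvgM; first exact: dyn_ccvg.
apply: ccvgV => //; have H := dyn_ccvg 0; rewrite add0r in H.
by apply: ccvg_ext H => m; rewrite add0r.
Qed.

Lemma ccvg_Wsummand I z t : dyn_regular tau lam I h mu ->
  ccvg (fun m => Wsummand tau lam I z h (mus m) t) (Wsummand tau lam I z h mu t).
Proof.
move=> reg; apply: ccvg_prod => k; rewrite mem_index_iota => kN _.
apply: ccvg_prod => a; rewrite mem_index_iota => aL _.
apply: ccvgM; last exact: ccvg_cst.
by apply: ccvg_prod => c _ _; apply: ccvg_psi; apply: reg.
Qed.

Lemma ccvg_Well I z t : dyn_regular tau lam I h mu ->
  ccvg (fun m => Well tau lam I t z h (mus m)) (Well tau lam I t z h mu).
Proof.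
move=> reg; apply: ccvgM; first exact: ccvg_cst.
have : forall t', ccvg (fun m => Wsummand tau lam I z h (mus m) t')
  (Wsummand tau lam I z h mu t') by move=> t'; apply: ccvg_Wsummand.
elim: (index_iota 1 N) t => [|k ks IH] t' H /=; first exact: H.
by apply: ccvg_sum => s _; apply: IH.
Qed.

(** Finitely many arguments have to avoid the zeros of theta. Each one moves vertically with the
    nonzero speed [w k - w j], so [theta_shift_neq0] applies to it for small shifts. *)
Lemma dyn_generic_eventually M : (forall j k, (j < k < N)%N -> w k != w j) ->
  exists M0, forall m, (M0 <= m)%N -> dyn_generic th h (mu_fun (mus m)) M N.
Proof.
move=> wne.
have [x|M0 M0P] := @eventually_all ('I_N * 'I_N * ('I_M.+1 * 'I_M.+1))%type
  (fun x m => (x.1.1 < x.1.2)%N -> th ((x.2.1%:R - x.2.2%:R) * h +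
     mu_fun (mus m) x.1.2 - mu_fun (mus m) x.1.1) != 0).
  case: x => [[j k] [p p']] /=; have [jk|] := boolP (j < k)%N; last by exists 0%N.
  have c0 : w k - w j != 0 by rewrite subr_eq0 wne // jk ltn_ord.
  have [e0 e00 e0P] := theta_shift_neq0 htau
    ((p%:R - p'%:R) * h + mu`_k - mu`_j) c0.
  have [M1 M1P] := harmonic_small e00; exists M1 => m /M1P lt _.
  have := e0P (harmonic m); rewrite harmonic_gt0 (le_lt_trans (ler_norm _) lt) => /(_ isT).
  congr (~~ (th _ == 0)); rewrite /mu_fun !musE complexBM; ring.
exists M0 => m /M0P H j k p p' /andP[jk kN] pM p'M.
exact: (H (Ordinal (ltn_trans jk kN), Ordinal kN,
  (Ordinal (pM : (p < M.+1)%N), Ordinal (p'M : (p' < M.+1)%N)))).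
Qed.

End Continuity.

(** The distinct weights [k] make every difference of two entries move. *)
Definition shift_mu (mu : N.-tuple R[i]) m : N.-tuple R[i] :=
  [tuple tnth mu k + 'i%C * ((val k)%:R * harmonic m)%:C%C | k < N].

(* Vanishes beyond N, like the default value of the entries of mu. *)
Definition shift_weight (k : nat) : R := if (k < N)%N then k%:R else 0.

Lemma shift_muE (mu : N.-tuple R[i]) m k :
  (shift_mu mu m)`_k = mu`_k + 'i%C * (shift_weight k * harmonic m)%:C%C.
Proof.
rewrite /shift_weight; case: ifP => [kN|/negbT]; last first.
  by rewrite -leqNgt => Nk; rewrite !nth_default ?size_tuple // mul0r mulr0 addr0.
have [i <-] : exists i : 'I_N, val i = k by exists (Ordinal kN).
by rewrite -[LHS](tnth_nth 0) tnth_mktuple (tnth_nth 0).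
Qed.

Lemma dualmu_shiftE (mu : N.-tuple R[i]) m k :
  (dualmu lam h (shift_mu mu m))`_k =
  (dualmu lam h mu)`_k + 'i%C * (- shift_weight k * harmonic m)%:C%C.
Proof.
rewrite /shift_weight; case: ifP => [kN|/negbT]; last first.
  by rewrite -leqNgt => Nk; rewrite !nth_default ?size_tuple // oppr0 mul0r mulr0 addr0.
have [i <-] : exists i : 'I_N, val i = k by exists (Ordinal kN).
rewrite -[LHS](tnth_nth 0) -[X in _ = X + _](tnth_nth 0) !tnth_mktuple.
by rewrite mulNr (rmorphN (real_complex R)); ring.
Qed.

End Perturbation.

Theorem theorem2p9 (R : realType) (n N : nat) (hn : (0 < n)%N) (hN : (0 < N)%N)
    (lam : N.-tuple nat) (hlam : (\sum_(k < N) tnth lam k)%N = n)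
    (tau : R[i]) (htau : 0 < complex.Im tau)
    (z : n.-tuple R[i]) (h : R[i]) (mu : N.-tuple R[i])
    (J K : N.-tuple {set 'I_n})
    (hJ : J \in ordpart n lam) (hK : K \in ordpart n lam)
    (hz : forall a b : 'I_n, a != b -> theta tau (tnth z b - tnth z a) != 0)
    (hhz : forall a b : 'I_n, theta tau (h + tnth z b - tnth z a) != 0)
    (hmuJ : dyn_regular tau lam J h mu)
    (hmuK : dyn_regular tau lam (permpart (longest n)^-1%g K) h
              (dualmu lam h mu)) :
  \sum_(I in ordpart n lam)
     (Welltilde tau lam 1%g J (substz I z) z h mu *
      Welltilde tau lam (longest n) K (substz I z) z h (dualmu lam h mu)) /
     (Rell tau I z * Qell tau I z h)
  = (J == K)%:R.
Proof.
pose mus := shift_mu mu.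
have musE := shift_muE mu; have dmusE := dualmu_shiftE h lam mu.
have wne j k : (j < k < N)%N -> @shift_weight R N k != shift_weight R N j.
  move=> /andP[jk kN]; rewrite /shift_weight kN (ltn_trans jk kN) eqr_nat.
  by rewrite gtn_eqF.
have [M1 gen1] := dyn_generic_eventually h htau musE n wne.
(* The dual parameters contain mu with a minus sign and move in the opposite direction; their
   differences still have nonzero speed. *)
have [|M2 gen2] := dyn_generic_eventually h htau dmusE n.
  by move=> j k /wne; rewrite eqr_opp.
have ev m : (maxn M1 M2 <= m)%N -> \sum_(I in ordpart n lam)
    (Welltilde tau lam 1%g J (substz I z) z h (mus m) *
     Welltilde tau lam (longest n) K (substz I z) z h (dualmu lam h (mus m))) /
    (Rell tau I z * Qell tau I z h) = (J == K)%:R.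
  rewrite geq_max => /andP[/gen1 g1 /gen2 g2].
  exact: (orthogonality_generic (theta_odd tau) (theta_three_term htau)
    hn hN hlam hz hhz g1 g2 hJ hK).
have lim : ccvg (fun m => \sum_(I in ordpart n lam)
    (Welltilde tau lam 1%g J (substz I z) z h (mus m) *
     Welltilde tau lam (longest n) K (substz I z) z h (dualmu lam h (mus m))) /
    (Rell tau I z * Qell tau I z h)) (\sum_(I in ordpart n lam)
    (Welltilde tau lam 1%g J (substz I z) z h mu *
     Welltilde tau lam (longest n) K (substz I z) z h (dualmu lam h mu)) /
    (Rell tau I z * Qell tau I z h)).
  apply: ccvg_sum => I _; apply: ccvgM; last exact: ccvg_cst.
  apply: ccvgM; (apply: ccvgM; last exact: ccvg_cst).
    by apply: (ccvg_Well htau musE); rewrite permpart1.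
  exact: (ccvg_Well htau dmusE).
(* From some index on both parameter families are generic and the perturbed sum is constantly the
   Kronecker symbol, while regularity at mu lets it converge to the required sum. *)
apply: ccvg_eq lim _ => e e0; exists (maxn M1 M2) => m /ev ->.
by rewrite subrr cnorm0.
Qed.
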